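(* Let $v\in\mathbb{R}$ and $(\rho_L,q_L),(\rho_R,q_R)\in\mathbb{R}_+^*\times\mathbb{R}$. Suppose that the drag force writes $D(\alpha)=\lambda D_0(\alpha)$ with $\lambda>0$ and $D_0$ a fixed drag force, and let $(\rho^\lambda,q^\lambda)$ be the self-similar solution of the Riemann problem $$\begin{cases}\partial_t\rho+\partial_x q=0,\\ \partial_t q+\partial_x\left(\frac{q^2}{\rho}+c^2\rho\right)=-\lambda D_0(q-v\rho)\,\delta_{vt},\\ \rho(0,x)=\rho_L\mathbf{1}_{x<0}+\rho_R\mathbf{1}_{x>0},\quad q(0,x)=q_L\mathbf{1}_{x<0}+q_R\mathbf{1}_{x>0}.\end{cases}$$ When $\lambda\to+\infty$, $(\rho^\lambda,q^\lambda)$ tends (in $L^1_{loc}(\mathbb{R}_+\times\mathbb{R})$) to the solution of the Riemann problem with the same initial data for the Euler equations with a solid wall along $x=vt$. When $\lambda\to0$, $(\rho^\lambda,q^\lambda)$ tends (in $L^1_{loc}(\mathbb{R}_+\times\mathbb{R})$) to the solution of the Riemann problem with the same initial data for the Euler equations without particle.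
   Context: $c>0$ is a fixed constant. $D_0:\mathbb{R}\to\mathbb{R}$ is $\mathcal{C}^1$, increasing, with $D_0(0)=0$ and $D_0(\alpha)$ of the same sign as $\alpha$ ($>0$ for $\alpha>0$, $<0$ for $\alpha<0$). For each $\lambda>0$ the Riemann problem then has a unique self-similar solution in the following sense. Euler Riemann solution. For $(\rho_a,q_a),(\rho_b,q_b)\in\mathbb{R}_+^*\times\mathbb{R}$, $W(x/t;(\rho_a,q_a),(\rho_b,q_b))$ denotes the unique self-similar entropy solution of the isothermal Euler equations $\partial_t\rho+\partial_x q=0$, $\partial_t q+\partial_x(q^2/\rho+c^2\rho)=0$ with initial data $(\rho_a,q_a)$ for $x<0$ and $(\rho_b,q_b)$ for $x>0$; $W(v_\mp;\cdot)$ are its left/right limits at $x/t=v$. The solution ''without particle'' is $W(x/t;(\rho_L,q_L),(\rho_R,q_R))$. For a drag force $D(\alpha)$ and $\alpha\ne0$ let $F_\alpha(\rho)=\int_{|\alpha|/c}^{\rho}\frac{1}{|D(\alpha)|}\left(c^2-\frac{\alpha^2}{r^2}\right)dr$. Germ. $\mathcal{G}_D(v)$ is the set of pairs $((\rho_-,q_-),(\rho_+,q_+))\in(\mathbb{R}_+^*\times\mathbb{R})^2$ such that $q_--v\rho_-=q_+-v\rho_+=:\alpha$ and one of the following holds: - $\alpha=0$, $\rho_-=\rho_+$ and $q_-=q_+$; - $\alpha>0$, $(\frac{\alpha}{c}-\rho_+)(\frac{\alpha}{c}-\rho_-)\ge0$ and $F_\alpha(\rho_-)-F_\alpha(\rho_+)=1$;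 - $\alpha<0$, $(\frac{|\alpha|}{c}-\rho_+)(\frac{|\alpha|}{c}-\rho_-)\ge0$ and $F_\alpha(\rho_+)-F_\alpha(\rho_-)=1$; - $c\rho_-<\alpha$, $\rho_+\ge\frac{\alpha}{c}$ and there exist $\rho\in[\rho_-,\frac{\alpha}{c})$ and $\theta\in[0,1]$ with $F_\alpha(\rho_-)-F_\alpha(\rho)=\theta$ and $F_\alpha\left(\frac{\alpha^2}{c^2\rho}\right)-F_\alpha(\rho_+)=1-\theta$; - $\alpha<-c\rho_+$, $\rho_-\ge\frac{|\alpha|}{c}$ and there exist $\rho\in[\rho_+,\frac{|\alpha|}{c})$ and $\theta\in[0,1]$ with $F_\alpha(\rho_+)-F_\alpha(\rho)=\theta$ and $F_\alpha\left(\frac{\alpha^2}{c^2\rho}\right)-F_\alpha(\rho_-)=1-\theta$. Self-similar solution of the Riemann problem with drag force $D$: a function $(\rho,q)$ of $x/t$ for which there are states $(\rho_\pm,q_\pm)\in\mathbb{R}_+^*\times\mathbb{R}$ with $(\rho,q)=W(x/t;(\rho_L,q_L),(\rho_-,q_-))$ on $\{x<vt\}$ and $W(v_-;(\rho_L,q_L),(\rho_-,q_-))=(\rho_-,q_-)$; $(\rho,q)=W(x/t;(\rho_+,q_+),(\rho_R,q_R))$ on $\{x>vt\}$ and $W(v_+;(\rho_+,q_+),(\rho_R,q_R))=(\rho_+,q_+)$; and $((\rho_-,q_-),(\rho_+,q_+))\in\mathcal{G}_D(v)$. Solid wall solution along $x=vt$: the function of $x/t$ described in the same way by states $(\rho_\pm,q_\pm)$,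 $W(v_-;(\rho_L,q_L),(\rho_-,q_-))=(\rho_-,q_-)$ and $W(v_+;(\rho_+,q_+),(\rho_R,q_R))=(\rho_+,q_+)$, with the germ condition replaced by the impermeability condition $q_-=v\rho_-$ and $q_+=v\rho_+$ on both sides of the wall. *)

(* Defs.v *)
From HB Require Import structures.
From mathcomp Require Import all_boot all_order all_algebra.
From mathcomp Require Import all_classical all_reals all_analysis.
Import Order.TTheory GRing.Theory Num.Theory.
Import numFieldNormedType.Exports.

Set Implicit Arguments.
Unset Strict Implicit.
Unset Printing Implicit Defensive.

Local Open Scope classical_set_scope.
Local Open Scope ring_scope.

(* A state is a pair (rho, q) of a density and a momentum; scalar functions of
   time and space take their arguments in the order t, x. *)

Section Euler.
Context {R : realType}.
Variable c : R.
Local Notation mu := (@lebesgue_measure R).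
Local Notation state := (R * R)%type.

Definition flux_q (u : state) : R := u.2 ^+ 2 / u.1 + c ^+ 2 * u.1.

(* Mechanical energy and its flux: the internal energy c^2 rho ln rho is the one
   associated with the pressure c^2 rho. *)
Definition energy (u : state) : R :=
  u.2 ^+ 2 / (2 * u.1) + c ^+ 2 * u.1 * ln u.1.

Definition energy_flux (u : state) : R :=
  u.2 / u.1 * (energy u + c ^+ 2 * u.1).

Definition dt (phi : R -> R -> R) (t x : R) : R := derive1 (phi^~ x) t.

Definition dx (phi : R -> R -> R) (t x : R) : R := derive1 (phi t) x.

(* C^1 functions with compact support in R x R; the support may meet {t = 0}. *)
Definition test_function (phi : R -> R -> R) : Prop :=
  [/\ forall t x, derivable (phi^~ x) t 1 /\ derivable (phi t) x 1,
      continuous (fun z : R * R => dt phi z.1 z.2),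
      continuous (fun z : R * R => dx phi z.1 z.2) &
      exists2 K : set (R * R),
        compact K & forall t x, ~ K (t, x) -> phi t x = 0].

(* The distribution - d_t e(U) - d_x f(U) on t > 0, with the initial trace U0,
   applied to phi. *)
Definition weak_balance (e f : state -> R) (U0 : R -> state)
    (U : R -> R -> state) (phi : R -> R -> R) : R :=
  \int[mu]_(t in `]0, +oo[)
     (\int[mu]_x (e (U t x) * dt phi t x + f (U t x) * dx phi t x))
  + \int[mu]_x (e (U0 x) * phi 0 x).

(* Measurable, bounded and bounded away from the vacuum, on t > 0. *)
Definition admissible (U : R -> R -> state) : Prop :=
  [/\ measurable_fun [set z : R * R | 0 < z.1]
        (fun z : R * R => (U z.1 z.2).1),
      measurable_fun [set z : R * R | 0 < z.1]
        (fun z : R * R => (U z.1 z.2).2) &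
      exists r M : R, 0 < r /\
        forall t x, 0 < t ->
          [/\ r <= (U t x).1, (U t x).1 <= M & `|(U t x).2| <= M]].

Definition entropy_solution (U0 : R -> state) (U : R -> R -> state) : Prop :=
  [/\ admissible U,
      forall phi, test_function phi -> weak_balance fst snd U0 U phi = 0,
      forall phi, test_function phi -> weak_balance snd flux_q U0 U phi = 0 &
      forall phi, test_function phi -> (forall t x, 0 <= phi t x) ->
        0 <= weak_balance energy energy_flux U0 U phi].

Definition riemann_data (Ua Ub : state) (x : R) : state :=
  if x < 0 then Ua else Ub.

Definition self_similar (W : R -> state) (t x : R) : state := W (x / t).

(* W is a representative, as a function of x / t, of the solution
   W( . ; Ua, Ub). *)
Definition euler_riemann_solution (Ua Ub : state) (W : R -> state) : Prop :=
  entropy_solution (riemann_data Ua Ub) (self_similar W).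

(* Solutions made of two Euler Riemann solutions, one on each side of x = v t,
   whose traces on that line satisfy the interface condition G.  The value at
   x / t = v itself is left free. *)
Definition interface_riemann_solution (G : state -> state -> Prop) (v : R)
    (UL UR : state) (U : R -> state) : Prop :=
  exists Um Up : state,
    [/\ 0 < Um.1, 0 < Up.1, G Um Up,
        exists W : R -> state,
          [/\ euler_riemann_solution UL Um W,
              W xi @[xi --> v^'-] --> Um &
              forall xi, xi < v -> U xi = W xi] &
        exists W : R -> state,
          [/\ euler_riemann_solution Up UR W,
              W xi @[xi --> v^'+] --> Up &
              forall xi, v < xi -> U xi = W xi]].

Definition oriented_integral (a b : R) (f : R -> R) : R :=
  if a <= b then \int[mu]_(r in `[a, b]) f r
  else - \int[mu]_(r in `[b, a]) f r.

Definition germ_F (D : R -> R) (alpha rho : R) : R :=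
  oriented_integral (`|alpha| / c) rho
    (fun r => 1 / `|D alpha| * (c ^+ 2 - alpha ^+ 2 / r ^+ 2)).

Definition germ (D : R -> R) (v : R) (Um Up : state) : Prop :=
  let: (rhom, qm) := Um in
  let: (rhop, qp) := Up in
  let alpha := qm - v * rhom in
  [/\ 0 < rhom, 0 < rhop, qm - v * rhom = qp - v * rhop &
   [\/ [/\ alpha = 0, rhom = rhop & qm = qp],
       [/\ 0 < alpha, 0 <= (alpha / c - rhop) * (alpha / c - rhom) &
           germ_F D alpha rhom - germ_F D alpha rhop = 1],
       [/\ alpha < 0, 0 <= (`|alpha| / c - rhop) * (`|alpha| / c - rhom) &
           germ_F D alpha rhop - germ_F D alpha rhom = 1] |
       [/\ c * rhom < alpha, alpha / c <= rhop &
           exists rho theta : R,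
             [/\ rhom <= rho < alpha / c, 0 <= theta <= 1,
                 germ_F D alpha rhom - germ_F D alpha rho = theta &
                 germ_F D alpha (alpha ^+ 2 / (c ^+ 2 * rho))
                   - germ_F D alpha rhop
                   = 1 - theta]]
       \/
       [/\ alpha < - (c * rhop), `|alpha| / c <= rhom &
           exists rho theta : R,
             [/\ rhop <= rho < `|alpha| / c, 0 <= theta <= 1,
                 germ_F D alpha rhop - germ_F D alpha rho = theta &
                 germ_F D alpha (alpha ^+ 2 / (c ^+ 2 * rho))
                   - germ_F D alpha rhom
                   = 1 - theta]]]].

Definition particle_riemann_solution (D : R -> R) (v : R) :=
  interface_riemann_solution (germ D v) v.

Definition wall_condition (v : R) (Um Up : state) : Prop :=
  Um.2 = v * Um.1 /\ Up.2 = v * Up.1.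

Definition wall_riemann_solution (v : R) :=
  interface_riemann_solution (wall_condition v) v.

End Euler.

Section Convergence.
Context {R : realType}.

Definition drag_force (D : R -> R) : Prop :=
  [/\ (forall a, derivable D a 1) /\ continuous (derive1 D),
      {homo D : a b / a <= b},
      D 0 = 0,
      forall a, 0 < a -> 0 < D a &
      forall a, a < 0 -> D a < 0].

(* Convergence in L^1_loc(R_+ x R), along the filter F on the parameter. *)
Definition cvg_L1loc (F : set_system R) (U : R -> R -> R -> R * R)
    (V : R -> R -> R * R) : Prop :=
  forall K : set (R * R), compact K -> K `<=` [set z | 0 <= z.1] ->
    (\int[(@lebesgue_measure R \x @lebesgue_measure R)%E]_(z in K)
       (`|(U lam z.1 z.2).1 - (V z.1 z.2).1|
        + `|(U lam z.1 z.2).2 - (V z.1 z.2).2|)%:E)%E @[lam --> F] --> 0%E.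

End Convergence.

(* Main.v *)
Require Import Defs.
From HB Require Import structures.
From mathcomp Require Import all_boot all_order all_algebra.
From mathcomp Require Import all_classical all_reals all_analysis.
From mathcomp Require Import measurable_realfun ring lra.
Import Order.TTheory GRing.Theory Num.Theory.
Import numFieldNormedType.Exports.
Set Implicit Arguments.
Unset Strict Implicit.
Unset Printing Implicit Defensive.
Local Open Scope classical_set_scope.
Local Open Scope ring_scope.

(** In the variable xi = x / t, put m = q - xi rho and P = m^2 / rho + c^2 rho: the fluxes of mass
and momentum across the ray x = xi t, in the frame of that ray. A self-similar entropy solution
satisfies m' = - rho and P' = - 2 m, so that m and P are continuous and m is strictly decreasing,
and the energy flux m (m^2 / (2 rho^2) + c^2 ln rho) may jump downwards only ([entropy_simil]).
The zero of m is the contact, which moves with the fluid.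

To the left of the contact, rho is one of the two roots of P rho = m^2 + c^2 rho^2. The entropy
inequality allows a single passage, at some x1, from the smaller (supersonic) root to the larger
(subsonic) one ([transition]); elsewhere the state is constant, or sonic along a fan. The wave
issued from (rho_L, q_L) is therefore an explicit function of x1 alone ([left_explicit]), and
waves with the same outer state are ordered: when x1 decreases, rho and P increase and m
decreases ([left_cmp]). In particular the L^1 distance of two waves up to a ray is the difference
of their mass fluxes there. The right wave is the left wave of the reflected flow.

The germ says that P jumps down by lambda D0(alpha) at the particle, where alpha is the common
value of m on the two sides, and that a flow which enters subsonic leaves subsonic ([germ_jump]).
By reflection it is enough to treat alpha >= 0.

When lambda tends to infinity, comparison at v with the wall solution, for which m(v) = 0, shows
that lambda D0(alpha) is at most the pressure on the wall ([wall_jump]); hence alpha tends to 0.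
Upstream the L^1 distance to the wall solution is then alpha. Downstream the density is bounded
below by the pressure, so the contact is at distance O(alpha) from v, and beyond it the right
waves are compared ([wall_limit]).

When lambda tends to 0, alpha stays bounded ([flux_bound]), so the jump of P tends to 0. A small
jump either moves the density a little along one of the two branches or acts as a shock which
stands still on the ray xi = v; in all cases the density on both sides of v is uniformly close,
up to the contact, to that of a single wave issued from (rho_L, q_L) ([particle_approx]). The
Euler solution has such a wave too. Its pressure has a quadratic minimum at its contact, whereas
the ordering of the two left waves and of the two right waves leaves only a small gap between the
pressures; this brings the contacts together and yields L^1 closeness ([flow_stability],
[euler_limit]).

Finally, on a compact set of space-time the L^1 distance is an integral over t of dilated L^1
distances in xi ([self_similar_integral]). *)

(** * Integrals of locally bounded functions *)

Section Integral.
Context {R : realType}.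
Local Notation mu := (@lebesgue_measure R).
Implicit Types (f g : R -> R) (a b d : R) (G : set R).

(** This class is stable under the algebraic operations and its members are integrable on every
segment, so that integrability need not be carried along separately. *)
Definition locbm f := measurable_fun setT f /\
  forall A, exists M, forall x, `|x| <= A -> `|f x| <= M.

(** Relations that hold almost everywhere are collected in an explicit set of full measure, which
is convenient because such sets are dense and stable under finite intersection. *)
Definition conull G := mu.-negligible (~` G).

Definition Iab a b f : R := \int[mu]_(x in `[a, b]) f x.

Lemma locbm_cst k : locbm (fun _ => k).
Proof. by split => // A; exists `|k|. Qed.

Lemma locbm_cont f : continuous f -> locbm f.
Proof.
move=> cf; split; first exact: continuous_measurable_fun.
move=> A.
have [A0|A0] := ltP A 0.
  by exists 0 => x /le_lt_trans /(_ A0); rewrite normr_lt0.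
have AA : - A <= A by lra.
have cw : {within `[- A, A], continuous f}.
  exact: continuous_subspaceT.
have [c1 _ H1] := EVT_max AA cw.
have [c2 _ H2] := EVT_min AA cw.
exists (`|f c1| + `|f c2|) => x.
rewrite ler_norml => xA.
have xin : x \in `[- A, A] by rewrite in_itv.
have h1 := H1 _ xin; have h2 := H2 _ xin.
rewrite ler_norml; apply/andP; split.
  have := ler_norm (- f c2); rewrite normrN => ?; have := normr_ge0 (f c1); lra.
have := ler_norm (f c1) => ?; have := normr_ge0 (f c2); lra.
Qed.

Lemma locbmD f g : locbm f -> locbm g -> locbm (fun x => f x + g x).
Proof.
move=> [mf bf] [mg bg]; split; first exact: measurable_funD.
move=> A; have [M1 H1] := bf A; have [M2 H2] := bg A.
exists (M1 + M2) => x xA; apply: le_trans (ler_normD _ _) _.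
by rewrite lerD ?H1 ?H2.
Qed.

Lemma locbmM f g : locbm f -> locbm g -> locbm (fun x => f x * g x).
Proof.
move=> [mf bf] [mg bg]; split; first exact: measurable_funM.
move=> A; have [M1 H1] := bf A; have [M2 H2] := bg A.
by exists (M1 * M2) => x xA; rewrite normrM ler_pM ?H1 ?H2.
Qed.

Lemma locbmN f : locbm f -> locbm (fun x => - f x).
Proof.
move=> hf; have := locbmM (locbm_cst (-1)) hf.
by under eq_fun do rewrite mulN1r.
Qed.

Lemma locbmB f g : locbm f -> locbm g -> locbm (fun x => f x - g x).
Proof. by move=> hf hg; exact: locbmD hf (locbmN hg). Qed.

Lemma locbm_norm f : locbm f -> locbm (fun x => `|f x|).
Proof.
move=> [mf bf]; split; first exact: measurableT_comp.
by move=> A; have [M H] := bf A; exists M => x; rewrite normr_id; exact: H.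
Qed.

Lemma locbm_id : locbm (fun x : R => x).
Proof. by split => // A; exists A. Qed.

Lemma locbm_itv f a b : locbm f -> exists2 M, 0 <= M & forall x, a <= x <= b -> `|f x| <= M.
Proof.
move=> [_ bf]; have [M H] := bf (`|a| + `|b|).
exists `|M| => // x /andP[ax xb]; apply: le_trans (ler_norm M); apply: H.
rewrite ler_norml; have := ler_norm (- a); have := ler_norm b; rewrite normrN.
by move=> ? ?; have := normr_ge0 a; have := normr_ge0 b; move=> ? ?; apply/andP; split; lra.
Qed.

Lemma locbm_int f a b : locbm f -> mu.-integrable `[a, b] (EFin \o f).
Proof.
move=> hf; have [M M0 HM] := @locbm_itv f a b hf.
apply: (@le_integrable _ _ _ mu _ _ _ (EFin \o (fun=> M))) => //.
- by apply/measurable_EFinP; apply: measurable_funTS; case: hf.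
- move=> x /=; rewrite in_itv/= => xab.
  by rewrite /abse /= lee_fin (ger0_norm M0); exact: HM.
- apply: continuous_compact_integrable; first exact: segment_compact.
  by move=> x; exact: cvg_cst.
Qed.

Lemma IabE a b f : (locbm f) -> (Iab a b f)%:E = (\int[mu]_(x in `[a, b]) (f x)%:E)%E.
Proof. by move=> hf; rewrite /Iab /Rintegral fineK //; apply: integrable_fin_num => //; exact: locbm_int. Qed.

Lemma Iab_split f a b d : locbm f -> a <= b -> b <= d ->
  Iab a d f = Iab a b f + Iab b d f.
Proof.
move=> hf ab bd; rewrite /Iab.
have := @Rintegral_itvB R f (BLeft a) (BRight d) b (locbm_int _ _ hf).
rewrite !bnd_simp => /(_ ab bd) => /eqP; rewrite subr_eq addrC => /eqP ->.
rewrite Rintegral_itv_obnd_cbnd //.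
apply: (integrableS _ _ _ (locbm_int b d hf)) => //.
by apply: subset_itvr; rewrite bnd_simp.
Qed.

Lemma IabD f g a b : locbm f -> locbm g ->
  Iab a b (fun x => f x + g x) = Iab a b f + Iab a b g.
Proof. by move=> hf hg; rewrite /Iab RintegralD //; exact: locbm_int. Qed.

Lemma IabB f g a b : locbm f -> locbm g ->
  Iab a b (fun x => f x - g x) = Iab a b f - Iab a b g.
Proof. by move=> hf hg; rewrite /Iab RintegralB //; exact: locbm_int. Qed.

Lemma IabZ k f a b : locbm f -> Iab a b (fun x => k * f x) = k * Iab a b f.
Proof. by move=> hf; rewrite /Iab RintegralZl //; exact: locbm_int. Qed.

Lemma Iab_cst k a b : a <= b -> Iab a b (fun=> k) = k * (b - a).
Proof.
move=> ab; have -> : Iab a b (fun=> k) = k * fine (mu `[a, b]) by exact: Rintegral_cst.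
rewrite lebesgue_measure_itv /= lte_fin.
by move: ab; rewrite le_eqVlt => /predU1P[->|->] //; rewrite ltxx /= subrr.
Qed.

Lemma conullI G1 G2 : conull G1 -> conull G2 -> conull (G1 `&` G2).
Proof. by rewrite /conull setCI; exact: negligibleU. Qed.

Lemma conullS G1 G2 : G1 `<=` G2 -> conull G1 -> conull G2.
Proof. by move=> s; apply: negligibleS; exact: subsetC. Qed.

Lemma conullD1 a : conull [set x | x <> a].
Proof.
rewrite /conull.
have : mu.-negligible [set a] by apply/negligibleP => //; exact: lebesgue_measure_set1.
by apply: negligibleS => x /= /contrapT ->.
Qed.

Lemma conullT : conull setT.
Proof. by rewrite /conull setCT; exact: negligible_set0. Qed.

Lemma conull_dense G a b : conull G -> a < b -> exists x, G x /\ a < x < b.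
Proof.
move=> cG ab; apply: contrapT => H.
have : mu.-negligible `]a, b[.
  apply: negligibleS cG => x /=; rewrite in_itv /= => xab Gx.
  by apply: H; exists x.
move=> /negligibleP => /(_ (measurable_itv _)) H0.
have : (mu `]a, b[ = 0)%E by exact: H0.
rewrite lebesgue_measure_itv /= lte_fin ab => /eqP.
by rewrite eqe subr_eq0 (gt_eqF ab).
Qed.

Lemma Iab_le G f g a b : conull G -> locbm f -> locbm g ->
  (forall x, G x -> a < x < b -> f x <= g x) -> Iab a b f <= Iab a b g.
Proof.
move=> cG hf hg fg.
have cG' : conull [set x | a < x < b -> f x <= g x].
  by apply: conullS cG => x Gx /=; exact: fg.
rewrite -subr_ge0 -IabB // -lee_fin IabE; last exact: locbmB.
have [ab|ba] := ltP a b; last first.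
  move: ba; rewrite le_eqVlt => /predU1P[->|ba].
    by rewrite set_itv1 integral_set1.
  by rewrite set_itv_ge ?bnd_simp -?ltNge // integral_set0.
pose h x := Num.max (g x - f x) 0.
have mgf : measurable_fun setT (fun x => g x - f x) by case: (locbmB hg hf).
rewrite (@ae_eq_integral _ _ _ mu _ (EFin \o h)) //=.
- by apply: integral_ge0 => x _; rewrite lee_fin /h le_max lexx orbT.
- by apply/measurable_EFinP; apply: measurable_funTS.
- apply/measurable_EFinP; apply: measurable_funTS; rewrite /h.
  exact: measurable_maxr.
- have c3 := conullI (conullI cG' (conullD1 a)) (conullD1 b).
  apply: negligibleS c3 => x /= H [[H1 H2] H3]; apply: H => /=.
  rewrite in_itv /= => /andP[ax xb].
  rewrite /h; congr (_%:E); apply/esym/max_idPl.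
  rewrite subr_ge0; apply: H1.
  rewrite !lt_neqAle ax xb !andbT; apply/andP; split; apply/eqP; first by move=> /esym.
  by move=> ?; exact: H3.
Qed.

Lemma Iab_ae G f g a b : conull G -> locbm f -> locbm g ->
  (forall x, G x -> a < x < b -> f x = g x) -> Iab a b f = Iab a b g.
Proof.
move=> cG hf hg fg; apply/le_anti/andP; split; apply: (Iab_le cG) => // x Gx xab;
  by rewrite fg.
Qed.

Lemma Iab_norm f a b : locbm f -> `|Iab a b f| <= Iab a b (fun x => `|f x|).
Proof. by move=> hf; apply: le_normr_Rintegral => //; exact: locbm_int. Qed.

Lemma Iab_bound G f a b k : conull G -> locbm f -> a <= b ->
  (forall x, G x -> a < x < b -> `|f x| <= k) -> `|Iab a b f| <= k * (b - a).
Proof.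
move=> cG hf ab fk; rewrite -Iab_cst // ler_norml -mulN1r -IabZ; last exact: locbm_cst.
by apply/andP; split; apply: (Iab_le cG) => //; rewrite ?mulN1r;
  do ?[exact: locbm_cst | exact: (locbmM (locbm_cst _) (locbm_cst _))];
  move=> x Gx xab; have := fk _ Gx xab; rewrite ler_norml => /andP[]; rewrite ?mulN1r.
Qed.

Lemma primitive_exists f : locbm f ->
  exists F : R -> R, forall a b, a <= b -> F b - F a = Iab a b f.
Proof.
move=> hf; exists (fun x => if 0 <= x then Iab 0 x f else - Iab x 0 f) => a b ab.
have [b0|b0] := leP 0 b; have [a0|a0] := leP 0 a.
- by rewrite (Iab_split hf a0 ab); lra.
- by rewrite (Iab_split hf (ltW a0) b0); lra.
- lra.
- by rewrite (Iab_split hf ab (ltW b0)); lra.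
Qed.

(** A primitive ignores null sets, so the continuity of f at x only needs to be tested along G. *)
Lemma primitive_derive G f F (k : R) (x : R) : locbm f -> conull G ->
  (forall a b, a <= b -> F b - F a = Iab a b f) ->
  (forall e : R, 0 < e -> exists2 d : R, 0 < d & forall y, G y -> `|y - x| < d -> `|f y - k| <= e) ->
  is_derive x (1 : R) F k.
Proof.
move=> hf cG HF Hc.
have key (e : R) : 0 < e -> exists2 d : R, 0 < d & forall h, `|h| < d -> `|F (x + h) - F x - k * h| <= e * `|h|.
  move=> e0; have [d d0 Hd] := Hc e e0; exists d => // h hd.
  have [h0|h0] := leP 0 h.
    rewrite HF; last lra.
    have -> : k * h = Iab x (x + h) (fun=> k) by rewrite Iab_cst; [ring|lra].
    rewrite -IabB //; last exact: locbm_cst.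
    have -> : `|h| = x + h - x by rewrite ger0_norm //; ring.
    apply: (Iab_bound cG); [exact: locbmB hf (locbm_cst _)|lra|].
    move=> y Gy yx; apply: Hd => //; move: hd; rewrite ger0_norm // => hd.
    by rewrite ger0_norm; lra.
  have -> : F (x + h) - F x - k * h = - (F x - F (x + h) - k * (- h)) by ring.
  rewrite normrN HF; last lra.
  have -> : k * - h = Iab (x + h) x (fun=> k) by rewrite Iab_cst; [ring|lra].
  rewrite -IabB //; last exact: locbm_cst.
  have -> : `|h| = x - (x + h) by rewrite ltr0_norm //; ring.
  apply: (Iab_bound cG); [exact: locbmB hf (locbm_cst _)|lra|].
  move=> y Gy yx; apply: Hd => //; move: hd; rewrite ltr0_norm // => hd.
  by rewrite ler0_norm; lra.
suff : h^-1 *: ((F \o shift x) (h *: (1 : R)) - F x) @[h --> 0^'] --> k.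
  move=> cv; split; first by apply/cvg_ex; exists k.
  exact: cvg_lim.
apply/cvgrPdist_le => e e0; have [d d0 Hd] := key e e0.
near=> h.
have hn0 : h != 0 by near: h; exact: nbhs_dnbhs_neq.
have hd : `|h| < d.
  by near: h; apply: dnbhs0_lt.
have h0 : 0 < `|h| by rewrite normr_gt0.
rewrite /= distrC -[X in `|_ - X|](mulKf hn0) /GRing.scale /= mulr1 -mulrBr normrM normfV.
by have := Hd h hd; rewrite ler_pdivrMl // (addrC x h) (mulrC k h) (mulrC e).
Unshelve. all: by end_near. Qed.

Lemma derive0_cst (F : R -> R) a b : a <= b ->
  (forall x, a < x < b -> is_derive x (1 : R) F 0) -> {within `[a, b], continuous F} -> F b = F a.
Proof.
rewrite le_eqVlt => /predU1P[-> //|ab] dF cF.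
have dF' x : x \in `]a, b[%R -> is_derive x 1 F 0 by rewrite in_itv; exact: dF.
have [x _] := MVT ab dF' cF.
by rewrite mul0r => /eqP; rewrite subr_eq0 => /eqP.
Qed.

End Integral.

(** * Continuity and primitives *)

Section Epsilon.
Context {R : realType}.
Implicit Types (f : R -> R) (x : R).

Lemma cont_at_eps f x (e : R) : {for x, continuous f} -> 0 < e ->
  exists2 d : R, 0 < d & forall y, `|y - x| < d -> `|f y - f x| <= e.
Proof.
move=> /cvgrPdist_le cf e0.
have /nbhs_ballP[d /= d0 Hd] := cf e e0.
exists d => // y yx; rewrite distrC; apply: (Hd y).
by rewrite /ball /= distrC.
Qed.

Lemma eps_cont_at f x : (forall e : R, 0 < e ->
  exists2 d : R, 0 < d & forall y, `|y - x| < d -> `|f y - f x| <= e) ->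
  {for x, continuous f}.
Proof.
move=> H; apply/cvgrPdist_le => e e0; have [d d0 Hd] := H e e0.
apply/nbhs_ballP; exists d => // y; rewrite /ball /= => yx.
by rewrite distrC; apply: Hd; rewrite distrC.
Qed.

(** A set of full measure is dense. *)
Lemma ge0_dense f (G : set R) a b : continuous f -> conull G -> a < b ->
  (forall x, G x -> a < x < b -> 0 <= f x) -> forall x, a <= x <= b -> 0 <= f x.
Proof.
move=> cf cG ab H x /andP[ax xb]; rewrite leNgt; apply/negP => fx.
have [d d0 Hd] := @cont_at_eps f x (- f x / 2) (cf x) ltac:(lra).
pose a' := Num.max a (x - d); pose b' := Num.min b (x + d).
have a'x : a' < b' by rewrite /a' /b' gt_max !lt_min; do ?[apply/andP; split]; lra.
have [y [Gy /andP[]]] := conull_dense cG a'x.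
rewrite /a' /b' gt_max lt_min => /andP[ay dy] /andP[yb yd].
have := H y Gy ltac:(by rewrite ay yb).
have yx : `|y - x| < d by rewrite ltr_norml; apply/andP; split; lra.
by have := Hd y yx; rewrite ler_norml => /andP[h1 h2] h; lra.
Qed.

(** The difference has derivative (1 - 1 / y)^2 / 2. With x the ratio of the densities on the two
sides of a shock, the strict inequality says that energy is dissipated there. *)
Lemma ln_lt_mid (x : R) : 1 < x -> ln x < (x - x^-1) / 2.
Proof.
move=> x1; rewrite -subr_gt0.
pose f (y : R) := (y - y^-1) / 2 - ln y.
have df (y : R) : 0 < y -> is_derive y 1 f ((1 + y^-2) / 2 - y^-1).
  move=> y0.
  have h1 : is_derive y 1 (fun z : R => z^-1) (- y^-2 *: (1 : R)).
    by apply: is_deriveV => //; rewrite gt_eqF.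
  have h2 := is_deriveB (@is_derive_id _ _ y (1 : R)) h1.
  have h3 := is_deriveM h2 (@is_derive_cst _ _ _ (2^-1 : R) y 1).
  have h4 := is_deriveB h3 (is_derive1_ln y0).
  apply: (is_derive_eq h4).
  by rewrite /GRing.scale /=; ring.
have [y /itvP yx] : exists2 y, y \in `]1, x[ & f x - f 1 = ((1 + y^-2) / 2 - y^-1) * (x - 1).
  apply: (@MVT R f (fun y => (1 + y^-2) / 2 - y^-1)) => //.
    by move=> y /itvP yx; apply: df; rewrite (lt_trans _ (_ : 1 < y)) ?yx.
  apply: derivable_within_continuous => y /itvP yx.
  by have [] := df y ltac:(by rewrite (lt_le_trans _ (_ : 1 <= y)) ?yx).
have -> : f 1 = 0 by rewrite /f ln1 invr1; lra.
rewrite subr0 /f => ->.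
apply: mulr_gt0; last by rewrite subr_gt0.
have y0 : y != 0 by rewrite gt_eqF // (lt_trans ltr01) ?yx.
have -> : (1 + y^-2) / 2 - y^-1 = (1 - y^-1) ^+ 2 / 2 by field.
rewrite divr_gt0 // exprn_even_gt0 //= subr_eq0 eq_sym invr_eq1.
by rewrite gt_eqF ?yx.
Qed.

Lemma FTC (f F : R -> R) (a b : R) : a <= b -> continuous f ->
  (forall x, is_derive x (1 : R) F (f x)) -> Iab a b f = F b - F a.
Proof.
move=> ab cf dF; have lf := locbm_cont cf.
have [F1 HF1] := primitive_exists lf.
have dF1 z : is_derive z (1 : R) F1 (f z).
  apply: (@primitive_derive _ setT f) => //; first exact: conullT.
  move=> e e0; have [d d0 hd] := cont_at_eps (cf z) e0.
  by exists d => // w _; exact: hd.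
have dd z : is_derive z (1 : R) (F1 - F) 0.
  by refine (is_derive_eq (is_deriveB (dF1 z) (dF z)) _); rewrite subrr.
have : (F1 - F) b = (F1 - F) a.
  apply: derive0_cst => //.
  apply: continuous_subspaceT => z.
  by apply/differentiable_continuous/derivable1_diffP; have [] := dd z.
by rewrite -(HF1 _ _ ab) /= !fctE; lra.
Qed.

Lemma ex_derive_cont (F : R -> R) f : (forall x, is_derive x (1 : R) F (f x)) -> continuous F.
Proof. by move=> h z; apply/differentiable_continuous/derivable1_diffP; have [] := h z. Qed.

End Epsilon.

(** * Self-similar flows *)

Section Similarity.
Context {R : realType}.
Implicit Types (c : R) (rho m P : R -> R) (G : set R).

(** The flux of energy across a ray, up to terms that are continuous in xi; only its jumps matter. *)
Definition Eflux c (m rho : R) : R :=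
  m * (m ^+ 2 / (2 * rho ^+ 2) + c ^+ 2 * ln rho).

(** The equations of a self-similar solution in the variable xi = x / t, where m and P are the
fluxes of mass and momentum across the ray x = xi t. The last field is the entropy inequality:
across any x0, the energy flux does not jump upwards. *)
Record simil c rho m P G : Prop := Simil {
  sm_loc : locbm rho;
  sm_bnd : exists r M : R, 0 < r /\ forall x, r <= rho x <= M;
  sm_G : conull G;
  sm_m : forall a b, a <= b -> m a - m b = Iab a b rho;
  sm_P : forall x, is_derive x (1 : R) P (- (2 * m x));
  sm_q : forall x, G x -> P x * rho x = m x ^+ 2 + c ^+ 2 * rho x ^+ 2;
  sm_E : forall x0 e : R, 0 < e -> exists2 d : R, 0 < d &
    forall a b, G a -> G b -> a < b -> `|a - x0| < d -> `|b - x0| < d ->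
      Eflux c (m b) (rho b) <= Eflux c (m a) (rho a) + e }.

(** The roots in rho of P rho = m^2 + c^2 rho^2; for m >= 0, s = 1 gives the subsonic root and
s = -1 the supersonic one. *)
Definition branch c (s : R) m P (x : R) : R :=
  (P x + s * Num.sqrt (P x ^+ 2 - 4 * c ^+ 2 * m x ^+ 2)) / (2 * c ^+ 2).

Section Basics.
Variables (c : R) (c0 : 0 < c) (rho m P : R -> R) (G : set R).
Hypothesis H : simil c rho m P G.

Lemma sm_slope : exists r M : R, [/\ 0 < r, 0 < M, (forall x, r <= rho x <= M) &
  forall a b, a <= b -> r * (b - a) <= m a - m b <= M * (b - a)].
Proof.
have [r [M [r0 rM]]] := sm_bnd H.
have M0 : 0 < M by have /andP[h1 h2] := rM 0; lra.
exists r, M; split => // a b ab.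
rewrite (sm_m H ab) -!Iab_cst //.
by apply/andP; split; apply: (Iab_le (sm_G H)); do ?[exact: (sm_loc H)|exact: locbm_cst];
  move=> x _ _; have /andP[] := rM x.
Qed.

Lemma sm_decr a b : a < b -> m b < m a.
Proof.
move=> ab; have [r [M [r0 _ _ h]]] := sm_slope.
have /andP[h1 _] := h a b (ltW ab).
by have := mulr_gt0 r0 (ltac:(lra) : 0 < b - a); lra.
Qed.

Lemma sm_ndecr a b : a <= b -> m b <= m a.
Proof. by rewrite le_eqVlt => /predU1P[->//|/sm_decr/ltW]. Qed.

Lemma sm_lt a b : m b < m a -> a < b.
Proof. by move=> h; rewrite ltNge; apply/negP => /sm_ndecr; rewrite leNgt h. Qed.

Lemma sm_mcont : continuous m.
Proof.
move=> x; apply: eps_cont_at => e e0.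
have [r [M [r0 M0 _ h]]] := sm_slope.
exists (e / M) => [|y]; first by rewrite divr_gt0.
rewrite ltr_pdivlMr // => hy.
have [yx|xy] := leP y x.
  have /andP[h1 h2] := h y x yx.
  have h3 : 0 <= r * (x - y) by apply: mulr_ge0; lra.
  rewrite ger0_norm; last lra.
  by apply: le_trans h2 _; rewrite mulrC; move: hy; rewrite ler0_norm; lra.
have /andP[h1 h2] := h x y (ltW xy).
have h3 : 0 <= r * (y - x) by apply: mulr_ge0; lra.
rewrite ler0_norm; last lra.
by rewrite opprB; apply: le_trans h2 _; rewrite mulrC; move: hy; rewrite ger0_norm; lra.
Qed.

Lemma sm_Pcont : continuous P.
Proof. by move=> x; apply/differentiable_continuous/derivable1_diffP; have [] := sm_P H x. Qed.

Lemma simil_Pint (a b : R) : a <= b -> P a - P b = Iab a b (fun x => 2 * m x).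
Proof.
move=> ab; have cm := sm_mcont.
have c2 : continuous (fun x => - (2 * m x)).
  by move=> x; apply: cvgN; apply: cvgM; [exact: cvg_cst|exact: cm].
have := FTC ab c2 (sm_P H).
have -> : (fun x => - (2 * m x)) = (fun x => (-1) * (2 * m x)) by apply/funext => x; ring.
have l2m : locbm (fun x => 2 * m x) by exact: locbmM (locbm_cst _) (locbm_cont cm).
rewrite (IabZ _ _ _ l2m); lra.
Qed.

Lemma sm_zero : exists xs, m xs = 0.
Proof.
have [r [M [r0 M0 _ h]]] := sm_slope.
pose L := `|m 0| / r.
have L0 : 0 <= L by rewrite divr_ge0 // ltW.
have rL : r * L = `|m 0| by rewrite /L mulrC mulfVK // gt_eqF.
have /andP[hp _] := h 0 L L0.
have /andP[hn _] := h (- L) 0 ltac:(lra).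
have m0n := ler_norm (m 0); have m0p := ler_norm (- m 0); rewrite normrN in m0p.
have hL : - L <= L by lra.
have hv : Num.min (m (- L)) (m L) <= 0 <= Num.max (m (- L)) (m L).
  rewrite ge_min le_max; apply/andP; split; apply/orP; [right|left]; lra.
have [x _ mx] := IVT hL (continuous_subspaceT sm_mcont) hv.
by exists x.
Qed.

(** By [Tp_G] this is (m - c rho)^2 / rho almost everywhere: it vanishes exactly at sonic points,
and is nevertheless continuous. *)
Definition Tp (x : R) := P x - 2 * c * m x.

Lemma Tp_cont : continuous Tp.
Proof.
move=> x; apply: cvgB; first exact: sm_Pcont.
by apply: cvgM; [exact: cvg_cst|exact: sm_mcont].
Qed.

Lemma Tp_G x : G x -> Tp x * rho x = (m x - c * rho x) ^+ 2.
Proof. by move=> Gx; rewrite /Tp mulrBl (sm_q H Gx); ring. Qed.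

Lemma rho_gt0 x : 0 < rho x.
Proof. by have [r [M [r0 _ h _]]] := sm_slope; have /andP[h1 _] := h x; lra. Qed.

Lemma P_gt0G x : G x -> 0 < P x.
Proof.
move=> Gx; rewrite -(pmulr_lgt0 _ (rho_gt0 x)) (sm_q H Gx).
by rewrite ltr_wpDl ?sqr_ge0 // mulr_gt0 // exprn_gt0 // rho_gt0.
Qed.

Lemma Tp_ge0 x : 0 <= Tp x.
Proof.
apply: (@ge0_dense _ _ G (x - 1) (x + 1)); [exact: Tp_cont|exact: sm_G H|lra| |lra].
by move=> y Gy _; rewrite -(pmulr_lge0 _ (rho_gt0 y)) Tp_G // sqr_ge0.
Qed.

Lemma P_ge0 x : 0 <= P x.
Proof.
apply: (@ge0_dense _ _ G (x - 1) (x + 1)); [exact: sm_Pcont|exact: sm_G H|lra| |lra].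
by move=> y Gy _; apply/ltW/P_gt0G.
Qed.

Lemma disc_pos x : 0 < m x -> 0 < Tp x -> 0 < P x ^+ 2 - 4 * c ^+ 2 * m x ^+ 2.
Proof.
move=> mx Tx; have -> : P x ^+ 2 - 4 * c ^+ 2 * m x ^+ 2 = Tp x * (P x + 2 * c * m x).
  by rewrite /Tp; ring.
by rewrite mulr_gt0 //; have := mulr_gt0 c0 mx; have := P_ge0 x; lra.
Qed.

Lemma branchE x (s : R) : G x -> s ^+ 2 = 1 -> 0 <= s * (2 * c ^+ 2 * rho x - P x) ->
  rho x = branch c s m P x.
Proof.
move=> Gx s2 hs; rewrite /branch.
have -> : P x ^+ 2 - 4 * c ^+ 2 * m x ^+ 2 = (s * (2 * c ^+ 2 * rho x - P x)) ^+ 2.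
  have q := sm_q H Gx.
  have -> : m x ^+ 2 = P x * rho x - c ^+ 2 * rho x ^+ 2 by lra.
  by rewrite exprMn s2; ring.
rewrite sqrtr_sqr ger0_norm // mulrA -expr2 s2.
by field; rewrite gt_eqF.
Qed.

Lemma sign_sub x : G x -> 0 <= m x -> m x <= c * rho x -> 0 <= 1 * (2 * c ^+ 2 * rho x - P x).
Proof.
move=> Gx m0 sb; rewrite mul1r -(pmulr_lge0 _ (rho_gt0 x)) mulrBl (sm_q H Gx).
have := ler_pM m0 m0 sb sb; lra.
Qed.

Lemma sign_sup x : G x -> c * rho x <= m x -> 0 <= -1 * (2 * c ^+ 2 * rho x - P x).
Proof.
move=> Gx sp; rewrite mulN1r opprB -(pmulr_lge0 _ (rho_gt0 x)) mulrBl (sm_q H Gx).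
have h : 0 <= c * rho x by rewrite mulr_ge0 // ltW // rho_gt0.
have := ler_pM h h sp sp; lra.
Qed.

Lemma branch_cont s : continuous (branch c s m P).
Proof.
move=> x; rewrite /branch; apply: cvgM; last exact: cvg_cst.
apply: cvgD; first exact: sm_Pcont.
apply: cvgM; first exact: cvg_cst.
apply: continuous_comp; last exact: sqrt_continuous.
apply: cvgB; first by apply: cvgM; exact: sm_Pcont.
by apply: cvgM; [exact: cvg_cst|apply: cvgM; exact: sm_mcont].
Qed.

(** m is a primitive of - rho, and is differentiable wherever rho agrees with a continuous function. *)
Lemma m_derive_branch (f : R -> R) (x a b : R) : a < x < b ->
  {for x, continuous f} -> (forall y, G y -> a < y < b -> rho y = f y) ->
  is_derive x (1 : R) m (- f x).
Proof.
move=> /andP[ax xb] cf hf.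
apply: (@primitive_derive _ G (fun y => - rho y)).
- exact: locbmN (sm_loc H).
- exact: sm_G H.
- move=> a' b' ab'.
  have -> : (fun y => - rho y) = (fun y => (-1) * rho y) by apply/funext => y; rewrite mulN1r.
  rewrite IabZ; last exact: sm_loc H.
  by rewrite -(sm_m H ab'); ring.
- move=> e e0; have [d d0 Hd] := cont_at_eps cf e0.
  exists (Num.min d (Num.min (x - a) (b - x))); first by rewrite !lt_min; do ?[apply/andP; split]; lra.
  move=> y Gy; rewrite !lt_min => /andP[yd /andP[ya yb]].
  have yab : a < y < b.
    move: ya yb; rewrite !ltr_norml => /andP[h1 _] /andP[_ h2]; apply/andP; split; lra.
  by rewrite (hf _ Gy yab) opprK addrC -opprB normrN; apply: Hd.
Qed.

(** Differentiating the root with m' = - rho and P' = - 2 m gives 0: away from the sonic states a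
smooth flow is constant. *)
Lemma const_branch s a b : s ^+ 2 = 1 -> a < b ->
  (forall x, a < x < b -> 0 < P x ^+ 2 - 4 * c ^+ 2 * m x ^+ 2) ->
  (forall x, G x -> a < x < b -> rho x = branch c s m P x) ->
  exists k, forall x, a < x < b -> branch c s m P x = k.
Proof.
move=> s2 ab hD hr.
have dm x : a < x < b -> is_derive x (1 : R) m (- branch c s m P x).
  by move=> xab; apply: (m_derive_branch xab) => //; exact: branch_cont.
have dr x : a < x < b -> is_derive x (1 : R) (branch c s m P) 0.
  move=> xab.
  have D0 := hD x xab.
  have h1 := is_deriveB (is_deriveX 2 (sm_P H x)) (is_deriveM (@is_derive_cst _ _ _ (4 * c ^+ 2) x (1:R)) (is_deriveX 2 (dm x xab))).
  have h2 := is_derive1_comp (is_derive1_sqrt D0 : is_derive ((P ^+ 2 - (cst (4 * c ^+ 2) * m ^+ 2)) x) 1 _ _) h1.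
  have h3 := is_deriveM (is_deriveD (sm_P H x) (is_deriveM (@is_derive_cst _ _ _ s x (1:R)) h2)) (@is_derive_cst _ _ _ ((2 * c ^+ 2)^-1) x (1:R)).
  apply: (is_derive_eq h3).
  rewrite /GRing.scale /= /cst /=.
  set S := Num.sqrt _.
  have S0 : 0 < S by rewrite sqrtr_gt0.
  have rE : branch c s m P x = (P x + s * S) / (2 * c ^+ 2) by [].
  rewrite !mulr0 !addr0 !add0r !expr1.
  have -> : 2 * P x * - (2 * m x) - 4 * c ^+ 2 * (2 * m x * - branch c s m P x) = 4 * m x * s * S.
    by rewrite rE; field; rewrite gt_eqF.
  have -> : (2 * S)^-1 * (4 * m x * s * S) = 2 * m x * s by field; rewrite gt_eqF.
  have -> : s * (2 * m x * s) = 2 * m x * s ^+ 2 by ring.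
  by rewrite s2 mulr1 addNr mulr0.
exists (branch c s m P ((a + b) / 2)).
suff key x y : a < x -> x <= y -> y < b -> branch c s m P y = branch c s m P x.
  move=> x /andP[ax xb]; have [h|h] := leP x ((a + b) / 2).
    by rewrite (key x ((a + b) / 2)) //; lra.
  by rewrite (key ((a + b) / 2) x) //; lra.
move=> ax xy yb; apply: derive0_cst => //.
  by move=> z /andP[h1 h2]; apply: dr; apply/andP; split; lra.
by apply: continuous_subspaceT; exact: branch_cont.
Qed.

End Basics.
End Similarity.
Arguments sm_mcont {R c rho m P G} H x.
Arguments sm_Pcont {R c rho m P G} H x.
Arguments branch_cont {R c rho m P G} H s x.

(** * The transition from supersonic to subsonic flow *)

Section Structure.
Context {R : realType}.
Variables (c : R) (c0 : 0 < c) (rho m P : R -> R) (G : set R).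
Hypothesis H : simil c rho m P G.

Local Notation Tp := (Tp c m P).
Local Notation up := (branch c 1 m P).
Local Notation lo := (branch c (-1) m P).

Lemma Tp_E x : Tp x = P x - 2 * c * m x. Proof. by []. Qed.

Lemma rho_up x : G x -> 0 <= m x -> m x <= c * rho x -> rho x = up x.
Proof. by move=> Gx m0 sb; apply: (branchE c0 H) => //; [rewrite expr1n|exact: (sign_sub H)]. Qed.

Lemma rho_lo x : G x -> c * rho x <= m x -> rho x = lo x.
Proof. by move=> Gx sp; apply: (branchE c0 H) => //; [rewrite sqrrN expr1n|exact: (sign_sup c0 H)]. Qed.

Lemma branch_prod x : 4 * c ^+ 2 * m x ^+ 2 <= P x ^+ 2 -> lo x * up x = m x ^+ 2 / c ^+ 2.
Proof.
move=> D0; rewrite /branch; set D := _ - _.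
have hS : Num.sqrt D ^+ 2 = D by rewrite sqr_sqrtr // subr_ge0.
transitivity ((P x ^+ 2 - Num.sqrt D ^+ 2) / (4 * c ^+ 4)); first by field; rewrite gt_eqF.
by rewrite hS /D; field; rewrite gt_eqF.
Qed.

Lemma branch_lt x : 0 < m x -> 0 < Tp x -> 0 < lo x < up x.
Proof.
move=> mx Tx; have D0 := disc_pos c0 H mx Tx.
have c2 : 0 < 2 * c ^+ 2 by rewrite mulr_gt0 // exprn_gt0.
have lu : lo x < up x.
  rewrite /branch ltr_pM2r ?invr_gt0 //.
  have : 0 < Num.sqrt (P x ^+ 2 - 4 * c ^+ 2 * m x ^+ 2) by rewrite sqrtr_gt0.
  lra.
rewrite lu andbT.
have up0 : 0 < up x.
  rewrite /branch divr_gt0 //.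
  have : 0 < Num.sqrt (P x ^+ 2 - 4 * c ^+ 2 * m x ^+ 2) by rewrite sqrtr_gt0.
  by have := P_ge0 c0 H x; lra.
rewrite -(pmulr_lgt0 _ up0) branch_prod; last by rewrite -subr_ge0 ltW.
by rewrite divr_gt0 // exprn_gt0.
Qed.

(** At a shock m and P are continuous, so the two densities are the roots of the same quadratic,
with product mu^2 / c^2. *)
Lemma Eflux_lt (mu r1 r2 : R) : 0 < mu -> 0 < r1 < r2 -> r1 * r2 = mu ^+ 2 / c ^+ 2 ->
  Eflux c mu r2 < Eflux c mu r1.
Proof.
move=> mu0 /andP[r10 r12] rr.
have r20 : 0 < r2 by exact: lt_trans r12.
have m2 : mu ^+ 2 = c ^+ 2 * (r1 * r2) by rewrite rr mulrC mulfVK // gt_eqF // exprn_gt0.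
rewrite /Eflux m2 ltr_pM2l //.
have -> : c ^+ 2 * (r1 * r2) / (2 * r2 ^+ 2) = c ^+ 2 * (r1 / r2 / 2) by field; rewrite gt_eqF.
have -> : c ^+ 2 * (r1 * r2) / (2 * r1 ^+ 2) = c ^+ 2 * (r2 / r1 / 2) by field; rewrite gt_eqF.
rewrite -!mulrDr ltr_pM2l ?exprn_gt0 //.
have x1 : 1 < r2 / r1 by rewrite ltr_pdivlMr // mul1r.
have := ln_lt_mid x1; rewrite ln_div ?posrE // invf_div; lra.
Qed.

Lemma Eflux_cont (f : R -> R) x : {for x, continuous f} -> 0 < f x ->
  {for x, continuous (fun y => Eflux c (m y) (f y))}.
Proof.
move=> cf f0; have cm := sm_mcont H x.
apply: cvgM => //; apply: cvgD.
  apply: cvgM; first by apply: cvgM.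
  apply: cvgV; first by rewrite gt_eqF // mulr_gt0 // exprn_gt0.
  by apply: cvgM; [exact: cvg_cst|apply: cvgM].
apply: cvgM; first exact: cvg_cst.
by apply: continuous_comp => //; exact: continuous_ln.
Qed.

(** The two roots are distinct near x0, so a supersonic point right after a subsonic one would
make the energy flux jump upwards, by [Eflux_lt]. *)
Lemma no_expansion x0 : 0 < m x0 -> 0 < Tp x0 ->
  (forall d : R, 0 < d -> exists a b, [/\ G a, G b, a < b & [/\ `|a - x0| < d, `|b - x0| < d,
     m a <= c * rho a & c * rho b <= m b]]) -> False.
Proof.
move=> mx Tx Hd.
have /andP[lo0 lu] := branch_lt mx Tx.
have up0 : 0 < up x0 by exact: lt_trans lu.
have cu := Eflux_cont (branch_cont H 1 x0) up0.
have cl := Eflux_cont (branch_cont H (-1) x0) lo0.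
have lt : Eflux c (m x0) (up x0) < Eflux c (m x0) (lo x0).
  apply: Eflux_lt => //; first by rewrite lo0.
  by rewrite branch_prod // -subr_ge0 ltW // (disc_pos c0 H).
set A := Eflux c _ _ in lt; set B := Eflux c _ _ in lt.
pose e := (B - A) / 4; have e0 : 0 < e by rewrite /e; lra.
have [d1 d10 h1] := cont_at_eps cu e0.
have [d2 d20 h2] := cont_at_eps cl e0.
have [d3 d30 h3] := sm_E H x0 e0.
have [d4 d40 h4] := cont_at_eps (sm_mcont H x0) (ltac:(lra) : 0 < m x0 / 2).
pose d := Num.min (Num.min d1 d2) (Num.min d3 d4).
have d0 : 0 < d by rewrite /d !lt_min d10 d20 d30 d40.
have [a [b [Ga Gb ab [ad bd sa sb]]]] := Hd d d0.
move: ad bd; rewrite /d !lt_min => /andP[/andP[a1 a2] /andP[a3 a4]] /andP[/andP[b1 b2] /andP[b3 b4]].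
have ma : 0 <= m a by have := h4 a a4; rewrite ler_norml => /andP[]; lra.
have := h3 a b Ga Gb ab a3 b3.
rewrite (rho_up Ga ma sa) (rho_lo Gb sb).
have := h1 a a1; have := h2 b b2; rewrite -/A -/B !ler_norml => /andP[? ?] /andP[? ?] ?.
have h5 : 4 * e = B - A by rewrite /e; field.
lra.
Qed.

(** The sonic defect P - 2 c m has derivative 2 (c rho - m): it decreases along supersonic flow and
increases along subsonic flow. *)
Lemma Tp_diff x y : x <= y -> Tp x - Tp y = Iab x y (fun z => 2 * (m z - c * rho z)).
Proof.
move=> xy.
have lm : locbm m by apply: locbm_cont; exact: sm_mcont H.
have -> : (fun z => 2 * (m z - c * rho z)) = (fun z => 2 * m z - 2 * c * rho z).
  by apply/funext => z; ring.
rewrite IabB; [|exact: locbmM (locbm_cst _) lm|exact: locbmM (locbm_cst _) (sm_loc H)].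
rewrite !IabZ //; last exact: sm_loc H.
rewrite -(sm_m H xy) !Tp_E; have := simil_Pint H xy.
rewrite IabZ //; lra.
Qed.

Lemma Tp_noninc x y : x <= y -> (forall z, G z -> x < z < y -> c * rho z <= m z) -> Tp y <= Tp x.
Proof.
move=> xy h; rewrite -subr_ge0 Tp_diff //.
have lm : locbm m by apply: locbm_cont; exact: sm_mcont H.
have -> : 0 = Iab x y (fun=> 0 : R) by rewrite Iab_cst // mul0r.
apply: (Iab_le (sm_G H)); first exact: locbm_cst.
  exact: locbmM (locbm_cst _) (locbmB lm (locbmM (locbm_cst _) (sm_loc H))).
by move=> z Gz xyz; have := h z Gz xyz; lra.
Qed.

Lemma Tp_nondec x y : x <= y -> (forall z, G z -> x < z < y -> m z <= c * rho z) -> Tp x <= Tp y.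
Proof.
move=> xy h; rewrite -subr_le0 Tp_diff //.
have lm : locbm m by apply: locbm_cont; exact: sm_mcont H.
have -> : 0 = Iab x y (fun=> 0 : R) by rewrite Iab_cst // mul0r.
apply: (Iab_le (sm_G H)); last by move=> z Gz xyz; have := h z Gz xyz; lra.
  exact: locbmM (locbm_cst _) (locbmB lm (locbmM (locbm_cst _) (sm_loc H))).
exact: locbm_cst.
Qed.

Lemma Tp_gt0 x : G x -> m x != c * rho x -> 0 < Tp x.
Proof.
move=> Gx ne; rewrite -(pmulr_lgt0 _ (rho_gt0 H x)) (Tp_G H) //.
by rewrite exprn_even_gt0 //= subr_eq0.
Qed.

(** Let x0 be the supremum of the subsonic points before b. Past x0 the flow is supersonic, so the
sonic defect decreases from x0 to b; if b were strictly supersonic, x0 would not be sonic, and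
[no_expansion] would apply at x0. *)
Lemma sub_stays a b : G a -> G b -> a < b -> 0 < m b -> m a < c * rho a -> m b <= c * rho b.
Proof.
move=> Ga Gb ab mb sa; rewrite leNgt; apply/negP => sb.
pose S := [set x | [/\ G x, a <= x <= b & m x < c * rho x]].
have Sa : S a by split => //; rewrite lexx ltW.
have hS : has_sup S by split; [exists a|exists b => x [_ /andP[_ ->]]].
pose x0 := sup S.
have ax0 : a <= x0 by apply: ub_le_sup => //; case: hS.
have x0b : x0 <= b by apply: ge_sup; [exists a|move=> x [_ /andP[_ ->]]].
have mx0 : 0 < m x0 by apply: lt_le_trans mb (sm_ndecr H x0b).
have after z : G z -> x0 < z <= b -> c * rho z <= m z.
  move=> Gz /andP[xz zb]; rewrite leNgt; apply/negP => sz.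
  have : z <= x0 by apply: ub_le_sup; [case: hS|split => //; rewrite zb andbT; lra].
  by rewrite leNgt xz.
have Tb : 0 < Tp b by apply: Tp_gt0 => //; rewrite gt_eqF.
have Tx0 : 0 < Tp x0.
  apply: lt_le_trans Tb _; apply: Tp_noninc => // z Gz /andP[h1 h2].
  by apply: after => //; rewrite h1 ltW.
apply: (no_expansion mx0 Tx0) => d d0.
have [y Sy yx] := sup_adherent d0 hS.
have yx0 : y <= x0 by apply: ub_le_sup => //; case: hS.
have [Gy /andP[ay yb] sy] := Sy.
move: x0b; rewrite le_eqVlt => /predU1P[xb|xb].
  exists y, b; split => //.
    rewrite lt_neqAle yb andbT; apply/eqP => E; move: sy; rewrite E; lra.
  rewrite -/x0 in yx.
  by split; [rewrite ler0_norm|rewrite -xb subrr normr0|exact: ltW|exact: ltW]; lra.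
have : x0 < Num.min b (x0 + d) by rewrite lt_min xb; lra.
move=> /(conull_dense (sm_G H)) [z [Gz /andP[xz]]]; rewrite lt_min => /andP[zb zd].
exists y, z; split => //; first lra.
rewrite -/x0 in yx.
split; [rewrite ler0_norm; lra|rewrite ger0_norm; lra|exact: ltW|].
by apply: after => //; rewrite xz ltW.
Qed.

(** Close to the zero of m the flow is subsonic because rho is bounded below, and far to the left it
is supersonic because m grows linearly; [sub_stays] forbids to return. *)
Lemma transition xs : m xs = 0 -> exists x1, [/\ x1 < xs,
  (forall x, G x -> x < x1 -> c * rho x <= m x),
  (forall x, G x -> x1 < x < xs -> m x <= c * rho x) &
  (forall x, x1 < x < xs -> 0 < Tp x)].
Proof.
move=> mxs.
have [r [M [r0 M0 rM sl]]] := sm_slope H.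
pose S := [set x | [/\ G x, x < xs & m x < c * rho x]].
have mpos x : x < xs -> 0 < m x by move=> h; rewrite -mxs; exact: sm_decr H _ _ h.
have S0 : S !=set0.
  have : xs - c * r / M / 2 < xs by rewrite ltrBlDr ltrDl divr_gt0 // divr_gt0 // mulr_gt0.
  move=> /(conull_dense (sm_G H)) [x [Gx /andP[h1 h2]]].
  exists x; split => //.
  have /andP[_ h3] := sl x xs (ltW h2).
  have h4 : M * (xs - x) <= M * (c * r / M / 2) by rewrite ler_pM2l //; lra.
  have h5 : M * (c * r / M / 2) = c * r / 2 by field; rewrite gt_eqF.
  have h6 : c * r <= c * rho x by rewrite ler_pM2l //; have /andP[] := rM x.
  have h7 : 0 < c * r by rewrite mulr_gt0.
  lra.
pose L := xs - (c * M + 1) / r.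
have lbS : lbound S L.
  move=> x [Gx xxs sx]; rewrite leNgt; apply/negP => xL.
  have /andP[h1 _] := sl x xs (ltW xxs).
  have h2 : r * ((c * M + 1) / r) <= r * (xs - x) by rewrite ler_pM2l //; move: xL; rewrite /L; lra.
  have h3 : r * ((c * M + 1) / r) = c * M + 1 by field; rewrite gt_eqF.
  have h4 : c * rho x <= c * M by rewrite ler_pM2l //; have /andP[] := rM x.
  lra.
have hS : has_inf S by split => //; exists L.
exists (inf S).
have i1 x : G x -> x < inf S -> c * rho x <= m x.
  move=> Gx xi; rewrite leNgt; apply/negP => sx.
  have [z Sz] := S0.
  have zi : inf S <= z by apply: ge_inf => //; exists L.
  have : inf S <= x.
    apply: ge_inf; first by exists L.
    by split => //; case: Sz => _ zxs _; lra.
  by rewrite leNgt xi.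
have i2 x : inf S < x -> exists y, [/\ G y, y < xs, m y < c * rho y & inf S <= y < x].
  move=> ix; have [y Sy yi] := inf_adherent (ltac:(lra) : 0 < x - inf S) hS.
  exists y; case: (Sy) => ? ? ?; split => //; apply/andP; split; last lra.
  by apply: ge_inf => //; exists L.
have i3 : inf S < xs.
  have [z Sz] := S0; apply: le_lt_trans (_ : z < xs); last by case: Sz.
  by apply: ge_inf => //; exists L.
have i4 x : G x -> inf S < x < xs -> m x <= c * rho x.
  move=> Gx /andP[ix xxs]; have [y [Gy yxs sy /andP[_ yx]]] := i2 x ix.
  exact: (sub_stays Gy Gx yx (mpos _ xxs) sy).
split => // x /andP[ix xxs].
have [y [Gy yxs sy /andP[iy yx]]] := i2 x ix.
have : 0 < Tp y by apply: Tp_gt0 => //; rewrite lt_eqF.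
move=> h; apply: lt_le_trans h _; apply: Tp_nondec; first exact: ltW.
by move=> z Gz /andP[h1 h2]; apply: i4 => //; apply/andP; split; lra.
Qed.

End Structure.

(** * Explicit form of a wave *)

Section Profile.
Context {R : realType}.
Implicit Types (c z : R).

(** With z = (ua - x) / c, where (ra, ra ua) is the outer state: ra gz z is the density of the outer
state followed by its rarefaction fan, and ra hz z the density behind a passage to subsonic flow
located at x. For z > 1 this passage is a shock, and z^2 is its Rankine-Hugoniot ratio; for
z <= 1 the fan is merely cut. *)
Definition gz z : R := if 1 <= z then 1 else expR (z - 1).
Definition hz z : R := if 1 <= z then z ^+ 2 else expR (z - 1).
Definition dens c (ra ua x1 x : R) : R :=
  if x < x1 then ra * gz ((ua - x) / c) else ra * hz ((ua - x1) / c).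

Lemma gz_ge1 z : 1 <= z -> gz z = 1. Proof. by rewrite /gz => ->. Qed.
Lemma gzE z : z <= 1 -> gz z = expR (z - 1).
Proof.
rewrite /gz le_eqVlt => /predU1P[->|z1]; first by rewrite lexx subrr expR0.
by rewrite leNgt z1.
Qed.
Lemma hzE z : z <= 1 -> hz z = expR (z - 1).
Proof.
rewrite /hz le_eqVlt => /predU1P[->|z1]; first by rewrite lexx subrr expR0 expr1n.
by rewrite leNgt z1.
Qed.
Lemma hz_ge1 z : 1 <= z -> hz z = z ^+ 2. Proof. by rewrite /hz => ->. Qed.

End Profile.

Section LeftExplicit.
Context {R : realType}.
Variables (c : R) (c0 : 0 < c) (rho m P : R -> R) (G : set R).
Hypothesis H : simil c rho m P G.

Local Notation Tp := (Tp c m P).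
Local Notation up := (branch c 1 m P).
Local Notation lo := (branch c (-1) m P).

Lemma branch_quad s x : s ^+ 2 = 1 -> 4 * c ^+ 2 * m x ^+ 2 <= P x ^+ 2 ->
  P x * branch c s m P x = m x ^+ 2 + c ^+ 2 * branch c s m P x ^+ 2.
Proof.
move=> s2 D0; rewrite /branch; set D := _ - _.
have hS : Num.sqrt D ^+ 2 = D by rewrite sqr_sqrtr // subr_ge0.
have -> : m x ^+ 2 = (P x ^+ 2 - (s ^+ 2) * Num.sqrt D ^+ 2) / (4 * c ^+ 2).
  by rewrite s2 hS /D; field; rewrite gt_eqF.
by field; rewrite gt_eqF.
Qed.

Lemma disc_ge0 x : 0 <= m x -> 4 * c ^+ 2 * m x ^+ 2 <= P x ^+ 2.
Proof.
move=> mx; have := Tp_ge0 H x; rewrite Tp_E => Tx.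
have h : 0 <= 2 * c * m x by rewrite mulr_ge0 // mulr_ge0 // ltW.
have := ler_pM h h (ltac:(lra) : 2 * c * m x <= P x) (ltac:(lra) : 2 * c * m x <= P x).
by lra.
Qed.

Lemma cont_eq_left (f : R -> R) (a b k : R) : continuous f -> a < b ->
  (forall x, a < x < b -> f x = k) -> f a = k /\ f b = k.
Proof.
move=> cf ab h.
have h1 : forall x, a <= x <= b -> 0 <= f x - k.
  apply: (@ge0_dense _ _ setT); [|exact: conullT|by []|].
    by move=> x; apply: cvgB; [exact: cf|exact: cvg_cst].
  by move=> x _ /h ->; rewrite subrr.
have h2 : forall x, a <= x <= b -> 0 <= k - f x.
  apply: (@ge0_dense _ _ setT); [|exact: conullT|by []|].
    by move=> x; apply: cvgB; [exact: cvg_cst|exact: cf].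
  by move=> x _ /h ->; rewrite subrr.
have ha : a <= a <= b by rewrite lexx ltW.
have hb : a <= b <= b by rewrite lexx ltW.
by have := h1 a ha; have := h2 a ha; have := h1 b hb; have := h2 b hb; split; lra.
Qed.

Lemma m_affine a b k : a <= b -> (forall x, G x -> a < x < b -> rho x = k) ->
  m a - m b = k * (b - a).
Proof.
move=> ab h; rewrite (sm_m H ab) -Iab_cst //.
by apply: (Iab_ae (sm_G H)) => //; [exact: sm_loc H|exact: locbm_cst].
Qed.

(** Before the transition x1 the sonic defect is nonincreasing: it is positive up to some x0, where
the density is constant, and vanishes from x0 to x1, where rho = m / c integrates to an
exponential. After x1 the density is constant, and it is determined by the continuity of m and P
at x1. *)
Lemma left_explicit xs : m xs = 0 -> exists ra ua x1,
  [/\ 0 < ra /\ x1 < xs,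
      forall x, x <= x1 -> x <= ua - c -> m x = ra * (ua - x),
      forall x, ua - c <= x -> x <= x1 -> m x = c * (ra * gz ((ua - x) / c)),
      forall x, x1 <= x -> x <= xs -> m x = ra * hz ((ua - x1) / c) * (xs - x) &
      forall x, G x -> x < xs -> x != x1 -> rho x = dens c ra ua x1 x].
Proof.
move=> mxs.
have [x1 [x1s sup1 sub1 T1]] := transition c0 H mxs.
have [r [M [r0 M0 rM sl]]] := sm_slope H.
have cm := sm_mcont H.
have cT := Tp_cont H : continuous Tp.
have mpos x : x < xs -> 0 < m x by move=> h; rewrite -mxs; exact: sm_decr H _ _ h.
have Tnon x y : x <= y -> y <= x1 -> Tp y <= Tp x.
  by move=> xy yx; apply: (Tp_noninc H) => // z Gz /andP[_ zy]; apply: sup1 => //; lra.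
(* the set is not empty: far to the left m exceeds c rho, since m grows linearly *)
pose S := [set x | x <= x1 /\ 0 < Tp x].
have S0 : S !=set0.
  pose L := Num.min x1 (xs - (c * M + 1) / r).
  have [y [Gy /andP[_]]] := conull_dense (sm_G H) (ltac:(lra) : L - 1 < L).
  rewrite /L lt_min => /andP[yx1 yL].
  exists y; split; first exact: ltW.
  apply: (Tp_gt0 H) => //; rewrite gt_eqF //.
  have /andP[h1 _] := sl y xs ltac:(lra).
  have h2 : r * ((c * M + 1) / r) <= r * (xs - y) by rewrite ler_pM2l //; lra.
  have h3 : r * ((c * M + 1) / r) = c * M + 1 by field; rewrite gt_eqF.
  have h4 : c * rho y <= c * M by rewrite ler_pM2l //; have /andP[] := rM y.
  lra.
have hS : has_sup S by split => //; exists x1 => x [].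
pose x0 := sup S.
have x01 : x0 <= x1 by apply: ge_sup => // x [].
have T0 x : x < x0 -> 0 < Tp x.
  move=> xx0; have [y [yx Ty] xy] := sup_adherent (ltac:(lra) : 0 < x0 - x) hS.
  by apply: lt_le_trans Ty (Tnon _ _ _ yx); rewrite -/x0 in xy; lra.
have Tz x : x0 < x -> x <= x1 -> Tp x = 0.
  move=> xx0 xx1; apply/le_anti/andP; split; last exact: Tp_ge0 H x.
  rewrite leNgt; apply/negP => Tx.
  have : x <= x0 by apply: ub_le_sup => //; case: hS.
  by rewrite leNgt xx0.
have rlo x : G x -> x < x0 -> rho x = lo x.
  by move=> Gx xx; apply: (rho_lo c0 H) => //; apply: sup1 => //; lra.
pose y0 := x0 - 1.
have y00 : y0 < x0 by rewrite /y0; lra.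
pose ra := lo y0.
have lo_ra x : x < x0 -> lo x = ra.
  move=> xx; pose a := Num.min x y0 - 1.
  have ax : a < x by rewrite /a ltrBlDr gt_min; apply/orP; left; lra.
  have ay : a < y0 by rewrite /a ltrBlDr gt_min; apply/orP; right; lra.
  have [k hk] : exists k, forall z, a < z < x0 -> lo z = k.
    apply: (const_branch c0 H) => //.
    - by rewrite sqrrN expr1n.
    - exact: lt_trans ay y00.
    - move=> z /andP[_ zx0]; apply: (disc_pos c0 H); [apply: mpos; lra|exact: T0].
    - by move=> z Gz /andP[_ zx0]; exact: rlo.
  by rewrite /ra !hk //; apply/andP; split => //; rewrite /y0; lra.
have ra0 : 0 < ra by have /andP[] := branch_lt c0 H (mpos y0 ltac:(lra)) (T0 y0 y00).
pose ua := y0 + m y0 / ra.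
have mA x : x <= x0 -> m x = ra * (ua - x).
  move=> xx0; have rE : ra * ua = ra * y0 + m y0 by rewrite /ua; field; rewrite gt_eqF.
  have h z : G z -> z < x0 -> rho z = ra by move=> Gz zz; rewrite rlo // lo_ra.
  have [xy|yx] := leP x y0.
    have := @m_affine x y0 ra xy (fun z Gz zz => h z Gz ltac:(lra)); lra.
  have := @m_affine y0 x ra (ltW yx) (fun z Gz zz => h z Gz ltac:(lra)); lra.
have lo0 : lo x0 = ra.
  have [_] := @cont_eq_left lo y0 x0 ra (branch_cont H (-1)) y00 (fun x xx => lo_ra x ltac:(lra)).
  by [].
have P0 : P x0 * ra = m x0 ^+ 2 + c ^+ 2 * ra ^+ 2.
  rewrite -lo0; apply: branch_quad; first by rewrite sqrrN expr1n.
  by apply: disc_ge0; apply/ltW/mpos; lra.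
have x0c : x0 <= ua - c.
  have : forall x, y0 <= x <= x0 -> 0 <= m x - c * ra.
    apply: (@ge0_dense _ (fun x => m x - c * ra) G); [|exact: sm_G H|by []|].
      by move=> x; apply: cvgB; [exact: cm|exact: cvg_cst].
    move=> x Gx /andP[_ xx]; rewrite subr_ge0 -(lo_ra x xx) -rlo //; apply: sup1 => //; lra.
  move=> /(_ x0); rewrite lexx ltW // => /(_ isT); rewrite mA // => h.
  by rewrite -subr_ge0 -(pmulr_rge0 _ ra0); lra.
have x0E : x0 < x1 -> x0 = ua - c /\ Tp x0 = 0.
  move=> lt; have [T00 _] := @cont_eq_left Tp x0 x1 0 cT lt (fun x xx => Tz x ltac:(lra) ltac:(lra)).
  split => //; have : (m x0 - c * ra) ^+ 2 = 0.
    by transitivity (Tp x0 * ra); [rewrite Tp_E mulrBl P0; ring|rewrite T00 mul0r].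
  move=> /eqP; rewrite expf_eq0 /= mA // => /eqP h.
  have : ra * (ua - c - x0) = 0 by rewrite -h; ring.
  by move=> /eqP; rewrite mulf_eq0 (gt_eqF ra0) /= subr_eq0 => /eqP.
have rfan x : G x -> x0 <= x -> x < x1 -> rho x = m x / c.
  move=> Gx xx xx1.
  have Tx : Tp x = 0.
    by move: xx; rewrite le_eqVlt => /predU1P[E|xx]; [rewrite -E; apply: (x0E _).2; lra|exact: Tz xx (ltW xx1)].
  have := Tp_G H Gx; rewrite Tx mul0r => /esym/eqP; rewrite expf_eq0 /= subr_eq0 => /eqP ->.
  by field; rewrite gt_eqF.
have mB x : x0 <= x -> x <= x1 -> x0 < x1 -> m x = c * (ra * expR ((ua - x) / c - 1)).
  move=> xx xx1 lt; have [x0e _] := x0E lt.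
  pose F := (fun y : R => m y * expR (y / c)).
  have dF y : x0 < y < x1 -> is_derive y (1 : R) F 0.
    move=> yy.
    have cmc : {for y, continuous (fun w => m w / c)}.
      by apply: cvgM; [exact: cm|exact: cvg_cst].
    have hy z : G z -> x0 < z < x1 -> rho z = m z / c.
      by move=> Gz /andP[h1 h2]; apply: rfan => //; exact: ltW.
    have d1 := m_derive_branch H yy cmc hy.
    have d2 := is_deriveM (@is_derive_id _ _ y (1 : R)) (@is_derive_cst _ _ _ (c^-1 : R) y (1 : R)).
    have d3 := is_derive1_comp (is_derive_expR ((id * cst c^-1) y)) d2.
    have d4 := is_deriveM d1 d3.
    refine (is_derive_eq d4 _).
    by rewrite /GRing.scale /= /cst /=; field; rewrite gt_eqF.
  have : F x = F x0.
    apply: derive0_cst => //.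
      by move=> y /andP[h1 h2]; apply: dF; apply/andP; split; lra.
    apply: continuous_subspaceT => y; apply: cvgM; first exact: cm.
    apply: continuous_comp; last exact: continuous_expR.
    by apply: cvgM; [exact: cvg_id|exact: cvg_cst].
  rewrite /F (mA x0) // => E.
  have -> : m x = ra * (ua - x0) * expR (x0 / c) / expR (x / c).
    by rewrite -E mulfK // gt_eqF // expR_gt0.
  rewrite -mulrA -expRN -expRD x0e.
  have -> : (ua - c) / c + - (x / c) = (ua - x) / c - 1 by field; rewrite gt_eqF.
  ring.
have [k hk] : exists k, forall z, x1 < z < xs -> up z = k.
  apply: (const_branch c0 H) => //; first by rewrite expr1n.
    by move=> z /andP[z1 zs]; apply: (disc_pos c0 H); [exact: mpos|apply: T1; rewrite z1 zs].
  move=> z Gz /andP[z1 zs]; apply: (rho_up c0 H) => //; first exact/ltW/mpos.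
  by apply: sub1 => //; rewrite z1 zs.
have rk z : G z -> x1 < z < xs -> rho z = k.
  move=> Gz /andP[z1 zs]; rewrite -(hk z) ?z1 ?zs //; apply: (rho_up c0 H) => //; first exact/ltW/mpos.
  by apply: sub1 => //; rewrite z1 zs.
have mC x : x1 <= x -> x <= xs -> m x = k * (xs - x).
  move=> h1 h2; have := @m_affine x xs k h2 (fun z Gz zz => rk z Gz ltac:(lra)).
  by rewrite mxs subr0.
have up1 : up x1 = k by have [] := @cont_eq_left up x1 xs k (branch_cont H 1) x1s hk.
have m10 := mpos _ x1s.
have k0 : 0 < k.
  by have := mC x1 (lexx _) (ltW x1s) => h; rewrite h pmulr_lgt0 ?subr_gt0 // in m10.
have P1 : P x1 * k = m x1 ^+ 2 + c ^+ 2 * k ^+ 2.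
  by rewrite -up1; apply: branch_quad; rewrite ?expr1n //; apply: disc_ge0; exact: ltW.
have ck : m x1 <= c * k.
  suff : forall x, x1 <= x <= xs -> 0 <= c * k - m x by move=> /(_ x1); rewrite lexx ltW // => /(_ isT); lra.
  apply: (@ge0_dense _ (fun x => c * k - m x) G); [|exact: sm_G H|by []|].
    by move=> x; apply: cvgB; [exact: cvg_cst|exact: cm].
  by move=> x Gx xx; rewrite subr_ge0 -(rk x Gx xx); exact: sub1.
have kE : k = ra * hz ((ua - x1) / c).
  have [x1c|cx1] := leP x1 (ua - c).
    have e01 : x0 = x1.
      by apply/le_anti; rewrite x01 /= leNgt; apply/negP => lt; have [] := x0E lt; lra.
    have z1 : 1 <= (ua - x1) / c by rewrite ler_pdivlMr // mul1r; lra.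
    rewrite hz_ge1 //.
    have m1E : m x1 = ra * (ua - x1) by rewrite mA // e01.
    have P1' : P x1 * ra = m x1 ^+ 2 + c ^+ 2 * ra ^+ 2 by rewrite -e01.
    have : (k - ra) * (c ^+ 2 * k * ra - m x1 ^+ 2) = 0.
      have -> : (k - ra) * (c ^+ 2 * k * ra - m x1 ^+ 2) =
        ra * (m x1 ^+ 2 + c ^+ 2 * k ^+ 2) - k * (m x1 ^+ 2 + c ^+ 2 * ra ^+ 2) by ring.
      by rewrite -P1 -P1'; ring.
    move=> /eqP; rewrite mulf_eq0 => /orP[|] /eqP h.
      have kr : k = ra by lra.
      have : ua - x1 = c.
        apply/le_anti/andP; split; last lra.
        by move: ck; rewrite kr m1E mulrC ler_pM2r.
      by move=> ->; rewrite divff ?gt_eqF // expr1n mulr1.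
    have -> : k = m x1 ^+ 2 / (c ^+ 2 * ra).
      have -> : m x1 ^+ 2 = c ^+ 2 * k * ra by lra.
      by field; rewrite !gt_eqF.
    by rewrite m1E; field; rewrite !gt_eqF.
  have lt : x0 < x1 by lra.
  have Tx1 : Tp x1 = 0 by apply: Tz.
  rewrite hzE; last by rewrite ler_pdivrMr // mul1r; lra.
  have : (m x1 - c * k) ^+ 2 = 0.
    by transitivity (Tp x1 * k); [rewrite Tp_E mulrBl P1; ring|rewrite Tx1 mul0r].
  move=> /eqP; rewrite expf_eq0 /= subr_eq0 => /eqP; rewrite mB //.
  by move=> /(mulfI _) -> //; rewrite gt_eqF.
have fanE x : ua - c <= x -> x <= x1 -> m x = c * (ra * gz ((ua - x) / c)).
  move=> h1 h2; have z1 : (ua - x) / c <= 1 by rewrite ler_pdivrMr // mul1r; lra.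
  have [lt|ge] := ltP x0 x1; first by rewrite gzE // mB //; lra.
  have xe : x = ua - c by lra.
  rewrite mA; last lra.
  by rewrite xe gz_ge1; [ring|rewrite ler_pdivlMr // mul1r; lra].
exists ra, ua, x1; split => //.
- move=> x h1 h2; apply: mA; have [lt|ge] := ltP x0 x1; last lra.
  by have [->] := x0E lt.
- by move=> x h1 h2; rewrite mC // kE.
- move=> x Gx xxs xne; rewrite /dens; case: ltP => [xx1|]; last first.
    rewrite le_eqVlt eq_sym (negbTE xne) /= => lt.
    by rewrite -kE; apply: rk => //; rewrite lt.
  have [lt|ge] := ltP x x0.
    rewrite gz_ge1 ?mulr1; first by rewrite rlo // lo_ra.
    by rewrite ler_pdivlMr // mul1r; lra.
  have lt01 : x0 < x1 by lra.
  rewrite rfan // fanE; [by field; rewrite gt_eqF|by have [<-] := x0E lt01|exact: ltW].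
Qed.

End LeftExplicit.

(** * Dilations and reflection of the line *)

Section Scaling.
Context {R : realType}.
Local Notation mu := (@lebesgue_measure R).
Variables (k : R) (k0 : k != 0).

Lemma measurable_scale : measurable_fun setT (fun x : R => k * x).
Proof. by apply: continuous_measurable_fun => x; apply: cvgM; [exact: cvg_cst|exact: cvg_id]. Qed.

Let T := measurableTypeR R.
Let kx : T -> T := fun x => k * x.
Let mkx : measurable_fun setT kx := measurable_scale.
Let push : {measure set T -> \bar R} :=
  measure_function_pushforward__canonical__measure_function_Measure mu mkx.
Let dil : {measure set T -> \bar R} := mscale (NngNum (normr_ge0 k)) push.

Lemma lebesgue_scale (A : set R) : measurable A ->
  (mu A = `|k|%:E * mu (kx @^-1` A))%E.
Proof.
move=> mA; apply: (@lebesgue_measure_unique R dil) => // X [[a b] /= _ <-].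
rewrite /dil /= /mscale /= /pushforward.
have [kp|kn] : (0 < k) \/ (k < 0).
  by case: (ltgtP k 0) k0 => // h _; [right|left].
- have -> : kx @^-1` `]a, b] = [set` `]a / k, b / k]] :> set R.
    apply/seteqP; split => x /=; by rewrite !in_itv /= /kx ltr_pdivrMr // ler_pdivlMr // (mulrC k).
  rewrite !lebesgue_measure_itv /= !lte_fin ltr_pM2r ?invr_gt0 //.
  case: ifP => ab; last by rewrite mule0.
  by rewrite !EFinN -EFinD -EFinM gtr0_norm //; congr (_%:E); field; rewrite gt_eqF.
- have -> : kx @^-1` `]a, b] = [set` `[b / k, a / k[] :> set R.
    apply/seteqP; split => x /=; by rewrite !in_itv /= /kx ltr_ndivlMr // ler_ndivrMr // (mulrC k) andbC.
  rewrite !lebesgue_measure_itv /= !lte_fin ltr_nM2r ?invr_lt0 //.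
  case: ifP => ab; last by rewrite mule0.
  by rewrite !EFinN -EFinD -EFinM ltr0_norm //; congr (_%:E); field; rewrite lt_eqF.
Qed.

Lemma ge0_integral_scale (F : R -> \bar R) : measurable_fun setT F -> (forall x, 0 <= F x)%E ->
  (\int[mu]_x F x = `|k|%:E * \int[mu]_x F (k * x)%R)%E.
Proof.
move=> mF F0.
transitivity (\int[dil]_x F x)%E.
  by apply: eq_measure_integral => A mA _; exact: lebesgue_scale.
rewrite /dil ge0_integral_mscale //; congr (_ * _)%E.
rewrite ge0_integral_pushforward // preimage_setT //.
Qed.

Lemma integral_scale (F : R -> R) : measurable_fun setT F ->
  mu.-integrable setT (EFin \o (fun x => F (k * x))) ->
  \int[mu]_x F x = `|k| * \int[mu]_x F (k * x).
Proof.
move=> mF iF.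
have mFk : measurable_fun setT (fun x => F (k * x)) by apply: measurableT_comp => //; exact: measurable_scale.
have fin := integrable_fin_num measurableT iF.
suff -> : \int[mu]_x F x = fine (`|k|%:E * \int[mu]_x (F (k * x)%R)%:E)%E by rewrite fineM.
congr fine; rewrite integralE.
have mE : measurable_fun setT (EFin \o F) by exact/measurable_EFinP.
have hp := @ge0_integral_scale ((EFin \o F)^\+)%E (measurable_funepos mE) (fun=> funepos_ge0 _ _).
have hn := @ge0_integral_scale ((EFin \o F)^\-)%E (measurable_funeneg mE) (fun=> funeneg_ge0 _ _).
have ep : (\int[mu]_x (EFin \o F)^\+ (k * x)%R = \int[mu]_x (EFin \o (fun y => F (k * y)%R))^\+ x)%E.
  by apply: eq_integral => x _; rewrite !funeposE.
have en : (\int[mu]_x (EFin \o F)^\- (k * x)%R = \int[mu]_x (EFin \o (fun y => F (k * y)%R))^\- x)%E.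
  by apply: eq_integral => x _; rewrite !funenegE.
rewrite hp hn ep en [in RHS]integralE; apply: esym; apply: muleBr => //.
exact: (integrable_add_def _ iF).
Qed.

Lemma conull_scale (G : set R) : conull G -> conull [set x | G (k * x)].
Proof.
move=> [N [mN N0 GN]]; exists (kx @^-1` N); split.
- by rewrite -[X in measurable X]setTI; exact: mkx.
- have mN' : measurable N := mN.
  have := lebesgue_scale mN'; have -> : mu N = 0%E by exact: N0.
  by move=> /esym/eqP; rewrite mule_eq0 eqe normr_eq0 (negbTE k0) => /eqP.
- by move=> x /= h; apply: GN.
Qed.

End Scaling.

Section Reflection.
Context {R : realType}.

Lemma conull_opp (G : set R) : conull G -> conull [set x | G (- x)].
Proof.
move=> /(@conull_scale R (-1) ltac:(by rewrite oppr_eq0 oner_eq0)).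
by apply: conullS => x /=; rewrite mulN1r.
Qed.

Lemma locbm_opp (f : R -> R) : locbm f -> locbm (fun x => f (- x)).
Proof.
move=> [mf bf]; split.
  rewrite (_ : (fun x => _) = (fun x => f ((-1) * x))); last by apply/funext => x; rewrite mulN1r.
  by apply: measurableT_comp => //; exact: measurable_scale.
by move=> A; have [M HM] := bf A; exists M => x xA; apply: HM; rewrite normrN.
Qed.

Lemma Iab_opp (f : R -> R) a b : locbm f ->
  Iab a b (fun x => f (- x)) = Iab (- b) (- a) f.
Proof.
move=> hf; rewrite /Iab [LHS]Rintegral_mkcond [RHS]Rintegral_mkcond.
have E : (fun x => (f \_ `[- b, - a]) (-1 * x)) = (fun x => f (- x)) \_ `[a, b].
  apply/funext => x; rewrite !patchE mulN1r.
  have -> : (- x \in `[- b, - a]%classic) = (x \in `[a, b]%classic).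
    by rewrite !mem_setE !in_itv /= !lerN2 andbC.
  by [].
rewrite [RHS](@integral_scale R (-1)); last 3 first.
- by rewrite oppr_eq0 oner_eq0.
- apply: (proj1 (measurable_restrictT _ (measurable_itv _))); apply: measurable_funTS; by case: hf.
- rewrite E; rewrite -restrict_EFin; apply/integrable_restrict => //.
  by rewrite setTI; exact: (locbm_int _ _ (locbm_opp hf)).
by rewrite normrN normr1 mul1r; congr Rintegral.
Qed.

(** Reflection changes the sign of velocities, hence of m, and keeps the pressure; the energy flux is
odd in m, which compensates the reversal of the order. *)
Lemma simil_opp (c : R) (rho m P : R -> R) (G : set R) : simil c rho m P G ->
  simil c (fun x => rho (- x)) (fun x => - m (- x)) (fun x => P (- x)) [set x | G (- x)].
Proof.
move=> H; split.
- exact: locbm_opp (sm_loc H).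
- by have [r [M [r0 h]]] := sm_bnd H; exists r, M; split.
- exact: conull_opp (sm_G H).
- move=> a b ab; rewrite Iab_opp; last exact: sm_loc H.
  by rewrite -(sm_m H) ?lerN2 //; ring.
- move=> x.
  have d1 := is_deriveN (@is_derive_id _ _ x (1 : R)).
  have d2 := is_derive1_comp (sm_P H (- x) : is_derive ((- id) x) (1:R) P _) d1.
  by refine (is_derive_eq d2 _); ring.
- by move=> x Gx; rewrite sqrrN; exact: (sm_q H).
- move=> x0 e e0; have [d d0 Hd] := sm_E H (- x0) e0.
  exists d => // a b Ga Gb ab ad bd.
  have := Hd (- b) (- a) Gb Ga; rewrite ltrN2 -!opprD !normrN => /(_ ab bd ad).
  by rewrite /Eflux !sqrrN !mulNr; lra.
Qed.

End Reflection.

(** * Cut-off functions and Lebesgue points *)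

Section Step.
Context {R : realType}.

(** th is a step across the unit interval, with derivative ka; the cut-off functions are differences
of two translated and dilated steps. *)
Definition is_step (th ka : R -> R) (K : R) : Prop :=
  [/\ continuous ka /\ (forall x, is_derive x (1 : R) th (ka x)),
      forall x, 0 <= ka x <= K,
      forall x, x <= 0 -> th x = 0 /\ ka x = 0,
      forall x, 1 <= x -> th x = 1 /\ ka x = 0 &
      {homo th : x y / x <= y}].

Lemma step_exists : exists th ka K, is_step th ka K.
Proof.
pose k0 (x : R) := Num.max 0 (x * (1 - x)).
have ck0 : continuous k0.
  move=> x; apply: (@continuous_max _ _ (fun=> 0 : R) (fun y : R => y * (1 - y)) x).
    exact: cvg_cst.
  by apply: cvgM; [exact: cvg_id|apply: cvgB; [exact: cvg_cst|exact: cvg_id]].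
have lk0 := locbm_cont ck0.
have k0ge x : 0 <= k0 x by rewrite le_max lexx.
pose w := Iab 0 1 k0.
have w0 : 0 < w.
  rewrite /w (@Iab_split _ _ _ (1/4) _ lk0); [|lra|lra].
  rewrite (@Iab_split _ _ (1/4) (3/4) 1 lk0); [|lra|lra].
  have h (a b : R) : 0 <= Iab a b k0 by apply: Rintegral_ge0 => x _; exact: k0ge.
  have : 3/16 * (3/4 - 1/4) <= Iab (1/4) (3/4) k0.
    rewrite -Iab_cst; last lra.
    apply: (Iab_le (@conullT R)) => //; first exact: locbm_cst.
    move=> x _ /andP[h1 h2]; rewrite le_max; apply/orP; right.
    have := mulr_ge0 (ltac:(lra) : 0 <= x - 1/4) (ltac:(lra) : 0 <= 3/4 - x); lra.
  have := h 0 (1/4); have := h (3/4) 1; lra.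
pose ka x := k0 x / w.
have cka : continuous ka by move=> x; apply: cvgM; [exact: ck0|exact: cvg_cst].
have kage x : 0 <= ka x by rewrite divr_ge0 // ltW.
have lka := locbm_cont cka.
have [F HF] := primitive_exists lka.
pose th x := F x - F 0.
have dF z : is_derive z (1 : R) th (ka z).
  have h : is_derive z (1 : R) F (ka z).
    apply: (@primitive_derive _ setT ka) => //; first exact: conullT.
    move=> e e0; have [d d0 hd] := cont_at_eps (cka z) e0.
    by exists d => // y _; exact: hd.
  by refine (is_derive_eq (is_deriveB h (@is_derive_cst _ _ _ (F 0) z (1:R))) _); rewrite subr0.
have kz x : x <= 0 \/ 1 <= x -> ka x = 0.
  move=> hx; rewrite /ka /k0 max_l ?mul0r //.
  case: hx => hx.
    have := mulr_ge0 (ltac:(lra) : 0 <= - x) (ltac:(lra) : 0 <= 1 - x); lra.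
  have := mulr_ge0 (ltac:(lra) : 0 <= x) (ltac:(lra) : 0 <= x - 1); lra.
have homo x y : x <= y -> th x <= th y.
  by move=> xy; rewrite -subr_ge0 /th opprB addrA subrK HF //; apply: Rintegral_ge0 => z _.
have flat (a b : R) : a <= b -> (forall x, a < x < b -> ka x = 0) -> F b - F a = 0.
  move=> ab h; rewrite HF //.
  have -> : Iab a b ka = Iab a b (fun=> 0 : R).
    by apply: (Iab_ae (@conullT R)) => //; [exact: locbm_cst|move=> x _ /h].
  by rewrite Iab_cst // mul0r.
have th1 : F 1 - F 0 = 1.
  rewrite HF //.
  have -> : Iab 0 1 ka = Iab 0 1 (fun x => w^-1 * k0 x).
    by apply: eq_Rintegral => x _; rewrite /ka mulrC.
  by rewrite IabZ // mulVf // gt_eqF.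
exists th, ka, w^-1; split => //.
- move=> x; rewrite kage /= /ka -[leRHS]mul1r ler_pM2r ?invr_gt0 //.
  rewrite ge_max ler01 /=.
  have := sqr_ge0 (x - 1/2); rewrite expr2; lra.
- move=> x x0; split; last by apply: kz; left.
  have := flat x 0 x0 (fun y yy => kz y ltac:(left; lra)); rewrite /th; lra.
- move=> x x1; split; last by apply: kz; right.
  have := flat 1 x x1 (fun y yy => kz y ltac:(right; lra)); rewrite /th; lra.
Qed.

End Step.

Section LebesguePoints.
Context {R : realType}.
Local Notation mu := (@lebesgue_measure R).

Lemma locbm_locally_integrable (g : R -> R) : locbm g -> locally_integrable setT g.
Proof.
move=> hg; split; [by case: hg|exact: openT|].
move=> K _ cK.
have [M [_ HM]] := compact_bounded cK.
pose A := `|M| + 1.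
have KA x : K x -> `|x| <= A.
  by move=> Kx; apply: (HM A _ x Kx); rewrite /A; have := ler_norm M; lra.
have mK : measurable K by exact: compact_measurable.
have /integrableP[_ H] := locbm_int (- A) A hg.
apply: le_lt_trans H.
have mg : measurable_fun setT g by case: hg.
apply: ge0_subset_integral => //.
- by do 2 apply/measurableT_comp => //; apply: measurable_funTS.
- by move=> x Kx /=; rewrite in_itv /= -ler_norml; exact: KA.
Qed.

(** One-sided form of the Lebesgue differentiation theorem, suited to mollifiers supported on
the right of a. *)
Lemma lebesgue_points (g : R -> R) : locbm g -> exists2 G, conull G &
  forall a e : R, G a -> 0 < e -> exists2 h0 : R, 0 < h0 &
    forall h, 0 < h < h0 -> Iab a (a + h) (fun y => `|g y - g a|) <= e * h.
Proof.
move=> hg; exists [set x | lebesgue_pt g x].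
  exact: lebesgue_differentiation (locbm_locally_integrable hg).
move=> a e /= La e0.
have /fine_cvgP[fin cv] := La.
have /cvgrPdist_lt/(_ (e / 4) ltac:(lra)) cv' := cv.
have := cv'; rewrite near_withinE => /nbhs_ballP[d /= d0 Hd].
have := fin; rewrite near_withinE => /nbhs_ballP[d1 /= d10 Hd1].
exists (Num.min d d1 / 2); first by rewrite divr_gt0 // lt_min d0 d10.
move=> h /andP[h0 hd].
have [hda hdb] : 2 * h < d /\ 2 * h < d1.
  by move: hd; rewrite ltr_pdivlMr // lt_min => /andP[h1 h2]; split; lra.
have lg : locbm (fun y => `|g y - g a|) by apply: locbm_norm; apply: locbmB => //; exact: locbm_cst.
have b1 : ball (0 : R) d (2 * h) by rewrite /ball /= sub0r normrN ger0_norm; lra.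
have b2 : ball (0 : R) d1 (2 * h) by rewrite /ball /= sub0r normrN ger0_norm; lra.
have := Hd _ b1 ltac:(lra); have := Hd1 _ b2 ltac:(lra).
rewrite sub0r normrN /=.
rewrite /davg /iavg lebesgue_measure_ball; last lra.
set I := (\int[mu]_(y in ball a (2 * h)) _)%E => fin2 lt2.
pose k : R := 2 * h *+ 2.
have kE : k = 4 * h by rewrite /k mulr2n; ring.
have k0 : k != 0 by rewrite kE gt_eqF //; lra.
have IE : I = (k%:E * ((k%:E)^-1 * I))%E.
  by rewrite muleA inver (negbTE k0) -EFinM mulfV // mul1e.
rewrite -/k in fin2 lt2.
set J := ((k%:E)^-1 * I)%E in fin2 lt2 IE.
have le1 : ((Iab a (a + h) (fun y => `|g y - g a|))%:E <= I)%E.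
  rewrite IabE //.
  apply: (@le_trans _ _ (\int[mu]_(y in `[a, (a + h)%R]) `|((center (g a) \o g) y)%:E|)%E) => //.
  apply: ge0_subset_integral => //.
  - exact: measurable_ball.
  - apply: measurableT_comp => //; apply/measurable_EFinP; apply: measurable_funTS.
    by have [] := locbmB hg (locbm_cst (g a)).
  - move=> y /=; rewrite in_itv /= /ball /= => /andP[h1 h2].
    by rewrite ler0_norm; lra.
have : ((Iab a (a + h) (fun y => `|g y - g a|))%:E <= (k * fine J)%:E)%E.
  by apply: le_trans le1 _; rewrite IE EFinM fineK.
rewrite lee_fin => /le_trans; apply.
have J1 : fine J < e / 4 by apply: le_lt_trans lt2; exact: ler_norm.
have -> : e * h = k * (e / 4) by rewrite kE; field.
by rewrite ler_pM2l ?kE; [exact: ltW|lra].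
Qed.

End LebesguePoints.

(** * Differential inequalities in the sense of distributions *)

Section Distribution.
Context {R : realType}.
Variables (th ka : R -> R) (K : R).
Hypothesis St : is_step th ka K.

Definition ramp (a h x : R) : R := th ((x - a) / h).
Definition mol (a h x : R) : R := ka ((x - a) / h) / h.
Definition hump (a b h x : R) : R := ramp a h x - ramp b h x.
Definition dhump (a b h x : R) : R := mol a h x - mol b h x.

Lemma St_cont : continuous ka. Proof. by have [[]] := St. Qed.
Lemma St_der x : is_derive x (1 : R) th (ka x). Proof. by have [[]] := St. Qed.

Lemma affine_cont (a h : R) : continuous (fun x : R => (x - a) / h).
Proof.
by move=> x; apply: cvgM; [apply: cvgB; [exact: cvg_id|exact: cvg_cst]|exact: cvg_cst].
Qed.

Lemma mol_cont (a h : R) : continuous (mol a h).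
Proof.
move=> x; apply: cvgM; last exact: cvg_cst.
apply: (@continuous_comp _ _ _ (fun y : R => (y - a) / h) ka x); first exact: affine_cont.
exact: St_cont.
Qed.

Lemma ramp_der (a h x : R) : is_derive x (1 : R) (ramp a h) (mol a h x).
Proof.
have d1 := is_deriveM (is_deriveB (@is_derive_id _ _ x (1:R)) (@is_derive_cst _ _ _ a x (1:R))) (@is_derive_cst _ _ _ (h^-1) x (1:R)).
refine (is_derive_eq (is_derive1_comp (St_der _ : is_derive (((id - cst a) * cst h^-1) x) 1 th _) d1) _).
by rewrite /GRing.scale /= /cst /mol /=; ring.
Qed.

Lemma hump_der (a b h x : R) : is_derive x (1 : R) (hump a b h) (dhump a b h x).
Proof. exact: is_deriveB (ramp_der a h x) (ramp_der b h x). Qed.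

Lemma dhump_cont (a b h : R) : continuous (dhump a b h).
Proof. by move=> x; apply: cvgB; exact: mol_cont. Qed.

Lemma hump_cont (a b h : R) : continuous (hump a b h).
Proof. exact: ex_derive_cont (hump_der a b h). Qed.

Lemma ramp_lo (a h x : R) : 0 < h -> x <= a -> ramp a h x = 0 /\ mol a h x = 0.
Proof.
move=> h0 xa; rewrite /ramp /mol; have [_ _ + _ _] := St.
move=> /(_ ((x - a) / h)) [|-> ->]; last by rewrite mul0r.
by rewrite pmulr_lle0 ?invr_gt0 // subr_le0.
Qed.

Lemma ramp_hi (a h x : R) : 0 < h -> a + h <= x -> ramp a h x = 1 /\ mol a h x = 0.
Proof.
move=> h0 xa; rewrite /ramp /mol; have [_ _ _ + _] := St.
move=> /(_ ((x - a) / h)) [|-> ->]; last by rewrite mul0r.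
by rewrite ler_pdivlMr // mul1r; lra.
Qed.

Lemma ramp01 (a h x : R) : 0 < h -> 0 <= ramp a h x <= 1.
Proof.
move=> h0; have [_ _ l r mono] := St; rewrite /ramp; set z := (x - a) / h.
have [z0|z0] := leP z 0; first by rewrite (l z z0).1 lexx ler01.
have [z1|z1] := leP 1 z; first by rewrite (r z z1).1 lexx ler01.
by rewrite -{1}(l 0 (lexx _)).1 -(r 1 (lexx _)).1 !mono // ltW.
Qed.

Lemma hump01 (a b h x : R) : 0 < h -> a <= b -> 0 <= hump a b h x <= 1.
Proof.
move=> h0 ab; have := ramp01 a x h0; have := ramp01 b x h0; rewrite /hump.
have [_ _ _ _ mono] := St.
have : ramp b h x <= ramp a h x.
  by apply: mono; rewrite ler_pM2r ?invr_gt0 //; lra.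
by move=> ? /andP[? ?] /andP[? ?]; apply/andP; split; lra.
Qed.

Lemma hump_out (a b h x : R) : 0 < h -> a <= b -> x <= a \/ b + h <= x -> hump a b h x = 0 /\ dhump a b h x = 0.
Proof.
move=> h0 ab; rewrite /hump /dhump => -[hx|hx].
  have [-> ->] := ramp_lo h0 hx.
  by have [|-> ->] := @ramp_lo b h x h0; [lra|rewrite subrr].
have [-> ->] := ramp_hi h0 hx.
by have [|-> ->] := @ramp_hi a h x h0; [lra|rewrite !subrr].
Qed.

Lemma hump_in (a b h x : R) : 0 < h -> a + h <= x <= b -> hump a b h x = 1.
Proof.
move=> h0 /andP[h1 h2]; rewrite /hump (ramp_hi h0 h1).1.
by rewrite (ramp_lo h0 h2).1 subr0.
Qed.

Lemma mol_bound (a h x : R) : 0 < h -> 0 <= mol a h x <= K / h.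
Proof.
move=> h0; have [_ + _ _ _] := St => /(_ ((x - a) / h)) /andP[h1 h2].
by rewrite /mol divr_ge0 ?ler_pM2r ?invr_gt0 // ltW.
Qed.

Lemma mol_mass (a h : R) : 0 < h -> Iab a (a + h) (mol a h) = 1.
Proof.
move=> h0; have ah : a <= a + h by lra.
have -> := FTC ah (@mol_cont a h) (ramp_der a h).
by rewrite (ramp_hi h0 (lexx _)).1 (ramp_lo h0 (lexx _)).1 subr0.
Qed.

Lemma mol_approx (g : R -> R) a h e : locbm g -> 0 < h -> 0 < e ->
  Iab a (a + h) (fun y => `|g y - g a|) <= e * h ->
  `|Iab a (a + h) (fun y => g y * mol a h y) - g a| <= K * e.
Proof.
move=> lg h0 e0 He.
have lm := locbm_cont (@mol_cont a h).
have ld : locbm (fun y => g y - g a) by apply: locbmB => //; exact: locbm_cst.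
have -> : g a = Iab a (a + h) (fun y => g a * mol a h y) by rewrite IabZ // mol_mass // mulr1.
rewrite -IabB; [|exact: locbmM|exact: locbmM (locbm_cst _) lm].
have -> : (fun x => g x * mol a h x - g a * mol a h x) = (fun x => (g x - g a) * mol a h x).
  by apply/funext => x; rewrite mulrBl.
apply: le_trans (Iab_norm _ _ (locbmM ld lm)) _.
have -> : K * e = K / h * (e * h) by field; rewrite gt_eqF.
have K0 : 0 <= K / h by have /andP[? ?] := mol_bound a a h0; lra.
apply: le_trans (ler_wpM2l K0 He).
rewrite -IabZ; last exact: locbm_norm.
apply: (Iab_le (@conullT R)); [exact: locbm_norm (locbmM ld lm)|exact: locbmM (locbm_cst _) (locbm_norm ld)|].
move=> x _ _; rewrite normrM mulrC; apply: ler_wpM2r => //.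
by have /andP[m0 m1] := mol_bound a x h0; rewrite ger0_norm.
Qed.

Lemma Iab0 (f : R -> R) a b : a <= b -> locbm f -> (forall x, a <= x <= b -> f x = 0) -> Iab a b f = 0.
Proof.
move=> ab lf h; transitivity (Iab a b (fun=> 0 : R)); last by rewrite Iab_cst // mul0r.
apply: (Iab_ae (@conullT R)) => //; first exact: locbm_cst.
by move=> x _ /andP[h1 h2]; apply: h; rewrite !ltW.
Qed.

(** Testing - g' >= e with plateaus from a to b whose edges have width h, and letting h tend to 0,
gives the inequality whenever a and b are Lebesgue points of g. *)
Lemma dist_ineq (g e : R -> R) : locbm g -> locbm e ->
  (forall a b h, 0 < h -> a <= b ->
     Iab a (b + h) (fun x => e x * hump a b h x) <= Iab a (b + h) (fun x => g x * dhump a b h x)) ->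
  exists2 G, conull G & forall a b, G a -> G b -> a < b -> Iab a b e <= g a - g b.
Proof.
move=> lg le Hw; have [G cG HG] := lebesgue_points lg.
exists G => // a b Ga Gb ab.
have [C C0 HC] := locbm_itv a (b + 1) le.
apply/ler_addgt0Pr => eps eps0.
have K0 : 0 <= K.
  by have [_ + _ _ _] := St => /(_ 0) /andP[]; exact: le_trans.
pose e1 := eps / (4 * (K + 1)).
have K10 : 0 < K + 1 by rewrite ltr_wpDl.
have C10 : 0 < C + 1 by rewrite ltr_wpDl.
have e10 : 0 < e1 by rewrite divr_gt0 // mulr_gt0.
have Ke1 : K * e1 <= eps / 4.
  have -> : eps / 4 = (K + 1) * e1 by rewrite /e1; field; rewrite gt_eqF.
  by rewrite ler_pM2r // lerDl ler01.
have [h1 h10 Ha] := HG a e1 Ga e10.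
have [h2 h20 Hb] := HG b e1 Gb e10.
pose h := Num.min (Num.min (h1 / 2) (h2 / 2)) (Num.min (Num.min 1 ((b - a) / 2)) (eps / (4 * (C + 1)))).
have h0 : 0 < h.
  by rewrite /h !lt_min ltr01 !divr_gt0 //=; [rewrite mulr_gt0|rewrite subr_gt0].
have : h <= h by [].
rewrite {2}/h !le_min => /andP[/andP[hh1 hh2] /andP[/andP[hh3 hh4] hh5]].
have Ch : C * h <= eps / 4.
  have -> : eps / 4 = (C + 1) * (eps / (4 * (C + 1))) by field; rewrite gt_eqF.
  by apply: ler_pM => //; [exact: ltW|rewrite lerDl ler01].
have [ah ahb bbh] : [/\ a <= a + h, a + h <= b & b <= b + h].
  by move: h0 hh4 ab; clear; split; lra.
have [h_h1 h_h2] : h < h1 /\ h < h2 by move: hh1 hh2 h10 h20; clear; split; lra.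
have abh := le_trans (ltW ab) bbh.
have ahbh := le_trans ahb bbh.
have lma := locbm_cont (@mol_cont a h); have lmb := locbm_cont (@mol_cont b h).
have lb := locbm_cont (@hump_cont a b h).
have A1 := mol_approx lg h0 e10 (Ha h ltac:(by rewrite h0 h_h1)).
have B1 := mol_approx lg h0 e10 (Hb h ltac:(by rewrite h0 h_h2)).
have := Hw a b h h0 (ltW ab).
have -> : Iab a (b + h) (fun x => g x * dhump a b h x) =
  Iab a (a + h) (fun y => g y * mol a h y) - Iab b (b + h) (fun y => g y * mol b h y).
  have -> : (fun x => g x * dhump a b h x) = (fun x => g x * mol a h x - g x * mol b h x).
    by apply/funext => x; rewrite mulrBr.
  rewrite IabB; [|exact: locbmM|exact: locbmM].
  congr (_ - _).
    rewrite (@Iab_split _ _ a (a + h) (b + h)) //; last exact: locbmM.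
    rewrite (@Iab0 _ (a + h)) ?addr0 //; first exact: locbmM.
    by move=> x /andP[hx _]; rewrite (ramp_hi h0 hx).2 mulr0.
  rewrite (@Iab_split _ _ a b (b + h) _ (ltW ab)) //; last exact: locbmM.
  rewrite (@Iab0 _ a b) ?add0r //; [exact: ltW|exact: locbmM|].
  by move=> x /andP[_ hx]; rewrite (ramp_lo h0 hx).2 mulr0.
have E1 : Iab a b e - 2 * (C * h) <= Iab a (b + h) (fun x => e x * hump a b h x).
  have leb : locbm (fun x => e x * hump a b h x) by exact: locbmM.
  rewrite (@Iab_split _ _ a (a + h) (b + h) leb) //.
  rewrite (@Iab_split _ _ (a + h) b (b + h) leb) //.
  rewrite (@Iab_split _ e a (a + h) b le) //.
  have -> : Iab (a + h) b (fun x => e x * hump a b h x) = Iab (a + h) b e.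
    apply: (Iab_ae (@conullT R)) => // x _ /andP[? ?].
    by rewrite hump_in ?mulr1 // !ltW.
  have I1 : `|Iab a (a + h) (fun x => e x * hump a b h x - e x)| <= C * (a + h - a).
    apply: (Iab_bound (@conullT R)) => //; first exact: locbmB.
    move=> x _ xx; have -> : e x * hump a b h x - e x = e x * (hump a b h x - 1) by ring.
    rewrite normrM -[leRHS]mulr1; apply: ler_pM => //; first by apply: HC; move: xx ahb hh3 h0 ab; clear; lra.
    have /andP[+ +] := @hump01 a b h x h0 (ltW ab); clear => u0 u1.
    by rewrite ler0_norm; lra.
  have I2 : `|Iab b (b + h) (fun x => e x * hump a b h x)| <= C * (b + h - b).
    apply: (Iab_bound (@conullT R)) => //.
    move=> x _ xx; rewrite normrM -[leRHS]mulr1; apply: ler_pM => //; first by apply: HC; move: xx hh3 ab; clear; lra.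
    by have /andP[u0 u1] := @hump01 a b h x h0 (ltW ab); rewrite ger0_norm.
  move: I1; rewrite IabB // => I1.
  have e3 : a + h - a = h by ring.
  have e4 : b + h - b = h by ring.
  move: I1 I2; rewrite e3 e4 !ler_norml => /andP[+ +] /andP[+ +].
  by clear; lra.
by move: E1 A1 B1; rewrite !ler_norml => + /andP[+ +] /andP[+ +]; move: Ch Ke1; clear; lra.
Qed.

End Distribution.

(** * Self-similar test functions *)

Section TestFunctions.
Context {R : realType}.
Local Notation mu := (@lebesgue_measure R).

Definition C1supp (f df : R -> R) (a b : R) : Prop :=
  [/\ forall x, is_derive x (1 : R) f (df x), continuous df &
      forall x, x <= a \/ b <= x -> f x = 0 /\ df x = 0].

Lemma derive1_is (f : R -> R) x d : is_derive x (1 : R) f d -> derive1 f x = d.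
Proof. by move=> h; rewrite derive1E; exact: derive_val. Qed.

Lemma Rint_supp (f : R -> R) (D : set R) a b : measurable D ->
  [set` `[a, b]] `<=` D -> (forall x, D x -> ~ a <= x <= b -> f x = 0) ->
  \int[mu]_(x in D) f x = Iab a b f.
Proof.
move=> mD abD f0; rewrite /Iab Rintegral_mkcond [RHS]Rintegral_mkcond.
congr Rintegral; apply/funext => x; rewrite !patchE.
case: ifPn => xD; case: ifPn => xab //.
  apply: f0; first exact: set_mem.
  by move=> h; move: xab; rewrite mem_setE in_itv /= h.
by move: xD; rewrite (mem_set (abD x _)) //; exact: set_mem.
Qed.

Section SelfSimilar.
Variables (chi dchi psi dpsi : R -> R) (t0 t1 A : R).
Hypothesis t00 : 0 < t0.
Hypothesis t01 : t0 <= t1.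
Hypothesis A0 : 0 <= A.
Hypothesis Hchi : C1supp chi dchi t0 t1.
Hypothesis Hpsi : C1supp psi dpsi (- A) A.

Definition phis (t x : R) : R := chi t * psi (x / t).

Lemma phis0 (t x : R) : t <= t0 -> phis t x = 0.
Proof. by move=> h; rewrite /phis; have [_ _ /(_ t (or_introl h)) [-> _]] := Hchi; rewrite mul0r. Qed.

Lemma phis_dx t x : is_derive x (1 : R) (phis t) (chi t * dpsi (x / t) / t).
Proof.
have [dps _ _] := Hpsi.
have d1 := is_deriveM (@is_derive_id _ _ x (1:R)) (@is_derive_cst _ _ _ (t^-1) x (1:R)).
have d2 := is_derive1_comp (dps _ : is_derive ((id * cst t^-1) x) (1:R) psi _) d1.
have d3 := is_deriveM (@is_derive_cst _ _ _ (chi t) x (1:R)) d2.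
refine (is_derive_eq d3 _).
by rewrite /GRing.scale /= /cst /=; ring.
Qed.

Lemma phis_dt (t x : R) : 0 < t ->
  is_derive t (1 : R) (phis^~ x) (dchi t * psi (x / t) - chi t * dpsi (x / t) * x / t ^+ 2).
Proof.
move=> t_0; have [dps _ _] := Hpsi; have [dch _ _] := Hchi.
have dv : is_derive t 1 (fun z : R => z^-1) (- t^-2 *: (1 : R)).
  by apply: is_deriveV => //; rewrite gt_eqF.
have d1 := is_deriveM (@is_derive_cst _ _ _ x t (1:R)) dv.
have d2 := is_derive1_comp (dps _ : is_derive ((cst x * (fun z : R => z^-1)) t) (1:R) psi _) d1.
have d3 := is_deriveM (dch t) d2.
refine (is_derive_eq d3 _).
by rewrite /GRing.scale /= /cst /=; field; rewrite gt_eqF.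
Qed.

Lemma phis_dt0 (t x : R) : t < t0 -> is_derive t (1 : R) (phis^~ x) 0.
Proof.
move=> tt; have h := @is_derive_cst R R^o R^o (0 : R) t (1 : R).
apply: (near_eq_is_derive _ h); near=> s; rewrite phis0 //; apply: ltW; near: s.
exact: lt_nbhsl.
Unshelve. all: by end_near. Qed.

Lemma phis_dtE (t x : R) : 0 < t -> dt phis t x = dchi t * psi (x / t) - chi t * dpsi (x / t) * x / t ^+ 2.
Proof. by move=> h; apply: derive1_is; exact: phis_dt. Qed.

Lemma phis_dxE t x : dx phis t x = chi t * dpsi (x / t) / t.
Proof. by apply: derive1_is; exact: phis_dx. Qed.

(** The quotient x / t is singular at t = 0 only, where chi vanishes. *)
Lemma phis_test : test_function phis.
Proof.
have [dps cdps ps0] := Hpsi; have [dch cdch ch0] := Hchi.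
have cps := ex_derive_cont dps; have cch := ex_derive_cont dch.
have nearlow (z : R * R) : z.1 < t0 -> \forall w \near z, w.1 < t0.
  move=> hz; have h : fst w @[w --> z] --> z.1 by exact: cvg_fst.
  exact: (cvgr_lt _ h).
have cdiv (z : R * R) : 0 < z.1 -> {for z, continuous (fun w : R * R => w.2 / w.1)}.
  move=> hz; apply: cvgM; first exact: cvg_snd.
  by apply: cvgV; [rewrite gt_eqF|exact: cvg_fst].
split.
- move=> t x; split; last by have [] := phis_dx t x.
  have [tt|tt] := ltP t t0; first by have [] := phis_dt0 x tt.
  by have [] := phis_dt x (lt_le_trans t00 tt).
- move=> z; have [zt|zt] := ltP z.1 t0.
    rewrite /continuous_at /dt (derive1_is (phis_dt0 z.2 zt)).
    apply: cvg_near_cst; near=> w; rewrite (derive1_is (phis_dt0 w.2 _)) //.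
    by near: w; exact: nearlow.
  have z0 := lt_le_trans t00 zt.
  have hc : {for z, continuous (fun w : R * R => dchi w.1 * psi (w.2 / w.1) - chi w.1 * dpsi (w.2 / w.1) * w.2 / w.1 ^+ 2)}.
    apply: cvgB.
      apply: cvgM; first by apply: (@continuous_comp _ _ _ fst dchi z); [exact: cvg_fst|exact: cdch].
      by apply: (@continuous_comp _ _ _ (fun w : R * R => w.2 / w.1) psi z); [exact: cdiv|exact: cps].
    apply: cvgM.
      apply: cvgM; last exact: cvg_snd.
      apply: cvgM; first by apply: (@continuous_comp _ _ _ fst chi z); [exact: cvg_fst|exact: cch].
      by apply: (@continuous_comp _ _ _ (fun w : R * R => w.2 / w.1) dpsi z); [exact: cdiv|exact: cdps].
    apply: cvgV; first by rewrite gt_eqF // exprn_gt0.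
    by apply: cvgM; exact: cvg_fst.
  rewrite /continuous_at phis_dtE //.
  apply: cvg_trans hc; apply: near_eq_cvg; near=> w; rewrite phis_dtE //.
  near: w; have h : fst w @[w --> z] --> z.1 by exact: cvg_fst.
  exact: (cvgr_gt _ h).
- move=> z; rewrite /continuous_at phis_dxE.
  have [zt|zt] := ltP z.1 t0.
    rewrite (ch0 z.1 (or_introl (ltW zt))).1 !mul0r.
    apply: cvg_near_cst; near=> w; rewrite phis_dxE (ch0 w.1 (or_introl _)).1 ?mul0r //.
    by apply: ltW; near: w; exact: nearlow.
  have z0 := lt_le_trans t00 zt.
  suff hc : {for z, continuous (fun w : R * R => chi w.1 * dpsi (w.2 / w.1) / w.1)}.
    by apply: cvg_trans hc; apply: near_eq_cvg; near=> w; rewrite phis_dxE.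
  apply: cvgM; last by apply: cvgV; [rewrite gt_eqF|exact: cvg_fst].
  apply: cvgM; first by apply: (@continuous_comp _ _ _ fst chi z); [exact: cvg_fst|exact: cch].
  by apply: (@continuous_comp _ _ _ (fun w : R * R => w.2 / w.1) dpsi z); [exact: cdiv|exact: cdps].
- exists (`[t0, t1]%classic `*` `[- (t1 * A), t1 * A]%classic).
    by apply: compact_setX; exact: segment_compact.
  move=> t x /= nK; rewrite /phis.
  have [h|h] := leP t t0; first by rewrite (ch0 t (or_introl h)).1 mul0r.
  have [h1|h1] := leP t1 t; first by rewrite (ch0 t (or_intror h1)).1 mul0r.
  have tp : 0 < t by exact: lt_trans h.
  suff hx : x / t <= - A \/ A <= x / t by rewrite (ps0 _ hx).1 mulr0.
  have [h2|h2] := leP (x / t) (- A); first by left.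
  have [h3|h3] := leP A (x / t); first by right.
  exfalso; apply: nK; rewrite !in_itv /=.
  have tA : t * A <= t1 * A by apply: ler_wpM2r => //; exact: ltW.
  move: h2 h3; rewrite ltr_pdivlMr // ltr_pdivrMr // => h2 h3.
  by do ?split => //; apply/andP; split; lra.
Unshelve. all: by end_near. Qed.

Lemma integrable_supp (k : R -> R) a b : locbm k -> (forall x, ~ a <= x <= b -> k x = 0) ->
  mu.-integrable setT (EFin \o k).
Proof.
move=> lk k0.
have -> : k = k \_ [set` `[a, b]].
  apply/funext => x; rewrite patchE; case: ifPn => // xab; apply: k0 => h.
  by move: xab; rewrite mem_setE in_itv /= h.
rewrite -restrict_EFin; apply/integrable_restrict => //.
by rewrite setTI; exact: locbm_int.
Qed.

(** The substitution x = t xi separates the variables, and the two integrals in time are opposite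
to each other by an integration by parts. *)
Lemma weak_self_similar (e f : R * R -> R) (U0 : R -> R * R) (W : R -> R * R) :
  locbm (e \o W) -> locbm (f \o W) ->
  weak_balance e f U0 (self_similar W) phis =
  Iab t0 t1 chi * (Iab (- A) A (fun x => (f (W x) - x * e (W x)) * dpsi x)
                   - Iab (- A) A (fun x => e (W x) * psi x)).
Proof.
move=> le lf.
have [dps cdps ps0] := Hpsi; have [dch cdch ch0] := Hchi.
have lps := locbm_cont (ex_derive_cont dps); have lch := locbm_cont (ex_derive_cont dch).
have ldps := locbm_cont cdps; have ldch := locbm_cont cdch.
set I2 := Iab _ _ (fun x => _ * dpsi x); set I1 := Iab _ _ (fun x => _ * psi x).
rewrite /weak_balance.
have -> : \int[mu]_x (e (U0 x) * phis 0 x) = 0.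
  under eq_Rintegral do rewrite phis0 ?mulr0 ?ltW //.
  by rewrite Rintegral_cst // mul0r.
rewrite addr0.
have psi0 x : ~ - A <= x <= A -> psi x = 0 /\ dpsi x = 0.
  move=> h; apply: ps0; have [h1|h1] := leP x (- A); first by left.
  by right; rewrite leNgt; apply/negP => h2; apply: h; rewrite !ltW.
have lk1 : locbm (fun x => e (W x) * psi x) by exact: (locbmM le).
have lk2 : locbm (fun x => (f (W x) - x * e (W x)) * dpsi x).
  by apply: locbmM => //; exact: (locbmB lf (locbmM locbm_id le)).
have inner t : 0 < t ->
  \int[mu]_x (e (self_similar W t x) * dt phis t x + f (self_similar W t x) * dx phis t x)
  = t * dchi t * I1 + chi t * I2.
  move=> tp; have tn0 : t != 0 by rewrite gt_eqF.
  pose k x := dchi t * (e (W x) * psi x) + chi t / t * ((f (W x) - x * e (W x)) * dpsi x).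
  have lk : locbm k by apply: locbmD; apply: locbmM => //; exact: locbm_cst.
  have kE x : e (self_similar W t x) * dt phis t x + f (self_similar W t x) * dx phis t x = k (x / t).
    by rewrite phis_dtE // phis_dxE /self_similar /k; field.
  under eq_Rintegral do rewrite kE.
  have k0 x : ~ - A <= x <= A -> k x = 0.
    by move=> h; have [p d] := psi0 x h; rewrite /k p d !mulr0 addr0.
  rewrite (@integral_scale R t tn0 (fun x => k (x / t))); last 2 first.
  - rewrite (_ : (fun x => _) = (fun x => k (t^-1 * x))); last by apply/funext => x; rewrite mulrC.
    by apply: measurableT_comp; [case: lk|exact: measurable_scale].
  - rewrite (_ : (fun x => k (t * x / t)) = k); first exact: integrable_supp lk k0.
    by apply/funext => x; rewrite mulrAC mulfV // mul1r.
  under eq_Rintegral do rewrite mulrAC mulfV // mul1r.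
  rewrite gtr0_norm // (@Rint_supp k setT (- A) A) //; last by move=> x _ /k0.
  rewrite /k IabD; [|exact: locbmM (locbm_cst _) lk1|exact: locbmM (locbm_cst _) lk2].
  by rewrite !IabZ // -/I1 -/I2; field.
transitivity (\int[mu]_(t in `]0, +oo[) (t * dchi t * I1 + chi t * I2)).
  by apply: eq_Rintegral => t; rewrite inE /= in_itv /= andbT => /inner.
rewrite (@Rint_supp _ _ t0 t1) //; last 2 first.
- by move=> t /=; rewrite !in_itv /= andbT => /andP[h _]; exact: lt_le_trans h.
- move=> t _ h; have [-> ->] : chi t = 0 /\ dchi t = 0.
    apply: ch0; have [h1|h1] := leP t t0; first by left.
    by right; rewrite leNgt; apply/negP => h2; apply: h; rewrite !ltW.
  by rewrite mulr0 !mul0r addr0.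
have ltd : locbm (fun t => t * dchi t) by exact: locbmM locbm_id ldch.
have -> : (fun t => t * dchi t * I1 + chi t * I2) = (fun t => I1 * (t * dchi t) + I2 * chi t).
  by apply/funext => t; ring.
rewrite IabD; [|exact: locbmM (locbm_cst _) ltd|exact: locbmM (locbm_cst _) lch].
rewrite !IabZ //.
suff : Iab t0 t1 (fun t => t * dchi t) + Iab t0 t1 chi = 0.
  move=> h; have -> : Iab t0 t1 (fun t => t * dchi t) = - Iab t0 t1 chi by apply/eqP; rewrite -addr_eq0 h.
  ring.
rewrite -IabD //.
have cF : continuous (fun t : R => t * dchi t + chi t).
  move=> t; apply: cvgD; last exact: (ex_derive_cont dch).
  by apply: cvgM; [exact: cvg_id|exact: cdch].
have dF (t : R) : is_derive t (1 : R) (fun t : R => t * chi t) (t * dchi t + chi t).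
  refine (is_derive_eq (is_deriveM (@is_derive_id _ _ t (1:R)) (dch t)) _).
  by rewrite /GRing.scale /=; ring.
rewrite (FTC t01 cF dF) (ch0 t1 (or_intror (lexx _))).1 (ch0 t0 (or_introl (lexx _))).1.
by rewrite !mulr0 subrr.
Qed.

End SelfSimilar.
End TestFunctions.

(** * Pointwise form of self-similar balance laws *)

Section Pointwise.
Context {R : realType}.
Local Notation state := (R * R)%type.
Variables (th ka : R -> R) (K : R).
Hypothesis St : is_step th ka K.
Local Notation hump := (hump th).
Local Notation dhump := (dhump ka).

Lemma hump_C1 (a b h : R) : 0 < h -> a <= b -> C1supp (hump a b h) (dhump a b h) a (b + h).
Proof.
move=> h0 ab; split; [exact: (hump_der St)|exact: (@dhump_cont _ _ _ _ St)|].
by move=> x hx; exact: (hump_out St h0 ab hx).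
Qed.

Lemma C1supp_widen (f df : R -> R) a b a' b' : a' <= a -> b <= b' -> C1supp f df a b -> C1supp f df a' b'.
Proof. by move=> aa bb [h1 h2 h3]; split => // x [hx|hx]; apply: h3; [left|right]; lra. Qed.

Lemma Iab_widen (f : R -> R) a b a' b' : a' <= a -> a <= b -> b <= b' -> locbm f ->
  (forall x, x <= a \/ b <= x -> f x = 0) -> Iab a' b' f = Iab a b f.
Proof.
move=> aa ab bb lf h.
rewrite (@Iab_split _ f a' a b'); [|by []|by []|lra].
rewrite (@Iab_split _ f a b b') //.
rewrite (@Iab0 _ f a' a) //; last by move=> x /andP[_ hx]; apply: h; left.
rewrite (@Iab0 _ f b b') //; last by move=> x /andP[hx _]; apply: h; right.
by rewrite add0r addr0.
Qed.

Lemma hump_mass (a b : R) : a + 1 < b -> 0 < Iab a (b + 1) (hump a b 1).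
Proof.
move=> ab; have lb := locbm_cont (@hump_cont _ _ _ _ St a b 1).
rewrite (@Iab_split _ _ a (a + 1) (b + 1) lb); [|lra|lra].
rewrite (@Iab_split _ _ (a + 1) b (b + 1) lb); [|lra|lra].
have nn (x : R) : 0 <= hump a b 1 x.
  by have /andP[] := @hump01 _ _ _ _ St a b 1 x ltac:(lra) ltac:(lra).
have h (y z : R) : 0 <= Iab y z (hump a b 1) by apply: Rintegral_ge0 => x _; exact: nn.
have -> : Iab (a + 1) b (hump a b 1) = Iab (a + 1) b (fun=> 1 : R).
  apply: (Iab_ae (@conullT R)) => //; first exact: locbm_cst.
  by move=> x _ xx; apply: (hump_in St); lra.
rewrite Iab_cst; last lra.
by have := h a (a + 1); have := h b (b + 1); lra.
Qed.

Section Balance.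
Variables (e f : state -> R) (U0 : R -> state) (W : R -> state).
Hypothesis le : locbm (e \o W).
Hypothesis lf : locbm (f \o W).

(** The flux of e across the ray of slope x, in the frame of that ray. *)
Definition gflux (x : R) := f (W x) - x * e (W x).

Lemma gflux_loc : locbm gflux.
Proof. exact: (locbmB lf (locbmM locbm_id le)). Qed.

Lemma weak_hump (a b h : R) : 0 < h -> a <= b -> exists phi : R -> R -> R,
  [/\ test_function phi, forall t x, 0 <= phi t x &
   exists2 k : R, 0 < k & weak_balance e f U0 (self_similar W) phi =
    k * (Iab a (b + h) (fun x => gflux x * dhump a b h x) - Iab a (b + h) (fun x => e (W x) * hump a b h x))].
Proof.
move=> h0 ab.
pose A := `|a| + `|b + h|.
have A0 : 0 <= A by rewrite addr_ge0.
have aA : - A <= a by have := ler_norm (- a); rewrite normrN /A; have := normr_ge0 (b + h); lra.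
have bA : b + h <= A by have := ler_norm (b + h); rewrite /A; have := normr_ge0 a; lra.
have Hpsi := C1supp_widen aA bA (hump_C1 h0 ab).
have Hchi := @hump_C1 1 3 1 ltac:(lra) ltac:(lra).
rewrite (_ : 3 + 1 = 4 :> R) in Hchi; last by ring.
exists (phis (hump 1 3 1) (hump a b h)); split.
- exact: (phis_test ltr01 A0 Hchi Hpsi).
- move=> t x; rewrite /phis mulr_ge0 //.
    by have /andP[] := @hump01 _ _ _ _ St 1 3 1 t ltac:(lra) ltac:(lra).
  by have /andP[] := @hump01 _ _ _ _ St a b h (x / t) h0 ab.
exists (Iab 1 4 (hump 1 3 1)).
  have := @hump_mass 1 3 ltac:(lra); rewrite (_ : 3 + 1 = 4 :> R) //; ring.
have h14 : 1 <= 4 :> R by lra.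
rewrite (weak_self_similar ltr01 h14 Hchi Hpsi) //.
have out := hump_out St h0 ab.
have abh : a <= b + h by lra.
have l1 : locbm (fun x => gflux x * dhump a b h x) by exact: locbmM gflux_loc (locbm_cont (@dhump_cont _ _ _ _ St _ _ _)).
have l2 : locbm (fun x => e (W x) * hump a b h x) by exact: (locbmM le (locbm_cont (@hump_cont _ _ _ _ St _ _ _))).
have -> : Iab a (b + h) (fun x => gflux x * dhump a b h x) = Iab (- A) A (fun x => gflux x * dhump a b h x).
  by apply/esym/Iab_widen => // x /out [_ ->]; rewrite mulr0.
have -> : Iab a (b + h) (fun x => e (W x) * hump a b h x) = Iab (- A) A (fun x => e (W x) * hump a b h x).
  by apply/esym/Iab_widen => // x /out [-> _]; rewrite mulr0.
by [].
Qed.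

Lemma balance_ineq :
  (forall phi, test_function phi -> (forall t x, 0 <= phi t x) ->
     0 <= weak_balance e f U0 (self_similar W) phi) ->
  exists2 G, conull G & forall a b, G a -> G b -> a < b -> Iab a b (e \o W) <= gflux a - gflux b.
Proof.
move=> H; apply: (dist_ineq St gflux_loc le) => a b h h0 ab.
have [phi [tp p0 [k k0 kE]]] := weak_hump h0 ab.
by have := H phi tp p0; rewrite kE pmulr_rge0 // subr_ge0.
Qed.

Lemma balance_eq :
  (forall phi, test_function phi -> weak_balance e f U0 (self_similar W) phi = 0) ->
  exists2 G, conull G & forall a b, G a -> G b -> a < b -> gflux a - gflux b = Iab a b (e \o W).
Proof.
move=> H.
have HE (a b h : R) : 0 < h -> a <= b ->
    Iab a (b + h) (fun x => gflux x * dhump a b h x) = Iab a (b + h) (fun x => e (W x) * hump a b h x).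
  move=> h0 ab; have [phi [tp p0 [k k0 kE]]] := weak_hump h0 ab.
  have := H phi tp; rewrite kE => /eqP; rewrite mulf_eq0 (gt_eqF k0) /= subr_eq0 => /eqP; exact.
have [G1 cG1 H1] : exists2 G, conull G & forall a b, G a -> G b -> a < b -> Iab a b (e \o W) <= gflux a - gflux b.
  by apply: (dist_ineq St gflux_loc le) => a b h h0 ab; rewrite HE.
have [G2 cG2 H2] : exists2 G, conull G & forall a b, G a -> G b -> a < b ->
    Iab a b (fun x => - e (W x)) <= - gflux a - - gflux b.
  apply: (dist_ineq St (locbmN gflux_loc) (locbmN le)) => a b h h0 ab.
  have lb := locbm_cont (@hump_cont _ _ _ _ St a b h).
  have ldb := locbm_cont (@dhump_cont _ _ _ _ St a b h).
  have -> : (fun x => - e (W x) * hump a b h x) = (fun x => (-1) * (e (W x) * hump a b h x)) by apply/funext => x; ring.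
  have -> : (fun x => - gflux x * dhump a b h x) = (fun x => (-1) * (gflux x * dhump a b h x)) by apply/funext => x; ring.
  have l1 : locbm (fun x => e (W x) * hump a b h x) by exact: (locbmM le lb).
  have l2 : locbm (fun x => gflux x * dhump a b h x) by exact: locbmM gflux_loc ldb.
  by rewrite !IabZ // HE.
exists (G1 `&` G2); first exact: conullI.
move=> a b [a1 a2] [b1 b2] ab; apply/le_anti/andP; split; last exact: H1.
have := H2 a b a2 b2 ab.
have -> : Iab a b (fun x => - e (W x)) = - Iab a b (e \o W).
  by rewrite -mulN1r -IabZ //; congr Iab; apply/funext => x; rewrite mulN1r.
lra.
Qed.

End Balance.
End Pointwise.

(** * From entropy solutions to self-similar flows *)

Section Inverse.
Context {R : realType}.

Lemma measurable_inv : measurable_fun setT (fun x : R => x^-1).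
Proof.
have -> : [set: R] = [set x | x != 0] `|` [set 0].
  by apply/seteqP; split => x // _; have [->|h] := eqVneq x 0; [right|left].
have o : open [set x : R | x != 0].
  rewrite (_ : [set x | x != 0] = ~` [set 0]); last by apply/seteqP; split => x /= /eqP.
  by apply: closed_openC; exact: closed_eq.
apply/measurable_funU => //; first exact: open_measurable.
split; last exact: measurable_fun_set1.
apply: open_continuous_measurable_fun => // x; rewrite inE /= => x0.
by apply: cvgV => //; exact: cvg_id.
Qed.

Lemma locbm_inv (f : R -> R) r : locbm f -> 0 < r -> (forall x, r <= f x) -> locbm (fun x => (f x)^-1).
Proof.
move=> [mf _] r0 rf; split; first by apply: measurableT_comp => //; exact: measurable_inv.
move=> A; exists r^-1 => x _; have f0 : 0 < f x by apply: lt_le_trans (rf x).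
by rewrite gtr0_norm ?invr_gt0 // lef_pV2 ?posrE.
Qed.

Lemma locbm_ln (f : R -> R) r M : locbm f -> 0 < r -> (forall x, r <= f x <= M) -> locbm (fun x => ln (f x)).
Proof.
move=> [mf _] r0 rf; split; first by apply: measurableT_comp => //; exact: measurable_ln.
move=> A; exists (`|ln r| + `|ln M|) => x _; have /andP[h1 h2] := rf x.
have f0 : 0 < f x by lra.
have a1 : ln r <= ln (f x) by rewrite ler_ln ?posrE.
have a2 : ln (f x) <= ln M by rewrite ler_ln ?posrE //; lra.
have := ler_norm (- ln r); have := ler_norm (ln M); rewrite normrN.
have := normr_ge0 (ln r); have := normr_ge0 (ln M).
by rewrite ler_norml => ? ? ? ?; apply/andP; split; lra.
Qed.

Lemma quad_derive (F : R -> R) (x k C : R) : 0 <= C ->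
  (forall y, `|y - x| < 1 -> `|F y - F x - k * (y - x)| <= C * (y - x) ^+ 2) -> is_derive x (1 : R) F k.
Proof.
move=> C0 H.
suff : h^-1 *: ((F \o shift x) (h *: (1 : R)) - F x) @[h --> 0^'] --> k.
  move=> cv; split; first by apply/cvg_ex; exists k.
  exact: cvg_lim.
apply/cvgrPdist_le => e e0.
near=> h.
have hn0 : h != 0 by near: h; exact: nbhs_dnbhs_neq.
have h1 : `|h| < 1 by near: h; apply: dnbhs0_lt.
have hd : `|h| < e / (C + 1) by near: h; apply: dnbhs0_lt; rewrite divr_gt0 //; lra.
have h0 : 0 < `|h| by rewrite normr_gt0.
rewrite /= distrC -[X in `|_ - X|](mulKf hn0) /GRing.scale /= mulr1 -mulrBr normrM normfV.
rewrite ler_pdivrMl //.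
have := H (h + x); rewrite addrK => /(_ h1); rewrite (mulrC k) => /le_trans; apply.
rewrite -real_normK ?num_real // expr2 mulrCA; apply: ler_wpM2l; first exact: ltW.
move: hd; rewrite ltr_pdivlMr; last lra.
by move=> hd; rewrite mulrC; have := normr_ge0 h; lra.
Unshelve. all: by end_near. Qed.

End Inverse.

Section FromWeak.
Context {R : realType}.
Local Notation state := (R * R)%type.
Variables (c : R) (c0 : 0 < c) (U0 : R -> state) (W : R -> state).
Hypothesis HW : entropy_solution c U0 (self_similar W).

Lemma W_bounds : exists r M : R, 0 < r /\ forall x, [/\ r <= (W x).1, (W x).1 <= M & `|(W x).2| <= M].
Proof.
have [[_ _ [r [M [r0 h]]]] _ _ _] := HW; exists r, M; split => // x.
by have := h 1 x ltr01; rewrite /self_similar divr1.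
Qed.

Lemma W_meas : measurable_fun setT (fun x => (W x).1) /\ measurable_fun setT (fun x => (W x).2).
Proof.
have [[m1 m2 _] _ _ _] := HW.
have mD : measurable [set z : R * R | 0 < z.1].
  have -> : [set z : R * R | 0 < z.1] = setT `&` fst @^-1` `]0, +oo[.
    by apply/seteqP; split => z /=; rewrite ?in_itv /= ?andbT => // -[].
  exact: measurable_fst.
have mi : measurable_fun setT (fun x : R => ((1 : R), x)).
  by apply: measurable_fun_pair.
have sub : (fun x : R => ((1 : R), x)) @` setT `<=` [set z : R * R | 0 < z.1].
  by move=> z [x _ <-] /=.
split.
- have := measurable_comp mD sub m1 mi.
  by congr measurable_fun; apply/funext => x; rewrite /= /self_similar divr1.
- have := measurable_comp mD sub m2 mi.
  by congr measurable_fun; apply/funext => x; rewrite /= /self_similar divr1.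
Qed.

Lemma W_loc : locbm (fst \o W) /\ locbm (snd \o W).
Proof.
have [r [M [r0 h]]] := W_bounds; have [m1 m2] := W_meas.
split; split => // A; exists M => x _ /=; have [h1 h2 h3] := h x => //.
by rewrite ger0_norm //; lra.
Qed.

Lemma flux_loc : locbm (flux_q c \o W).
Proof.
have [r [M [r0 h]]] := W_bounds; have [l1 l2] := W_loc.
have li : locbm (fun x => ((W x).1)^-1) by apply: (locbm_inv l1 r0) => x; have [] := h x.
exact: (locbmD (locbmM (locbmM l2 l2) li) (locbmM (locbm_cst (c ^+ 2)) l1)).
Qed.

Lemma energy_loc : locbm (energy c \o W).
Proof.
have [r [M [r0 h]]] := W_bounds; have [l1 l2] := W_loc.
have li : locbm (fun x => (2 * (W x).1)^-1).
  apply: (@locbm_inv _ (fun x => 2 * (W x).1) (2 * r)); [exact: (locbmM (locbm_cst 2) l1)|lra|].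
  by move=> x; have [] := h x; lra.
have ll : locbm (fun x => ln (W x).1).
  by apply: (@locbm_ln _ _ r M l1 r0) => x; have [-> ->] := h x.
exact: (locbmD (locbmM (locbmM l2 l2) li) (locbmM (locbmM (locbm_cst (c ^+ 2)) l1) ll)).
Qed.

Lemma energy_flux_loc : locbm (energy_flux c \o W).
Proof.
have [r [M [r0 h]]] := W_bounds; have [l1 l2] := W_loc.
have li : locbm (fun x => ((W x).1)^-1) by apply: (locbm_inv l1 r0) => x; have [] := h x.
exact: (locbmM (locbmM l2 li) (locbmD energy_loc (locbmM (locbm_cst (c ^+ 2)) l1))).
Qed.

(** Mass balance makes m a primitive of - rho. With n the momentum flux across the ray, a primitive
of - q, one has P = n - xi m and P' = - q - m + xi rho = - 2 m: this is continuous although q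
and rho are not, which is why the proof estimates the second order remainder of P directly. *)
Lemma entropy_simil : exists m P G, simil c (fst \o W) m P G /\
  forall x, G x -> (W x).2 = m x + x * (W x).1.
Proof.
have [th [ka [K St]]] := @step_exists R.
have [l1 l2] := W_loc.
have [_ w1 w2 w3] := HW.
have [G1 cG1 H1] := balance_eq St l1 l2 w1.
have [G2 cG2 H2] := balance_eq St l2 flux_loc w2.
have [G3 cG3 H3] := balance_ineq St energy_loc energy_flux_loc w3.
have [r [M [r0 hb]]] := W_bounds.
have M0 : 0 < M by have [? ? _] := hb 0; lra.
pose G := G1 `&` G2 `&` G3.
have cG : conull G by do !apply: conullI.
have [a0 [[[a1 a2] a3] _]] := conull_dense cG (@ltr01 R).
have [F1 HF1] := primitive_exists l1.
have [F2 HF2] := primitive_exists l2.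
pose g1 := gflux fst snd W; pose g2 := gflux snd (flux_q c) W.
pose m x := g1 a0 + F1 a0 - F1 x.
pose n x := g2 a0 + F2 a0 - F2 x.
have mG x : G x -> m x = g1 x.
  move=> [[x1 x2] x3]; rewrite /m.
  have [h|h|->] := ltgtP x a0; last by ring.
    by have := H1 x a0 x1 a1 h; rewrite -(HF1 _ _ (ltW h)) -/(g1 x) -/(g1 a0); lra.
  by have := H1 a0 x a1 x1 h; rewrite -(HF1 _ _ (ltW h)) -/(g1 x) -/(g1 a0); lra.
have nG x : G x -> n x = g2 x.
  move=> [[x1 x2] x3]; rewrite /n.
  have [h|h|->] := ltgtP x a0; last by ring.
    by have := H2 x a0 x2 a2 h; rewrite -(HF2 _ _ (ltW h)) -/(g2 x) -/(g2 a0); lra.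
  by have := H2 a0 x a2 x2 h; rewrite -(HF2 _ _ (ltW h)) -/(g2 x) -/(g2 a0); lra.
have dm a b : a <= b -> m a - m b = Iab a b (fst \o W) by move=> ab; rewrite -HF1 // /m; ring.
have dn a b : a <= b -> n a - n b = Iab a b (snd \o W) by move=> ab; rewrite -HF2 // /n; ring.
have qE x : G x -> (W x).2 = m x + x * (W x).1 by move=> Gx; rewrite mG // /g1 /gflux; ring.
have slope a b : a <= b -> `|m b - m a| <= M * (b - a).
  move=> ab; rewrite distrC dm //; apply: (Iab_bound cG) => // x _ _ /=.
  by have [? ? _] := hb x; rewrite ger0_norm //; lra.
have cm : continuous m.
  move=> x; apply: eps_cont_at => e e0; exists (e / M) => [|y]; first by rewrite divr_gt0.
  rewrite ltr_pdivlMr // => hy.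
  have [yx|xy] := leP y x.
    rewrite distrC; apply: le_trans (slope _ _ yx) _.
    by move: hy; rewrite ler0_norm; lra.
  apply: le_trans (slope _ _ (ltW xy)) _.
  by move: hy; rewrite ger0_norm; lra.
pose P x := n x - x * m x.
have key a b : a <= b -> `|P b - P a + 2 * m a * (b - a)| <= 3 * M * (b - a) ^+ 2.
  move=> ab.
  have lint : locbm (fun s => (m s - m a) + (s - a) * (W s).1).
    apply: locbmD; first exact: (locbmB (locbm_cont cm) (locbm_cst _)).
    by apply: locbmM => //; exact: locbmB locbm_id (locbm_cst _).
  have E : P b - P a + 2 * m a * (b - a) =
      - Iab a b (fun s => (m s - m a) + (s - a) * (W s).1) - (b - a) * (m b - m a).
    have -> : Iab a b (fun s => (m s - m a) + (s - a) * (W s).1) =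
        Iab a b (fun s => (snd \o W) s - (m a + a * (W s).1)).
      apply: (Iab_ae cG) => //.
        by apply: (locbmB l2); apply: locbmD; [exact: locbm_cst|apply: locbmM => //; exact: locbm_cst].
      by move=> s Gs _ /=; rewrite qE //; ring.
    rewrite IabB //; last by apply: locbmD; [exact: locbm_cst|apply: locbmM => //; exact: locbm_cst].
    rewrite (@IabD _ (fun=> m a)); [|exact: locbm_cst|apply: locbmM => //; exact: locbm_cst].
    rewrite Iab_cst // (@IabZ _ a _ a b l1) -dm // -dn // /P; ring.
  rewrite E; apply: le_trans (ler_normB _ _) _.
  rewrite normrN normrM (ger0_norm (ltac:(lra) : 0 <= b - a)).
  have B1 : `|Iab a b (fun s => (m s - m a) + (s - a) * (W s).1)| <= (2 * M * (b - a)) * (b - a).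
    apply: (Iab_bound cG) => // s Gs /andP[h1 h2].
    apply: le_trans (ler_normD _ _) _.
    have s1 := slope a s (ltW h1).
    have s2 : M * (s - a) <= M * (b - a) by rewrite ler_pM2l //; lra.
    have s3 : `|(s - a) * (W s).1| <= M * (b - a).
      have [? ? _] := hb s; rewrite normrM mulrC; apply: ler_pM => //; rewrite ger0_norm; lra.
    lra.
  have B2 : (b - a) * `|m b - m a| <= (b - a) * (M * (b - a)) by apply: ler_wpM2l; [lra|exact: slope].
  by apply: le_trans (lerD B1 B2) _; lra.
have dP x : is_derive x (1 : R) P (- (2 * m x)).
  apply: (@quad_derive _ _ _ _ (5 * M)); first lra.
  move=> y _; have [xy|yx] := leP x y.
    have := key x y xy; rewrite mulNr opprK => /le_trans; apply.
    by have := mulr_ge0 (ltW M0) (sqr_ge0 (y - x)); lra.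
  have := key y x (ltW yx) => h.
  have E : P y - P x - - (2 * m x) * (y - x) =
    - (P x - P y + 2 * m y * (x - y)) - 2 * (x - y) * (m x - m y) by ring.
  rewrite E; apply: le_trans (ler_normB _ _) _; rewrite normrN.
  have B2 : `|2 * (x - y) * (m x - m y)| <= 2 * (x - y) * (M * (x - y)).
    rewrite normrM (ger0_norm (ltac:(lra) : 0 <= 2 * (x - y))).
    by apply: ler_wpM2l; [lra|apply: slope; exact: ltW].
  by apply: le_trans (lerD h B2) _; lra.
exists m, P, G; split => //; split => //.
- by exists r, M; split => // x; have [-> ->] := hb x.
- move=> x Gx; have [h1 h2 _] := hb x.
  have rn : (W x).1 != 0 by rewrite gt_eqF //; lra.
  by rewrite /P nG // mG // /g1 /g2 /gflux /flux_q /=; field.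
- move=> x0 e e0.
  pose S x := c ^+ 2 * m x + x * P x + x ^+ 2 / 2 * m x.
  have cS : continuous S.
    have cP : continuous P := ex_derive_cont dP.
    move=> x; apply: cvgD.
      apply: cvgD; first by apply: cvgM; [exact: cvg_cst|exact: cm].
      by apply: cvgM; [exact: cvg_id|exact: cP].
    apply: cvgM; last exact: cm.
    by apply: cvgM; [apply: cvgM; exact: cvg_id|exact: cvg_cst].
  have [d1 d10 hS] := cont_at_eps (cS x0) (ltac:(lra) : 0 < e / 4).
  have [C C0 hC] := locbm_itv (x0 - 1) (x0 + 1) energy_loc.
  pose d := Num.min d1 (Num.min 1 (e / (4 * (C + 1)))).
  have d0 : 0 < d by rewrite /d !lt_min d10 ltr01 divr_gt0 //; lra.
  exists d => // a b Ga Gb ab; rewrite /d !lt_min => /andP[ad1 /andP[ad2 ad3]] /andP[bd1 /andP[bd2 bd3]].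
  have gE x : G x -> gflux (energy c) (energy_flux c) W x = Eflux c (m x) (W x).1 + S x.
    move=> Gx; have [h1 h2 _] := hb x.
    have rn : (W x).1 != 0 by rewrite gt_eqF //; lra.
    have PE : P x = m x ^+ 2 / (W x).1 + c ^+ 2 * (W x).1.
      by rewrite /P nG // mG // /g1 /g2 /gflux /flux_q /=; field.
    by rewrite /S PE /gflux /energy_flux /energy qE // /Eflux; field.
  have := H3 a b Ga.2 Gb.2 ab; rewrite !gE //.
  have I1 : `|Iab a b (energy c \o W)| <= C * (b - a).
    apply: (Iab_bound cG); [exact: energy_loc|exact: ltW|].
    move=> x _ /andP[h1 h2]; apply: hC.
    by move: ad2 bd2; rewrite !ltr_norml => /andP[? ?] /andP[? ?]; apply/andP; split; lra.
  have ba : b - a <= 2 * (e / (4 * (C + 1))).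
    by move: ad3 bd3; rewrite !ltr_norml => /andP[? ?] /andP[? ?]; lra.
  have I2 : C * (b - a) <= e / 2.
    have -> : e / 2 = (C + 1) * (2 * (e / (4 * (C + 1)))) by field; lra.
    by apply: ler_pM => //; lra.
  have := hS a ad1; have := hS b bd1; move: I1; rewrite !ler_norml /=.
  by move=> /andP[? ?] /andP[? ?] /andP[? ?] ?; lra.
Qed.

End FromWeak.

(** * Recovering the initial data *)

Section InitialData.
Context {R : realType}.
Local Notation mu := (@lebesgue_measure R).
Local Notation state := (R * R)%type.

Lemma locbm_scale (f : R -> R) k : locbm f -> locbm (fun x => f (k * x)).
Proof.
move=> [mf bf]; split; first by apply: measurableT_comp => //; exact: measurable_scale.
move=> A; have [M HM] := bf (`|k| * A); exists M => x xA; apply: HM.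
by rewrite normrM; apply: ler_wpM2l.
Qed.

Section Product.
Variables (a da b db : R -> R) (t0 t1 x0 x1 : R).
Hypothesis Ha : C1supp a da t0 t1.
Hypothesis Hb : C1supp b db x0 x1.

Definition prodt (t x : R) : R := a t * b x.

Lemma prodt_dt (t x : R) : is_derive t (1 : R) (prodt^~ x) (da t * b x).
Proof.
have [d _ _] := Ha.
refine (is_derive_eq (is_deriveM (d t) (@is_derive_cst _ _ _ (b x) t (1:R))) _).
by rewrite /GRing.scale /= /cst; ring.
Qed.

Lemma prodt_dx (t x : R) : is_derive x (1 : R) (prodt t) (a t * db x).
Proof.
have [d _ _] := Hb.
refine (is_derive_eq (is_deriveM (@is_derive_cst _ _ _ (a t) x (1:R)) (d x)) _).
by rewrite /GRing.scale /= /cst; ring.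
Qed.

Lemma prodt_dtE t x : dt prodt t x = da t * b x.
Proof. by apply: derive1_is; exact: prodt_dt. Qed.

Lemma prodt_dxE t x : dx prodt t x = a t * db x.
Proof. by apply: derive1_is; exact: prodt_dx. Qed.

Lemma prodt_test : test_function prodt.
Proof.
have [dA cda a0] := Ha; have [dB cdb b0] := Hb.
have ca := ex_derive_cont dA; have cb := ex_derive_cont dB.
split.
- by move=> t x; split; [have [] := prodt_dt t x|have [] := prodt_dx t x].
- have -> : (fun z : R * R => dt prodt z.1 z.2) = (fun z : R * R => da z.1 * b z.2).
    by apply/funext => z; rewrite prodt_dtE.
  move=> z; apply: cvgM; first by apply: (@continuous_comp _ _ _ fst da z); [exact: cvg_fst|exact: cda].
  by apply: (@continuous_comp _ _ _ snd b z); [exact: cvg_snd|exact: cb].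
- have -> : (fun z : R * R => dx prodt z.1 z.2) = (fun z : R * R => a z.1 * db z.2).
    by apply/funext => z; rewrite prodt_dxE.
  move=> z; apply: cvgM; first by apply: (@continuous_comp _ _ _ fst a z); [exact: cvg_fst|exact: ca].
  by apply: (@continuous_comp _ _ _ snd db z); [exact: cvg_snd|exact: cdb].
- exists (`[t0, t1]%classic `*` `[x0, x1]%classic).
    by apply: compact_setX; exact: segment_compact.
  move=> t x /= nK; rewrite /prodt.
  have [h|h] := leP t t0; first by rewrite (a0 t (or_introl h)).1 mul0r.
  have [h1|h1] := leP t1 t; first by rewrite (a0 t (or_intror h1)).1 mul0r.
  have [h2|h2] := leP x x0; first by rewrite (b0 x (or_introl h2)).1 mulr0.
  have [h3|h3] := leP x1 x; first by rewrite (b0 x (or_intror h3)).1 mulr0.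
  by exfalso; apply: nK; rewrite !in_itv /= !ltW.
Qed.

End Product.

(** The test function is a product a(t) b(x) with a(0) = 1, supported where U is constant, apart from
its part at t < 0. The flux term vanishes because b' has integral 0, and the time term is
- e(Ua) times the integral of b. *)
Lemma initial_state (e f : state -> R) (U0 W : R -> state) (Ua Ul : state) (be ga s : R) (G : set R) :
  locbm (e \o W) -> locbm (f \o W) ->
  (forall phi, test_function phi -> weak_balance e f U0 (self_similar W) phi = 0) ->
  be + 1 < ga -> 0 < s -> conull G ->
  (forall t x, 0 < t <= 2 * s -> be <= x <= ga + 1 -> G (x / t) -> W (x / t) = Ua) ->
  (forall x, be <= x <= ga + 1 -> U0 x = Ul) -> e Ua = e Ul.
Proof.
move=> le lf Hw bg s0 cG HG HU.
have [th [ka [K St]]] := @step_exists R.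
have Ha := hump_C1 St s0 (ltac:(lra) : - (4 * s) <= s).
have Hb := hump_C1 St ltr01 (ltac:(lra) : be <= ga).
set a := hump _ _ _ _ in Ha; set da := dhump _ _ _ _ in Ha.
set b := hump _ _ _ _ in Hb; set db := dhump _ _ _ _ in Hb.
have [dA cda a0] := Ha; have [dB cdb b0] := Hb.
have lb := locbm_cont (ex_derive_cont dB); have ldb := locbm_cont cdb; have lda := locbm_cont cda.
pose B := Iab be (ga + 1) b.
have B0 : 0 < B by exact: (hump_mass St).
have wide : be <= ga + 1 by lra.
have b0' x : ~ be <= x <= ga + 1 -> b x = 0 /\ db x = 0.
  move=> h; apply: b0; have [h1|h1] := leP x be; first by left.
  by right; rewrite leNgt; apply/negP => h2; apply: h; rewrite !ltW.
have db0 : Iab be (ga + 1) db = 0.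
  rewrite (FTC wide cdb dB) (b0 be (or_introl (lexx _))).1.
  by rewrite (b0 (ga + 1) (or_intror (lexx _))).1 subrr.
have aE : a 0 = 1 by apply: (hump_in St) => //; lra.
have as1 : a s = 1 by apply: (hump_in St) => //; lra.
have da0 t : 0 < t -> ~ s <= t <= s + s -> da t = 0.
  move=> tp h; have [h1|h1] := leP (s + s) t; first by have [_ ->] := a0 t (or_intror h1).
  have ts : t <= s by rewrite leNgt; apply/negP => h2; apply: h; rewrite !ltW.
  rewrite /da /dhump (@ramp_hi _ _ _ _ St (- (4 * s)) s t s0 ltac:(lra)).2.
  by rewrite (@ramp_lo _ _ _ _ St s s t s0 ts).2 subrr.
have := Hw _ (prodt_test Ha Hb); rewrite /weak_balance.
have -> : \int[mu]_x (e (U0 x) * prodt a b 0 x) = e Ul * B.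
  rewrite (@Rint_supp _ (fun x => e (U0 x) * prodt a b 0 x) setT be (ga + 1)) //; last first.
    by move=> x _ /b0' [h _]; rewrite /prodt h !mulr0.
  rewrite /B -IabZ //; apply: eq_Rintegral => x; rewrite inE /= in_itv /= => xx.
  by rewrite HU // /prodt aE mul1r.
have inner t : 0 < t ->
  \int[mu]_x (e (self_similar W t x) * dt (prodt a b) t x + f (self_similar W t x) * dx (prodt a b) t x)
  = e Ua * B * da t.
  move=> tp; under eq_Rintegral do rewrite (prodt_dtE b Ha) (prodt_dxE a Hb) /self_similar.
  have [h1|h1] := leP (s + s) t.
    have [at0 dat0] := a0 t (or_intror h1).
    under eq_Rintegral do rewrite at0 dat0 !mul0r !mulr0 addr0.
    by rewrite Rintegral_cst // mul0r dat0 mulr0.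
  rewrite (@Rint_supp _ _ setT be (ga + 1)) //; last first.
    by move=> x _ /b0' [-> ->]; rewrite !mulr0 addr0.
  transitivity (Iab be (ga + 1) (fun x => (e Ua * da t) * b x + (f Ua * a t) * db x)).
    apply: (Iab_ae (conull_scale (invr_neq0 (lt0r_neq0 tp)) cG)).
    - apply: locbmD; apply: locbmM.
      + have := locbm_scale t^-1 le; by congr locbm; apply/funext => x /=; rewrite mulrC.
      + exact: locbmM (locbm_cst _) lb.
      + have := locbm_scale t^-1 lf; by congr locbm; apply/funext => x /=; rewrite mulrC.
      + exact: locbmM (locbm_cst _) ldb.
    - by apply: locbmD; apply: locbmM => //; exact: locbm_cst.
    - move=> x /= Gx xx; rewrite mulrC in Gx.
      by rewrite (HG t x) //; [ring|lra|lra].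
  rewrite IabD; [|exact: locbmM (locbm_cst _) lb|exact: locbmM (locbm_cst _) ldb].
  by rewrite !IabZ // db0 -/B; ring.
have -> : \int[mu]_(t in `]0, +oo[)
   (\int[mu]_x (e (self_similar W t x) * dt (prodt a b) t x + f (self_similar W t x) * dx (prodt a b) t x))
  = - (e Ua * B).
  transitivity (\int[mu]_(t in `]0, +oo[) (e Ua * B * da t)).
    by apply: eq_Rintegral => t; rewrite inE /= in_itv /= andbT => tp; rewrite inner.
  rewrite (@Rint_supp _ (fun t => e Ua * B * da t) _ s (s + s)) //; last 2 first.
  - by move=> t /=; rewrite !in_itv /= andbT => /andP[h _]; exact: lt_le_trans h.
  - by move=> t /=; rewrite in_itv /= andbT => tp /(da0 t tp) ->; rewrite mulr0.
  have ss : s <= s + s by lra.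
  rewrite IabZ // (FTC ss cda dA) as1 (a0 (s + s) (or_intror (lexx _))).1.
  by rewrite sub0r mulrN1.
move=> h; have : (e Ul - e Ua) * B = 0 by rewrite -h; ring.
by move=> /eqP; rewrite mulf_eq0 (gt_eqF B0) orbF subr_eq0 => /eqP ->.
Qed.

End InitialData.

(** * The two waves of an Euler Riemann solution *)

Section Resolve.
Context {R : realType}.

(** The part of a flow to the left of its contact xs, when the outer state has density rL and velocity
uL; x1 is the point of transition to subsonic flow. *)
Record left_wave (c rL uL : R) (rho m : R -> R) (G : set R) (xs x1 : R) : Prop := LeftWave {
  lw_lt : x1 < xs;
  lw_zero : m xs = 0;
  lw_sup : forall x, x <= x1 -> x <= uL - c -> m x = rL * (uL - x);
  lw_fan : forall x, uL - c <= x -> x <= x1 -> m x = c * (rL * gz ((uL - x) / c));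
  lw_sub : forall x, x1 <= x -> x <= xs -> m x = rL * hz ((uL - x1) / c) * (xs - x);
  lw_dens : forall x, G x -> x < xs -> x != x1 -> rho x = dens c rL uL x1 x }.

(** The right wave is described as the left wave of the reflected flow. *)
Record riemann (c rL uL rR uR : R) (rho q m P : R -> R) (G : set R) : Prop := Riemann {
  rm_simil : simil c rho m P G;
  rm_q : forall x, G x -> q x = m x + x * rho x;
  rm_qloc : locbm q;
  rm_left : exists xs x1, left_wave c rL uL rho m G xs x1;
  rm_right : exists xs x1, left_wave c rR (- uR) (fun x => rho (- x)) (fun x => - m (- x))
     [set x | G (- x)] xs x1 }.

Lemma far_state c ra ua (rho m : R -> R) G xs x1 : 0 < c -> left_wave c ra ua rho m G xs x1 ->
  exists L, forall x, G x -> x < L -> rho x = ra /\ m x = ra * (ua - x).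
Proof.
move=> c0 H; exists (Num.min x1 (ua - c)) => x Gx; rewrite lt_min => /andP[h1 h2].
split; last by apply: (lw_sup H); exact: ltW.
rewrite (lw_dens H Gx); last 2 first.
- exact: lt_trans h1 (lw_lt H).
- by rewrite lt_eqF.
by rewrite /dens h1 gz_ge1 ?mulr1 // ler_pdivlMr // mul1r; lra.
Qed.

(** The structure theorem yields some outer states; testing near t = 0, far from the waves, identifies
them with the data. *)
Lemma euler_resolve (c rL qL rR qR : R) W : 0 < c -> 0 < rL -> 0 < rR ->
  euler_riemann_solution c (rL, qL) (rR, qR) W ->
  exists m P G, riemann c rL (qL / rL) rR (qR / rR) (fst \o W) (snd \o W) m P G.
Proof.
move=> c0 rL0 rR0 HW.
have [m [P [G [S qE]]]] := entropy_simil HW.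
have [_ w1 w2 _] := HW.
have [l1 l2] := W_loc HW; have l3 := flux_loc HW.
exists m, P, G; split => //.
- have [xs mxs] := sm_zero S.
  have [ra [ua [x1 [[ra0 x1s] A B C D]]]] := left_explicit c0 S mxs.
  have LW : left_wave c ra ua (fst \o W) m G xs x1 by [].
  have [L HL] := far_state c0 LW.
  pose s := (2 * (`|L| + 1))^-1.
  have s0 : 0 < s by rewrite invr_gt0; have := normr_ge0 L; lra.
  have sE : 2 * s * (`|L| + 1) = 1 by rewrite /s; field; have := normr_ge0 L; lra.
  have far t x : 0 < t <= 2 * s -> - 4 <= x <= - 2 + 1 -> G (x / t) -> W (x / t) = (ra, ra * ua).
    move=> /andP[t0 ts] /andP[_ xx] Gx.
    have xL : x / t < L.
      rewrite ltr_pdivrMr //.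
      have : t * (`|L| + 1) <= 1 by rewrite -[leRHS]sE ler_pM2r //; have := normr_ge0 L; lra.
      have : - L * t <= `|L| * t by rewrite ler_pM2r //; rewrite -normrN; exact: ler_norm.
      lra.
    have [h1 h2] := HL _ Gx xL.
    have := qE _ Gx; rewrite h2 => h3; rewrite /= in h1.
    rewrite (surjective_pairing (W (x / t))) h1 h3 h1; congr pair; ring.
  have ini x : - 4 <= x <= - 2 + 1 -> riemann_data (rL, qL) (rR, qR) x = (rL, qL).
    by move=> /andP[_ h]; rewrite /riemann_data ifT //; lra.
  have e1 := @initial_state _ fst snd _ W (ra, ra * ua) (rL, qL) (-4) (-2) s G l1 l2 w1 ltac:(lra) s0 (sm_G S) far ini.
  have e2 := @initial_state _ snd (flux_q c) _ W (ra, ra * ua) (rL, qL) (-4) (-2) s G l2 l3 w2 ltac:(lra) s0 (sm_G S) far ini.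
  rewrite /= in e1 e2; exists xs, x1.
  by have -> : qL / rL = ua; [rewrite -e1 -e2 mulrC mulKf // gt_eqF|rewrite -e1].
- have S' := simil_opp S.
  have [xs mxs] := sm_zero S'.
  have [ra [ua [x1 [[ra0 x1s] A B C D]]]] := left_explicit c0 S' mxs.
  have LW : left_wave c ra ua (fun x => (W (- x)).1) (fun x => - m (- x)) [set x | G (- x)] xs x1 by [].
  have [L HL] := far_state c0 LW.
  pose s := (2 * (`|L| + 1))^-1.
  have s0 : 0 < s by rewrite invr_gt0; have := normr_ge0 L; lra.
  have sE : 2 * s * (`|L| + 1) = 1 by rewrite /s; field; have := normr_ge0 L; lra.
  have far t x : 0 < t <= 2 * s -> 1 <= x <= 3 + 1 -> G (x / t) -> W (x / t) = (ra, - (ra * ua)).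
    move=> /andP[t0 ts] /andP[xx _] Gx.
    have xL : - (x / t) < L.
      rewrite -mulNr ltr_pdivrMr //.
      have : t * (`|L| + 1) <= 1 by rewrite -[leRHS]sE ler_pM2r //; have := normr_ge0 L; lra.
      have : - L * t <= `|L| * t by rewrite ler_pM2r //; rewrite -normrN; exact: ler_norm.
      lra.
    have [h1 h2] := HL (- (x / t)) (ltac:(by rewrite /= opprK)) xL.
    rewrite !opprK in h1 h2.
    have := qE _ Gx; rewrite /= h1 => h3.
    rewrite (surjective_pairing (W (x / t))) h1 h3; congr pair.
    have -> : m (x / t) = - (ra * (ua + x / t)) by rewrite -h2 opprK.
    ring.
  have ini x : 1 <= x <= 3 + 1 -> riemann_data (rL, qL) (rR, qR) x = (rR, qR).
    by move=> /andP[h _]; rewrite /riemann_data ifF //; apply/negP => ?; lra.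
  have e1 := @initial_state _ fst snd _ W (ra, - (ra * ua)) (rR, qR) 1 3 s G l1 l2 w1 ltac:(lra) s0 (sm_G S) far ini.
  have e2 := @initial_state _ snd (flux_q c) _ W (ra, - (ra * ua)) (rR, qR) 1 3 s G l2 l3 w2 ltac:(lra) s0 (sm_G S) far ini.
  rewrite /= in e1 e2; exists xs, x1.
  have -> : - (qR / rR) = ua; last by rewrite -e1.
  by rewrite -e1 -e2 mulNr opprK mulrC mulKf // gt_eqF.
Qed.

End Resolve.

(** * Comparison of waves with a common outer state *)

Section DensMono.
Context {R : realType}.
Implicit Types z : R.

Lemma gz_gt0 z : 0 < gz z.
Proof. by rewrite /gz; case: ifP => // _; exact: expR_gt0. Qed.

Lemma gz_mono z z' : z <= z' -> gz z <= gz z'.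
Proof.
move=> zz; rewrite /gz; case: (leP 1 z) => h1; case: (leP 1 z') => h2 //; first lra.
  by rewrite -[leRHS]expR0 ler_expR; lra.
by rewrite ler_expR; lra.
Qed.

Lemma gz_le_hz z : gz z <= hz z.
Proof. by rewrite /gz /hz; case: (leP 1 z) => // h; exact: exprn_ege1. Qed.

Lemma hz_mono z z' : z <= z' -> hz z <= hz z'.
Proof.
move=> zz; rewrite /hz; case: (leP 1 z) => h1; case: (leP 1 z') => h2 //; last 1 first.
- by rewrite ler_expR; lra.
- by apply: lerXn2r => //; rewrite nnegrE; lra.
- lra.
- apply: (@le_trans _ _ 1); last exact: exprn_ege1.
  by rewrite -[leRHS]expR0 ler_expR; lra.
Qed.

Lemma hz_gt0 z : 0 < hz z. Proof. exact: lt_le_trans (gz_gt0 z) (gz_le_hz z). Qed.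

Lemma gz_le1 z : gz z <= 1.
Proof. by rewrite /gz; case: (leP 1 z) => // h; rewrite -[leRHS]expR0 ler_expR; lra. Qed.

Lemma zc_mono (c u x y : R) : 0 < c -> x <= y -> (u - y) / c <= (u - x) / c.
Proof. by move=> c0 xy; rewrite ler_pM2r ?invr_gt0 //; lra. Qed.

(** An earlier transition compresses the fluid earlier. *)
Lemma dens_mono (c r u x1 x2 x : R) : 0 < c -> 0 < r -> x1 <= x2 ->
  dens c r u x2 x <= dens c r u x1 x.
Proof.
move=> c0 r0 x12; rewrite /dens; case: (ltP x x2) => h2; case: (ltP x x1) => h1 //; rewrite ?ler_pM2l //.
- by apply: le_trans (gz_le_hz _) _; apply: hz_mono; exact: zc_mono.
- lra.
- by apply: hz_mono; exact: zc_mono.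
Qed.

Lemma dens_ge (c r u x1 x : R) : 0 < c -> 0 < r -> r * gz ((u - x) / c) <= dens c r u x1 x.
Proof.
move=> c0 r0; rewrite /dens; case: (ltP x x1) => h1 //; rewrite ler_pM2l //.
by apply: le_trans (gz_le_hz _) _; apply: hz_mono; exact: zc_mono.
Qed.

Lemma dens_le (c r u x1 x L : R) : 0 < c -> 0 < r -> L <= x1 -> dens c r u x1 x <= r * (1 + hz ((u - L) / c)).
Proof.
move=> c0 r0 Lx; rewrite /dens; case: (ltP x x1) => h1; rewrite ler_pM2l //.
  by have := gz_le1 ((u - x) / c); have := hz_gt0 ((u - L) / c); lra.
by have := hz_mono (zc_mono u c0 Lx); lra.
Qed.

End DensMono.

Section Compare.
Context {R : realType}.

(** The densities are ordered by [dens_mono], so the integral of their distance is a difference of mass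
fluxes; the two flows coincide far to the left. Integrating P' = - 2 m then orders the pressures. *)
Lemma left_core (c rL uL : R) rho1 m1 P1 G1 xs1 x1 rho2 m2 P2 G2 xs2 x2 (a : R) :
  0 < c -> 0 < rL -> simil c rho1 m1 P1 G1 -> simil c rho2 m2 P2 G2 ->
  left_wave c rL uL rho1 m1 G1 xs1 x1 -> left_wave c rL uL rho2 m2 G2 xs2 x2 ->
  a <= xs1 -> a <= xs2 -> x1 <= x2 ->
  [/\ P2 a <= P1 a,
      forall b, b <= a -> 0 <= m2 b - m1 b <= m2 a - m1 a,
      forall b, b <= a -> Iab b a (fun x => `|rho1 x - rho2 x|) <= m2 a - m1 a &
      m1 a = m2 a -> P1 a = P2 a].
Proof.
move=> c0 r0 S1 S2 L1 L2 as1 as2 x12.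
have [l1 [l2 _]] := (sm_loc S1, (sm_loc S2, tt)).
have lm1 := locbm_cont (sm_mcont S1); have lm2 := locbm_cont (sm_mcont S2).
pose G := G1 `&` G2 `&` [set x | x <> x1] `&` [set x | x <> x2].
have cG : conull G by do !apply: conullI; [exact: sm_G S1|exact: sm_G S2|exact: conullD1|exact: conullD1].
have ord x : G x -> x < a -> rho2 x <= rho1 x.
  move=> [[[g1 g2] /eqP n1] /eqP n2] xa.
  rewrite (lw_dens L1) ?(lw_dens L2) //; [|lra|lra].
  exact: dens_mono.
have m12 b d : b <= d -> d <= a -> m2 b - m1 b <= m2 d - m1 d.
  move=> bd da; have := sm_m S1 bd; have := sm_m S2 bd.
  have : Iab b d rho2 <= Iab b d rho1.
    by apply: (Iab_le cG) => // x Gx /andP[_ xd]; apply: ord => //; lra.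
  lra.
pose Bm := Num.min (Num.min x1 (uL - c)) a.
have [B [[[[b1 b2] /eqP n1] /eqP n2] /andP[_ BB]]] := conull_dense cG (ltac:(lra) : Bm - 1 < Bm).
move: BB; rewrite /Bm !lt_min => /andP[/andP[Bx Bu] Ba].
have meq b : b <= B -> m2 b = m1 b.
  by move=> bB; rewrite (lw_sup L1) ?(lw_sup L2) //; lra.
have req : rho1 B = rho2 B.
  rewrite (lw_dens L1) ?(lw_dens L2) //; [|lra|lra].
  by rewrite /dens Bx ifT //; lra.
have Peq : P1 B = P2 B.
  have h : P1 B * rho1 B = P2 B * rho1 B.
    by rewrite (sm_q S1) // {2}req (sm_q S2) // meq // req.
  by apply: (mulIf _ h); rewrite gt_eqF //; exact: (rho_gt0 S1).
have m12' b : b <= a -> 0 <= m2 b - m1 b.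
  move=> ba; have [bB|Bb] := leP b B; first by rewrite meq // subrr.
  by have := m12 B b (ltW Bb) ba; rewrite meq // subrr.
have Pa : P1 a - P2 a = Iab B a (fun x => 2 * m2 x) - Iab B a (fun x => 2 * m1 x).
  by rewrite -(simil_Pint S1 (ltW Ba)) -(simil_Pint S2 (ltW Ba)) Peq; ring.
have l2m1 : locbm (fun x => 2 * m1 x) by exact: locbmM (locbm_cst _) lm1.
have l2m2 : locbm (fun x => 2 * m2 x) by exact: locbmM (locbm_cst _) lm2.
split.
- rewrite -subr_ge0 Pa subr_ge0; apply: (Iab_le (@conullT R)) => // x _ /andP[_ xa].
  by have := m12' x (ltW xa); lra.
- by move=> b ba; rewrite m12' //= m12.
- move=> b ba.
  have -> : Iab b a (fun x => `|rho1 x - rho2 x|) = Iab b a (fun x => rho1 x - rho2 x).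
    apply: (Iab_ae cG); [exact: locbm_norm (locbmB l1 l2)|exact: locbmB|].
    by move=> x Gx /andP[_ xa]; rewrite ger0_norm // subr_ge0; exact: ord.
  rewrite IabB // -(sm_m S1 ba) -(sm_m S2 ba).
  by have := m12' b ba; lra.
- move=> ma; apply/eqP; rewrite -subr_eq0 Pa subr_eq0; apply/eqP.
  apply: (Iab_ae (@conullT R)) => // x _ /andP[_ xa].
  by have := m12' x (ltW xa); have := m12 x a (ltW xa) (lexx _); rewrite ma subrr; lra.
Qed.

Lemma left_cmp (c rL uL : R) rho1 m1 P1 G1 xs1 x1 rho2 m2 P2 G2 xs2 x2 (a : R) :
  0 < c -> 0 < rL -> simil c rho1 m1 P1 G1 -> simil c rho2 m2 P2 G2 ->
  left_wave c rL uL rho1 m1 G1 xs1 x1 -> left_wave c rL uL rho2 m2 G2 xs2 x2 ->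
  a <= xs1 -> a <= xs2 ->
  [/\ m1 a <= m2 a -> P2 a <= P1 a, m2 a <= m1 a -> P1 a <= P2 a,
      forall b, b <= a -> `|m1 b - m2 b| <= `|m1 a - m2 a| &
      forall b, b <= a -> Iab b a (fun x => `|rho1 x - rho2 x|) <= `|m1 a - m2 a|].
Proof.
move=> c0 r0 S1 S2 L1 L2 as1 as2.
have [x12|x21] := leP x1 x2.
  have [h1 h2 h3 h4] := left_core c0 r0 S1 S2 L1 L2 as1 as2 x12.
  have /andP[m0 _] := h2 a (lexx _).
  have E : `|m1 a - m2 a| = m2 a - m1 a by rewrite ler0_norm; lra.
  split => //.
  - by move=> h; rewrite h4 //; lra.
  - by move=> b /h2 /andP[k1 k2]; rewrite E ler0_norm; lra.
  - by move=> b /h3; rewrite E.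
have [h1 h2 h3 h4] := left_core c0 r0 S2 S1 L2 L1 as2 as1 (ltW x21).
have /andP[m0 _] := h2 a (lexx _).
have E : `|m1 a - m2 a| = m1 a - m2 a by rewrite ger0_norm; lra.
split => //.
- by move=> h; rewrite h4 //; lra.
- by move=> b /h2 /andP[k1 k2]; rewrite E ger0_norm; lra.
- move=> b /h3; rewrite E; congr (_ <= _); congr Iab; apply/funext => x; exact: distrC.
Qed.

Lemma right_cmp (c rR uR : R) rho1 m1 P1 G1 xs1 x1 rho2 m2 P2 G2 xs2 x2 (a : R) :
  0 < c -> 0 < rR -> simil c rho1 m1 P1 G1 -> simil c rho2 m2 P2 G2 ->
  left_wave c rR uR (fun x => rho1 (- x)) (fun x => - m1 (- x)) [set x | G1 (- x)] xs1 x1 ->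
  left_wave c rR uR (fun x => rho2 (- x)) (fun x => - m2 (- x)) [set x | G2 (- x)] xs2 x2 ->
  - xs1 <= a -> - xs2 <= a ->
  [/\ m2 a <= m1 a -> P2 a <= P1 a, m1 a <= m2 a -> P1 a <= P2 a,
      forall b, a <= b -> `|m1 b - m2 b| <= `|m1 a - m2 a| &
      forall b, a <= b -> Iab a b (fun x => `|rho1 x - rho2 x|) <= `|m1 a - m2 a|].
Proof.
move=> c0 r0 S1 S2 L1 L2 as1 as2.
have [h1 h2 h3 h4] := @left_cmp _ _ _ _ _ _ _ _ _ _ _ _ _ _ _ (- a) c0 r0 (simil_opp S1) (simil_opp S2) L1 L2 ltac:(lra) ltac:(lra).
rewrite !opprK in h1 h2 h3 h4.
have E (u w : R) : `|- u + w| = `|u - w| by rewrite addrC distrC.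
split.
- by move=> h; apply: h1; lra.
- by move=> h; apply: h2; lra.
- by move=> b ab; have := h3 (- b); rewrite !opprK !E; apply; lra.
- move=> b ab; have := h4 (- b); rewrite E => /(_ ltac:(lra)).
  rewrite (@Iab_opp _ (fun x => `|rho1 x - rho2 x|)) ?opprK //.
  exact: locbm_norm (locbmB (sm_loc S1) (sm_loc S2)).
Qed.

End Compare.

(** * Stability of flows under a small jump of momentum flux *)

Section Stability.
Context {R : realType}.

(** What remains of a self-similar flow after two of them are glued at the particle, with P shifted
on one side so as to be continuous. *)
Record mflow (rho m P : R -> R) : Prop := MFlow {
  mf_loc : locbm rho;
  mf_mloc : locbm m;
  mf_ge0 : forall x, 0 <= rho x;
  mf_m : forall x y, x <= y -> m x - m y = Iab x y rho;
  mf_P : forall x y, x <= y -> P x - P y = Iab x y (fun z => 2 * m z) }.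

Lemma mf_noninc rho m P x y : mflow rho m P -> x <= y -> m y <= m x.
Proof.
move=> F xy; rewrite -subr_ge0 (mf_m F xy); apply: Rintegral_ge0 => z _; exact: (mf_ge0 F).
Qed.

Lemma Iab_bndl (G : set R) (f : R -> R) (x y k : R) : conull G -> locbm f -> x <= y ->
  (forall z, G z -> x < z < y -> k <= f z) -> k * (y - x) <= Iab x y f.
Proof. by move=> cG lf xy h; rewrite -Iab_cst //; apply: (Iab_le cG) => //; exact: locbm_cst. Qed.

Lemma Iab_bndr (G : set R) (f : R -> R) (x y k : R) : conull G -> locbm f -> x <= y ->
  (forall z, G z -> x < z < y -> f z <= k) -> Iab x y f <= k * (y - x).
Proof. by move=> cG lf xy h; rewrite -Iab_cst //; apply: (Iab_le cG) => //; exact: locbm_cst. Qed.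

Lemma Iab_absB rho m P rho' m' P' (x y : R) : mflow rho m P -> mflow rho' m' P' -> x <= y ->
  Iab x y (fun z => `|rho z - rho' z|) <= (m x - m y) + (m' x - m' y).
Proof.
move=> F F' xy; have l := mf_loc F; have l' := mf_loc F'.
rewrite (mf_m F xy) (mf_m F' xy) -IabD //.
apply: (Iab_le (@conullT R)); [exact: locbm_norm (locbmB l l')|exact: locbmD|].
move=> z _ _; apply: le_trans (ler_normB _ _) _.
by rewrite !ger0_norm //; [exact: (mf_ge0 F')|exact: (mf_ge0 F)].
Qed.

(** The distance of rho and rho' exceeds rho - rho' by at most 2 eta, and rho - rho' integrates to a
difference of mass fluxes. *)
Lemma Iab_oneside (G : set R) rho m P rho' m' P' (x y eta : R) : conull G ->
  mflow rho m P -> mflow rho' m' P' -> x <= y -> 0 <= eta ->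
  (forall z, G z -> x < z < y -> rho' z - eta <= rho z) ->
  Iab x y (fun z => `|rho z - rho' z|) <= (m x - m y) - (m' x - m' y) + 2 * eta * (y - x).
Proof.
move=> cG F F' xy e0 h; have l := mf_loc F; have l' := mf_loc F'.
rewrite (mf_m F xy) (mf_m F' xy) -IabB // -(@Iab_cst _ (2 * eta)) //.
rewrite -IabD; [|exact: locbmB|exact: locbm_cst].
apply: (Iab_le cG); [exact: locbm_norm (locbmB l l')|exact: locbmD (locbmB l l') (locbm_cst _)|].
by move=> z Gz zz; have := h z Gz zz; have [h1|h1] := leP 0 (rho z - rho' z);
  [rewrite ger0_norm|rewrite ltr0_norm]; lra.
Qed.

(** Here b and b' are the contacts and B0 lies to the left of all waves. Up to the first contact the
densities are ordered up to eta, so their L^1 distance is a difference of mass fluxes; beyond the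
second one it is the difference of the mass fluxes there, by comparison of the right waves. There
remains to show that the contacts are at distance at most kap. If the denser
flow has its contact farther to the right, its mass flux at the first contact is at most eta A0.
In the opposite case the pressures decide: P' has a quadratic minimum at b', while the two
comparisons squeeze it between bounds that differ by 2 eta A0^2 + de. *)
Lemma flow_stability (G : set R) rho m P rho' m' P' (b b' B0 eta de kap r' M' M M1 r0 : R) :
  conull G -> mflow rho m P -> mflow rho' m' P' ->
  B0 <= b -> B0 <= b' -> m b = 0 -> m' b' = 0 -> m B0 = m' B0 -> P B0 = P' B0 ->
  0 < r' -> (forall x, r' <= rho' x <= M') ->
  (forall x, G x -> B0 < x < Num.min b b' -> rho' x - eta <= rho x) \/
  (forall x, G x -> B0 < x < Num.min b b' -> rho x - eta <= rho' x) ->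
  (forall a, b <= a -> b' <= a -> [/\ m' a <= m a -> P' a <= P a - de,
     m a <= m' a -> P a - de <= P' a &
     forall d, a <= d -> Iab a d (fun x => `|rho x - rho' x|) <= `|m a - m' a|]) ->
  (forall x, G x -> B0 < x < b -> rho x <= M) ->
  (forall x, G x -> b < x < b' -> rho x <= M1) ->
  (forall x, G x -> B0 < x < b -> x < b' + 1 -> r0 <= rho x) ->
  0 <= eta -> 0 <= de -> 0 <= kap -> 0 <= M -> 0 <= M1 ->
  2 * eta * (b' - B0) ^+ 2 + de <= r' * kap ^+ 2 ->
  eta * (b' - B0) <= r' * kap -> eta * (b' - B0) <= r0 * kap -> eta * (b' - B0) < r0 ->
  forall d, b <= d -> b' <= d ->
  Iab B0 d (fun x => `|rho x - rho' x|) <= 3 * eta * (b' - B0) + 3 * (M + M' + M1) * kap.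
Proof.
move=> cG F F' Bb Bb' mb mb' mB PB r'0 rM' H2 H3 HM HM1 Hr0 eta0 de0 kap0 M0 M10 K1 K2 K3 K4 d bd bd'.
set A0 := b' - B0 in K1 K2 K3 K4 *.
have A00 : 0 <= A0 by rewrite subr_ge0.
have subA x : x <= b' -> x - B0 <= A0 by rewrite lerD2r.
have M'0 : 0 < M' by have /andP[+ +] := rM' 0; move: r'0; clear; lra.
have l := mf_loc F; have l' := mf_loc F'.
have ln : locbm (fun x => `|rho x - rho' x|) by exact: locbm_norm (locbmB l l').
have lm := mf_mloc F; have lm' := mf_mloc F'.
have l2m : locbm (fun x => 2 * m x) by exact: locbmM (locbm_cst _) lm.
have l2m' : locbm (fun x => 2 * m' x) by exact: locbmM (locbm_cst _) lm'.
have slope' x y : x <= y -> r' * (y - x) <= m' x - m' y <= M' * (y - x).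
  move=> xy; rewrite (mf_m F' xy); apply/andP; split.
    by apply: (Iab_bndl cG) => // z _ _; have /andP[] := rM' z.
  by apply: (Iab_bndr cG) => // z _ _; have /andP[] := rM' z.
have eA : 0 <= eta * A0 by exact: mulr_ge0.
(* P' is at its minimum at b', where its derivative - 2 m' vanishes *)
have quadl x : x <= b' -> r' * (b' - x) ^+ 2 <= P' x - P' b'.
  move=> xb; rewrite (mf_P F' xb).
  pose f z := 2 * (r' * (b' - z)).
  have cf : continuous f.
    move=> z; apply: cvgM; first exact: cvg_cst.
    by apply: cvgM; [exact: cvg_cst|apply: cvgB; [exact: cvg_cst|exact: cvg_id]].
  have df z : is_derive z (1 : R) (fun y => - (r' * (b' - y) ^+ 2)) (f z).
    have d1 := is_deriveB (@is_derive_cst _ _ _ b' z (1:R)) (@is_derive_id _ _ z (1:R)).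
    have d2 := is_deriveN (is_deriveM (@is_derive_cst _ _ _ r' z (1:R)) (is_deriveX 2 d1)).
    refine (is_derive_eq d2 _); rewrite /GRing.scale /= /cst /f /=.
    have -> : (cst b' - id) z = b' - z by []. ring.
  have E : r' * (b' - x) ^+ 2 = Iab x b' f by rewrite (FTC xb cf df); ring.
  rewrite E; apply: (Iab_le cG) => //; first exact: locbm_cont cf.
  by move=> z _ /andP[_ zb]; have /andP[] := slope' z b' (ltW zb); rewrite mb' /f; clear; lra.
have quadr x : b' <= x -> r' * (x - b') ^+ 2 <= P' x - P' b'.
  move=> xb; rewrite -[leRHS]opprB (mf_P F' xb).
  pose f z := - (2 * (r' * (z - b'))).
  have cf : continuous f.
    move=> z; apply: cvgN; apply: cvgM; first exact: cvg_cst.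
    by apply: cvgM; [exact: cvg_cst|apply: cvgB; [exact: cvg_id|exact: cvg_cst]].
  have df z : is_derive z (1 : R) (fun y => - (r' * (y - b') ^+ 2)) (f z).
    have d1 := is_deriveB (@is_derive_id _ _ z (1:R)) (@is_derive_cst _ _ _ b' z (1:R)).
    have d2 := is_deriveN (is_deriveM (@is_derive_cst _ _ _ r' z (1:R)) (is_deriveX 2 d1)).
    refine (is_derive_eq d2 _); rewrite /GRing.scale /= /cst /f /=.
    have -> : (id - cst b') z = z - b' by []. ring.
  have E : r' * (x - b') ^+ 2 = - Iab b' x f by rewrite (FTC xb cf df); ring.
  rewrite E lerN2; apply: (Iab_le cG) => //; first exact: locbm_cont cf.
  by move=> z _ /andP[zb _]; have /andP[] := slope' b' z (ltW zb); rewrite mb' /f; clear; lra.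
have sqle (s : R) : 0 <= s -> r' * s ^+ 2 <= r' * kap ^+ 2 -> s <= kap.
  by move=> s0; rewrite ler_pM2l // ler_pXn2r // nnegrE.
have mlo x : (forall z, G z -> B0 < z < x -> rho' z - eta <= rho z) -> B0 <= x -> x <= b' -> m x <= m' x + eta * A0.
  move=> h Bx xb.
  have : Iab B0 x (fun z => rho' z - eta) <= Iab B0 x rho.
    by apply: (Iab_le cG) => //; exact: locbmB l' (locbm_cst _).
  rewrite IabB //; last exact: locbm_cst.
  rewrite Iab_cst // -(mf_m F Bx) -(mf_m F' Bx) mB.
  by have := ler_wpM2l eta0 (subA x xb); clear; lra.
have mup x : (forall z, G z -> B0 < z < x -> rho z - eta <= rho' z) -> B0 <= x -> x <= b' -> m' x <= m x + eta * A0.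
  move=> h Bx xb.
  have : Iab B0 x (fun z => rho z - eta) <= Iab B0 x rho'.
    by apply: (Iab_le cG) => //; exact: locbmB l (locbm_cst _).
  rewrite IabB //; last exact: locbm_cst.
  rewrite Iab_cst // -(mf_m F Bx) -(mf_m F' Bx) mB.
  by have := ler_wpM2l eta0 (subA x xb); clear; lra.
have Pcmp x (f g : R -> R) : B0 <= x -> x <= b' -> locbm f -> locbm g ->
   (forall z, B0 < z < x -> f z <= g z + eta * A0) ->
   Iab B0 x (fun z => 2 * f z) <= Iab B0 x (fun z => 2 * g z) + 2 * eta * A0 ^+ 2.
  move=> Bx xb lf lg h.
  have l2g : locbm (fun z => 2 * g z) by exact: locbmM (locbm_cst _) lg.
  have : Iab B0 x (fun z => 2 * f z) <= Iab B0 x (fun z => 2 * g z + 2 * (eta * A0)).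
    apply: (Iab_le (@conullT R)) => //; first exact: locbmM (locbm_cst _) lf.
      exact: locbmD l2g (locbm_cst _).
    by move=> z _ zz; have := h z zz; clear; lra.
  rewrite IabD //; last exact: locbm_cst.
  rewrite Iab_cst //.
  by have := ler_wpM2l eA (subA x xb); clear; lra.
have MMk (k s : R) : 0 <= k -> s <= kap -> k * s <= k * kap by move=> k0 sk; exact: ler_wpM2l.
have kM : 0 <= M * kap by exact: mulr_ge0.
have kM' : 0 <= M' * kap by apply: mulr_ge0 => //; exact: ltW.
have kM1 : 0 <= M1 * kap by exact: mulr_ge0.
case: H2 => H2.
- have [bb|bb] := leP b b'.
  + have H2' x : G x -> B0 < x < b -> rho' x - eta <= rho x.
      by move=> Gx /andP[h1 h2]; apply: H2 => //; rewrite h1 lt_min h2; move: h2 bb; clear; lra.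
    have Pb : P' b <= P b + 2 * eta * A0 ^+ 2.
      have := mf_P F Bb; have := mf_P F' Bb; rewrite PB.
      have := @Pcmp b m m' Bb bb lm lm'.
      have h z : B0 < z < b -> m z <= m' z + eta * A0.
        move=> /andP[h1 h2]; apply: mlo; [|exact: ltW|exact: le_trans (ltW h2) bb].
        by move=> w Gw /andP[w1 w2]; apply: H2' => //; rewrite w1 (lt_trans w2).
      by move=> /(_ h); clear; lra.
    have m0 : m b' <= 0 by rewrite -mb; exact: (mf_noninc F).
    have Pbb : P b <= P b'.
      rewrite -subr_le0 (mf_P F bb).
      have -> : 0 = 0 * (b' - b) by rewrite mul0r.
      apply: (Iab_bndr (@conullT R)) => // z _ /andP[z1 _].
      by have := mf_noninc F (ltW z1); rewrite mb; clear; lra.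
    have [_ Pd I3] := H3 b' bb (lexx _).
    have P1 := Pd ltac:(by rewrite mb').
    have bk : b' - b <= kap.
      apply: sqle; first by rewrite subr_ge0.
      by apply: le_trans (quadl b bb) _; move: Pb Pbb P1 K1; clear; lra.
    have I1 := Iab_oneside cG F F' Bb eta0 H2'.
    have I2 := Iab_absB F F' bb.
    have I4 := I3 d bd'.
    have /andP[_ s1] := slope' b b' bb; rewrite mb' in s1.
    have s2 : - m b' <= M1 * (b' - b).
      by have := Iab_bndr cG l bb HM1; rewrite -(mf_m F bb) mb; clear; lra.
    rewrite (Iab_split ln Bb bd) (Iab_split ln bb bd').
    move: I4; rewrite mb' subr0 ler0_norm // => I4.
    have q1 := MMk M' _ (ltW M'0) bk; have q2 := MMk M1 _ M10 bk.
    have q3 := ler_wpM2l eta0 (subA b bb).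
    rewrite mb in I1 I2; rewrite mb' in I2.
    by move: mB I1 I2 I4 s1 s2 q1 q2 q3 kM kM' kM1 eA; clear; lra.
  + have H2' x : G x -> B0 < x < b' -> rho' x - eta <= rho x.
      by move=> Gx /andP[h1 h2]; apply: H2 => //; rewrite h1 lt_min h2; move: h2 bb; clear; lra.
    have mb'le : m b' <= eta * A0 by have := mlo b' H2' Bb' (lexx _); rewrite mb' add0r.
    have low y : b' <= y -> y <= b -> y <= b' + 1 -> r0 * (y - b') <= m b' - m y.
      move=> y1 y2 y3; rewrite (mf_m F y1); apply: (Iab_bndl cG) => // z Gz /andP[z1 z2].
      apply: Hr0 => //; first by rewrite (le_lt_trans Bb' z1) (lt_le_trans z2).
      exact: lt_le_trans y3.
    have b1 : b <= b' + 1.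
      rewrite leNgt; apply/negP => h.
      have := low (b' + 1) ltac:(clear; lra) (ltW h) (lexx _).
      by have := mf_noninc F (ltW h); rewrite mb; move: mb'le K4; clear; lra.
    have bk : b - b' <= kap.
      have := low b (ltW bb) (lexx _) b1; rewrite mb => h.
      have r00 : 0 < r0 by exact: le_lt_trans K4.
      by rewrite -(ler_pM2l r00); move: h mb'le K3; clear; lra.
    have I1 := Iab_oneside cG F F' Bb' eta0 H2'.
    have I2 := Iab_absB F F' (ltW bb).
    have [_ _ I3] := H3 b (lexx _) (ltW bb).
    have I4 := I3 d bd.
    have /andP[_ s1] := slope' b' b (ltW bb); rewrite mb' in s1.
    have s0 : m' b <= 0 by rewrite -mb'; exact: (mf_noninc F' (ltW bb)).
    have s3 : 0 <= m b' by rewrite -mb; exact: (mf_noninc F (ltW bb)).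
    rewrite (Iab_split ln Bb' bd') (Iab_split ln (ltW bb) bd).
    move: I4; rewrite mb sub0r normrN ler0_norm // => I4.
    have q1 := MMk M' _ (ltW M'0) bk.
    rewrite mb' -/A0 in I1 I2; rewrite mb in I2.
    by move: mB I1 I2 I4 s1 s0 s3 mb'le q1 kM kM' kM1 eA; clear; lra.
- have H2s x : G x -> B0 < x < Num.min b b' -> rho x - eta <= rho' x by exact: H2.
  have [bb|bb] := leP b' b.
  + have H2' x : G x -> B0 < x < b' -> rho x - eta <= rho' x.
      by move=> Gx /andP[h1 h2]; apply: H2 => //; rewrite h1 lt_min h2; move: h2 bb; clear; lra.
    have Pb : P b' <= P' b' + 2 * eta * A0 ^+ 2.
      have := mf_P F Bb'; have := mf_P F' Bb'; rewrite PB.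
      have := @Pcmp b' m' m Bb' (lexx _) lm' lm.
      have h z : B0 < z < b' -> m' z <= m z + eta * A0.
        move=> /andP[h1 h2]; apply: mup; [|exact: ltW|exact: ltW].
        by move=> w Gw /andP[w1 w2]; apply: H2' => //; rewrite w1 (lt_trans w2).
      by move=> /(_ h); clear; lra.
    have Pbb : P b <= P b'.
      rewrite -subr_ge0 (mf_P F bb).
      have -> : 0 = 0 * (b - b') by rewrite mul0r.
      apply: (Iab_bndl (@conullT R)) => // z _ /andP[_ z1].
      by have := mf_noninc F (ltW z1); rewrite mb; clear; lra.
    have s0 : m' b <= 0 by rewrite -mb'; exact: (mf_noninc F' bb).
    have [Pd _ I3] := H3 b (lexx _) bb.
    have P1 := Pd ltac:(by rewrite mb).
    have bk : b - b' <= kap.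
      apply: sqle; first by rewrite subr_ge0.
      by apply: le_trans (quadr b bb) _; move: de0 Pb Pbb P1 K1; clear; lra.
    have I1 := Iab_oneside cG F' F Bb' eta0 H2'.
    have -> : (fun x => `|rho x - rho' x|) = (fun x => `|rho' x - rho x|) by apply/funext => x; exact: distrC.
    have ln' : locbm (fun x => `|rho' x - rho x|) by exact: locbm_norm (locbmB l' l).
    have I2 := Iab_absB F' F bb.
    have I4 := I3 d bd.
    have /andP[_ s1] := slope' b' b bb; rewrite mb' in s1.
    have s2 : m b' <= M * (b - b').
      have : Iab b' b rho <= M * (b - b').
        by apply: (Iab_bndr cG) => // z Gz /andP[z1 z2]; apply: HM => //; rewrite z2 (le_lt_trans Bb').
      by rewrite -(mf_m F bb) mb subr0.
    rewrite (Iab_split ln' Bb' bd') (Iab_split ln' bb bd).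
    move: I4; rewrite mb sub0r normrN ler0_norm // => I4.
    have E : Iab b d (fun x => `|rho' x - rho x|) = Iab b d (fun x => `|rho x - rho' x|).
      by congr Iab; apply/funext => x; exact: distrC.
    have q1 := MMk M' _ (ltW M'0) bk; have q2 := MMk M _ M0 bk.
    rewrite E mb' -/A0 in I1 I2 *; rewrite mb in I2.
    by move: mB I1 I2 I4 s1 s2 s0 q1 q2 kM kM' kM1 eA; clear; lra.
  + have H2' x : G x -> B0 < x < b -> rho x - eta <= rho' x.
      by move=> Gx /andP[h1 h2]; apply: H2 => //; rewrite h1 lt_min h2; move: h2 bb; clear; lra.
    have mble : m' b <= eta * A0 by have := mup b H2' Bb (ltW bb); rewrite mb add0r.
    have /andP[s0 s1] := slope' b b' (ltW bb); rewrite mb' in s0 s1.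
    have bk : b' - b <= kap by rewrite -(ler_pM2l r'0); move: s0 mble K2; clear; lra.
    have m0 : m b' <= 0 by rewrite -mb; exact: (mf_noninc F (ltW bb)).
    have I1 := Iab_oneside cG F' F Bb eta0 H2'.
    have -> : (fun x => `|rho x - rho' x|) = (fun x => `|rho' x - rho x|) by apply/funext => x; exact: distrC.
    have ln' : locbm (fun x => `|rho' x - rho x|) by exact: locbm_norm (locbmB l' l).
    have I2 := Iab_absB F' F (ltW bb).
    have [_ _ I3] := H3 b' (ltW bb) (lexx _).
    have I4 := I3 d bd'.
    have s2 : - m b' <= M1 * (b' - b).
      by have := Iab_bndr cG l (ltW bb) HM1; rewrite -(mf_m F (ltW bb)) mb; clear; lra.
    rewrite (Iab_split ln' Bb bd) (Iab_split ln' (ltW bb) bd').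
    move: I4; rewrite mb' subr0 ler0_norm // => I4.
    have E : Iab b' d (fun x => `|rho' x - rho x|) = Iab b' d (fun x => `|rho x - rho' x|).
      by congr Iab; apply/funext => x; exact: distrC.
    have q1 := MMk M' _ (ltW M'0) bk; have q2 := MMk M1 _ M10 bk.
    have q3 := ler_wpM2l eta0 (subA b (ltW bb)).
    have q4 : 0 <= m' b by rewrite -mb'; exact: (mf_noninc F' (ltW bb)).
    rewrite E mb mb' in I1 I2 *.
    by move: mB I1 I2 I4 s0 s1 s2 q1 q2 q3 q4 mble kM kM' kM1 eA; clear; lra.
Qed.

End Stability.

(** * Flows coupled through the particle *)

Section Particle.
Context {R : realType}.

Record flow := Flow { f_rho : R -> R; f_q : R -> R; f_m : R -> R; f_P : R -> R; f_G : set R }.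

Definition flow_opp (s : flow) : flow :=
  Flow (fun x => f_rho s (- x)) (fun x => - f_q s (- x)) (fun x => - f_m s (- x))
       (fun x => f_P s (- x)) [set x | f_G s (- x)].

Definition solves (c rL uL rR uR : R) (s : flow) :=
  riemann c rL uL rR uR (f_rho s) (f_q s) (f_m s) (f_P s) (f_G s).

Lemma solves_opp c rL uL rR uR s : solves c rL uL rR uR s ->
  solves c rR (- uR) rL (- uL) (flow_opp s).
Proof.
case=> S q lq L Rr; split => /=.
- exact: simil_opp S.
- by move=> x Gx; rewrite q //; ring.
- exact: locbmN (locbm_opp lq).
- exact: Rr.
- have [xs [x1 H]] := L; exists xs, x1.
  have -> : (fun x => f_rho s (- - x)) = f_rho s by apply/funext => x; rewrite opprK.
  have -> : (fun x => - - f_m s (- - x)) = f_m s by apply/funext => x; rewrite !opprK.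
  have -> : [set x | f_G s (- - x)] = f_G s by apply/seteqP; split => x /=; rewrite opprK.
  by rewrite opprK.
Qed.

(** A and B extend to Riemann solutions whose inner data are the traces at v; al is the common mass
flux and de the jump of momentum flux. By pt_pos and pt_neg, a flow that enters the particle
subsonic leaves it subsonic. A wall is the case al = 0. *)
Record particle (c rL uL rR uR v al de rm rp : R) (A B : flow) : Prop := Particle {
  pt_A : solves c rL uL rm (v + al / rm) A;
  pt_B : solves c rp (v + al / rp) rR uR B;
  pt_rm : 0 < rm;
  pt_rp : 0 < rp;
  pt_mA : f_m A v = al;
  pt_mB : f_m B v = al;
  pt_PA : f_P A v * rm = al ^+ 2 + c ^+ 2 * rm ^+ 2;
  pt_PB : f_P B v * rp = al ^+ 2 + c ^+ 2 * rp ^+ 2;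
  pt_tA : forall e, 0 < e -> exists2 d, 0 < d & forall x, v - d < x < v -> `|f_rho A x - rm| <= e;
  pt_tB : forall e, 0 < e -> exists2 d, 0 < d & forall x, v < x < v + d -> `|f_rho B x - rp| <= e;
  pt_jump : f_P A v - f_P B v = de;
  pt_pos : 0 < al -> al <= c * rm -> al <= c * rp;
  pt_neg : al < 0 -> - al <= c * rp -> - al <= c * rm }.

Lemma particle_opp c rL uL rR uR v al de rm rp A B :
  particle c rL uL rR uR v al de rm rp A B ->
  particle c rR (- uR) rL (- uL) (- v) (- al) (- de) rp rm (flow_opp B) (flow_opp A).
Proof.
case=> hA hB r1 r2 mA mB PA PB tA tB j pp pn; split; rewrite /= ?opprK //.
- by have := solves_opp hB; rewrite opprD mulNr.
- by have := solves_opp hA; rewrite opprD mulNr.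
- by rewrite mB.
- by rewrite mA.
- by rewrite sqrrN.
- by rewrite sqrrN.
- move=> e e0; have [d d0 H] := tB e e0; exists d => // x /andP[h1 h2]; apply: H.
  by apply/andP; split; lra.
- move=> e e0; have [d d0 H] := tA e e0; exists d => // x /andP[h1 h2]; apply: H.
  by apply/andP; split; lra.
- by rewrite -j; ring.
- by move=> h; apply: pn; lra.
- by move=> h; apply: pp; lra.
Qed.

Definition near_flow (v e : R) (A B A' B' : flow) : Prop :=
  [/\ forall a b, a <= b -> b <= v -> Iab a b (fun x => `|f_rho A x - f_rho A' x|) <= e,
      forall a b, v <= a -> a <= b -> Iab a b (fun x => `|f_rho B x - f_rho B' x|) <= e,
      forall x, x <= v -> `|f_m A x - f_m A' x| <= e &
      forall x, v <= x -> `|f_m B x - f_m B' x| <= e].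

Lemma near_flow_opp c rL uL rR uR c' rL' uL' rR' uR' v e A B A' B'
   c1 rL1 uL1 rR1 uR1 c2 rL2 uL2 rR2 uR2  :
  solves c rL uL rR uR A -> solves c' rL' uL' rR' uR' B ->
  solves c1 rL1 uL1 rR1 uR1 A' -> solves c2 rL2 uL2 rR2 uR2 B' ->
  near_flow (- v) e (flow_opp B) (flow_opp A) (flow_opp B') (flow_opp A') -> near_flow v e A B A' B'.
Proof.
move=> hA hB hA' hB' [h1 h2 h3 h4].
have ln (s t : flow) c3 c4 a3 a4 a5 a6 b3 b4 b5 b6 : solves c3 a3 a4 a5 a6 s -> solves c4 b3 b4 b5 b6 t ->
    locbm (fun x => `|f_rho s x - f_rho t x|).
  by move=> H1 H2; exact: locbm_norm (locbmB (sm_loc (rm_simil H1)) (sm_loc (rm_simil H2))).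
split.
- move=> a b ab bv; have := h2 (- b) (- a) ltac:(lra) ltac:(lra).
  by rewrite (@Iab_opp _ (fun x => `|f_rho A x - f_rho A' x|)) ?opprK //; exact: ln hA hA'.
- move=> a b va ab; have := h1 (- b) (- a) ltac:(lra) ltac:(lra).
  by rewrite (@Iab_opp _ (fun x => `|f_rho B x - f_rho B' x|)) ?opprK //; exact: ln hB hB'.
- move=> x xv; have := h4 (- x) ltac:(lra); rewrite /= opprK.
  by rewrite opprK addrC distrC.
- move=> x xv; have := h3 (- x) ltac:(lra); rewrite /= opprK.
  by rewrite opprK addrC distrC.
Qed.

Lemma hz_eq1 (z : R) : hz z = 1 -> z = 1.
Proof.
rewrite /hz; case: (leP 1 z) => h.
  move/eqP; rewrite sqrp_eq1; first by move/eqP.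
  lra.
move=> E; have : expR (z - 1) < 1 by rewrite -[ltRHS]expR0 ltr_expR; lra.
by rewrite E ltxx.
Qed.

Lemma wave_edge (c rL uL : R) rho m G xs x1 : 0 < c -> 0 < rL -> left_wave c rL uL rho m G xs x1 ->
  m x1 <= c * (rL * hz ((uL - x1) / c)).
Proof.
move=> c0 r0 H; have [h|h] := leP x1 (uL - c).
  have z1 : 1 <= (uL - x1) / c by rewrite ler_pdivlMr // mul1r; lra.
  rewrite (lw_sup H (lexx _) h) hz_ge1 //.
  have {1}-> : uL - x1 = c * ((uL - x1) / c) by field; rewrite gt_eqF.
  rewrite mulrCA ler_pM2l // ler_pM2l // expr2 -[leLHS]mulr1 ler_pM2l //; lra.
rewrite (lw_fan H (ltW h) (lexx _)) ler_pM2l // ler_pM2l //; exact: gz_le_hz.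
Qed.

(** The left trace is either the subsonic state behind the transition, or the undisturbed outer state,
or a sonic state inside the fan. *)
Lemma left_trace (c rL uL v rm : R) rho m P G xs x1 : 0 < c -> 0 < rL ->
  simil c rho m P G -> left_wave c rL uL rho m G xs x1 -> v <= xs ->
  (forall e, 0 < e -> exists2 d, 0 < d & forall x, v - d < x < v -> `|rho x - rm| <= e) ->
  [\/ x1 < v /\ rm = rL * hz ((uL - x1) / c) /\ m v < c * rm,
      [/\ v <= x1, v <= uL - c & rm = rL /\ m v = rL * (uL - v)] |
      [/\ v <= x1, uL - c < v & m v = c * rm]].
Proof.
move=> c0 r0 S L vx tr.
have dense k : (exists2 w, w < v & forall x, G x -> w < x < v -> rho x = k) -> rm = k.
  move=> [w wv hw]; apply/eqP; rewrite -subr_eq0 -normr_eq0.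
  have : `|rm - k| <= 0.
    apply/ler_addgt0Pl => e e0; have [d d0 hd] := tr e e0.
    have [x [Gx /andP[]]] := conull_dense (sm_G S) (ltac:(by rewrite gt_max wv; lra) : Num.max w (v - d) < v).
    rewrite gt_max => /andP[xw xd] xv; have := hd x ltac:(lra).
    by rewrite (hw x Gx) ?xw ?xv // addr0 distrC.
  by move=> h; apply/eqP/le_anti; rewrite h normr_ge0.
have [xv|vx1] := ltP x1 v.
  have rE : rm = rL * hz ((uL - x1) / c).
    apply: dense; exists x1 => // x Gx /andP[h1 h2].
    by rewrite (lw_dens L Gx) ?gt_eqF // /dens ?ltNge ?(ltW h1) //; lra.
  apply: Or31; split => //; split => //.
  rewrite rE; apply: lt_le_trans (wave_edge c0 r0 L); exact: sm_decr S _ _ xv.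
have [vu|uv] := leP v (uL - c).
  apply: Or32; split => //; split; last exact: (lw_sup L).
  apply: dense; exists (v - 1); first lra.
  move=> x Gx /andP[_ xv]; rewrite (lw_dens L Gx); [|lra|by rewrite lt_eqF //; lra].
  rewrite /dens ifT; last lra.
  by rewrite gz_ge1 ?mulr1 // ler_pdivlMr // mul1r; lra.
apply: Or33; split => //.
apply/eqP; rewrite -subr_eq0 -normr_eq0.
have : `|m v - c * rm| <= 0.
  apply/ler_addgt0Pl => e e0; rewrite addr0.
  have [d d0 hd] := tr (e / (2 * c)) ltac:(by rewrite divr_gt0 // mulr_gt0).
  have [d1 d10 hd1] := cont_at_eps (sm_mcont S v) (ltac:(lra) : 0 < e / 2).
  pose w := Num.max (Num.max (uL - c) (v - d1)) (v - d).
  have wv : w < v by rewrite /w !gt_max; do ?[apply/andP; split]; lra.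
  have [x [Gx /andP[]]] := conull_dense (sm_G S) wv.
  rewrite /w !gt_max => /andP[/andP[x1' x2'] x3'] xv.
  have h1 := hd x ltac:(lra); have h2 := hd1 x ltac:(by rewrite ltr0_norm; lra).
  have mx : m x = c * rho x.
    rewrite (lw_fan L); [|lra|lra].
    rewrite (lw_dens L Gx); [|lra|by rewrite lt_eqF //; lra].
    by rewrite /dens ifT //; lra.
  have E : m v - c * rm = - (m x - m v) + c * (rho x - rm) by rewrite mx; ring.
  rewrite E; apply: le_trans (ler_normD _ _) _; rewrite normrN normrM (gtr0_norm c0).
  have : c * `|rho x - rm| <= c * (e / (2 * c)) by rewrite ler_pM2l.
  have -> : c * (e / (2 * c)) = e / 2 by field; rewrite gt_eqF.
  lra.
by move=> h; apply/eqP/le_anti; rewrite h normr_ge0.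
Qed.

(** To the right of v, the flow is a left wave for its own trace rp. If the transition is not after v,
the state is constant up to the contact, so hz equals 1 there, which means that the transition is
sonic. Otherwise a subsonic rp would start a fan at a density strictly smaller than rp. *)
Lemma right_trace (c rp v al : R) rho m P G xs x1 : 0 < c -> 0 < rp ->
  simil c rho m P G -> left_wave c rp (v + al / rp) rho m G xs x1 -> v < xs ->
  (forall e, 0 < e -> exists2 d, 0 < d & forall x, v < x < v + d -> `|rho x - rp| <= e) ->
  (al <= c * rp /\ forall x, G x -> v < x < xs -> rho x = rp) \/ (v < x1 /\ c * rp <= al).
Proof.
move=> c0 r0 S L vx tr.
have alE : (al / rp <= c) = (al <= c * rp) by rewrite ler_pdivrMr.
have [xv|vx1] := leP x1 v.
  have h x : G x -> v < x < xs -> rho x = rp * hz ((v + al / rp - x1) / c).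
    by move=> Gx /andP[h1 h2]; rewrite (lw_dens L Gx) //; [rewrite /dens ifF //; apply/negbTE; rewrite -leNgt; lra|rewrite gt_eqF //; lra].
  have E : rp = rp * hz ((v + al / rp - x1) / c).
    apply/eqP; rewrite -subr_eq0 -normr_eq0.
    have : `|rp - rp * hz ((v + al / rp - x1) / c)| <= 0.
      apply/ler_addgt0Pl => e e0; rewrite addr0; have [d d0 hd] := tr e e0.
      have [x [Gx /andP[xv']]] := conull_dense (sm_G S) (ltac:(by rewrite lt_min vx; lra) : v < Num.min xs (v + d)).
      rewrite lt_min => /andP[x1' x2']; have := hd x ltac:(lra).
      by rewrite (h x Gx) ?xv' ?x1' // distrC.
    by move=> k; apply/eqP/le_anti; rewrite k normr_ge0.
  have h1 : hz ((v + al / rp - x1) / c) = 1.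
    by apply: (mulfI (lt0r_neq0 r0)); rewrite mulr1 -E.
  have z1 := hz_eq1 h1.
  have x1E : v + al / rp - x1 = c by rewrite -[RHS]mul1r -z1; field; rewrite !gt_eqF.
  left; split; first by rewrite -alE; lra.
  by move=> x Gx xx; rewrite h // h1 mulr1.
right; split => //.
rewrite leNgt -(ltr_pdivrMr _ _ r0); apply/negP => lt.
pose k := gz ((al / rp) / c).
have k1 : k < 1.
  rewrite /k gzE; first by rewrite -[ltRHS]expR0 ltr_expR subr_lt0 ltr_pdivrMr // mul1r.
  by rewrite ler_pdivrMr // mul1r ltW.
have [d d0 hd] := tr (rp * (1 - k) / 2) ltac:(by rewrite divr_gt0 // mulr_gt0 //; lra).
have [x [Gx /andP[xv']]] := conull_dense (sm_G S) (ltac:(by rewrite !lt_min vx vx1 /=; lra) : v < Num.min (Num.min xs x1) (v + d)).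
rewrite !lt_min => /andP[/andP[x1' x2'] x3']; have := hd x ltac:(lra).
have -> : rho x = rp * gz ((v + al / rp - x) / c).
  by rewrite (lw_dens L Gx) ?lt_eqF // /dens x2'.
have : rp * gz ((v + al / rp - x) / c) <= rp * k.
  by rewrite ler_pM2l //; apply: gz_mono; rewrite ler_pM2r ?invr_gt0 //; lra.
rewrite ler_norml => h /andP[h1 _].
have : 0 < rp * (1 - k) by rewrite mulr_gt0 //; lra.
lra.
Qed.

End Particle.

(** * A small jump of momentum flux hardly changes the wave *)

Section Approx.
Context {R : realType}.
Implicit Types z : R.

Lemma gz_lip z' z : z' <= z -> gz z - gz z' <= z - z'.
Proof.
move=> zz; rewrite /gz; case: (leP 1 z) => h1; case: (leP 1 z') => h2; [lra| |lra|].
  by have := expR_ge1Dx (z' - 1); lra.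
have -> : expR (z' - 1) = expR (z - 1) * expR (z' - z) by rewrite -expRD; congr expR; ring.
have e1 : expR (z - 1) <= 1 by rewrite -[leRHS]expR0 ler_expR; lra.
have e2 := expR_ge1Dx (z' - z).
have e3 : expR (z' - z) <= 1 by rewrite -[leRHS]expR0 ler_expR; lra.
have := ler_pM (expR_ge0 (z - 1)) (ltac:(lra) : 0 <= 1 - expR (z' - z)) e1 (lexx _).
lra.
Qed.

Lemma hz_lip z' z (Z : R) : 1 <= Z -> z <= Z -> z' <= z -> hz z - hz z' <= 2 * Z * (z - z').
Proof.
move=> Z1 zZ zz.
have ZZ : z - z' <= 2 * Z * (z - z').
  have := mulr_ge0 (ltac:(lra) : 0 <= z - z') (ltac:(lra) : 0 <= 2 * Z - 1); lra.
have [z1|z1] := leP z 1.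
  rewrite !hzE //; last lra.
  by have := gz_lip zz; rewrite !gzE //; lra.
rewrite hz_ge1; last exact: ltW.
have [z1'|z1'] := leP z' 1.
  rewrite hzE //; have := expR_ge1Dx (z' - 1).
  have := mulr_ge0 (ltac:(lra) : 0 <= z - 1) (ltac:(lra) : 0 <= 2 * Z - z - 1).
  have := mulr_ge0 (ltac:(lra) : 0 <= 1 - z') (ltac:(lra) : 0 <= 2 * Z - 1); lra.
rewrite hz_ge1; last exact: ltW.
have := mulr_ge0 (ltac:(lra) : 0 <= z - z') (ltac:(lra) : 0 <= 2 * Z - z - z'); lra.
Qed.

Lemma gz_shift z t : z <= 1 -> 0 <= t -> gz (z - t) = gz z * expR (- t).
Proof. by move=> z1 t0; rewrite !gzE; [rewrite -expRD; congr expR; ring|lra|lra]. Qed.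

Lemma hz_gz z : z <= 1 -> hz z = gz z.
Proof. by move=> z1; rewrite hzE // gzE. Qed.

(** On the subsonic branch the momentum flux al^2 / r + c^2 r increases with r, but its derivative
vanishes at the sonic state: a jump de changes the density by an amount of order sqrt de. *)
Lemma sub_close (c al P1 P2 r1 r2 de : R) : 0 < c -> 0 <= al -> 0 < r1 -> 0 < r2 ->
  P1 * r1 = al ^+ 2 + c ^+ 2 * r1 ^+ 2 -> P2 * r2 = al ^+ 2 + c ^+ 2 * r2 ^+ 2 ->
  P1 - P2 = de -> 0 <= de -> al <= c * r1 -> al <= c * r2 ->
  r2 <= r1 /\ c ^+ 2 * (r1 - r2) ^+ 2 <= de * r1.
Proof.
move=> c0 a0 r10 r20 e1 e2 d de0 s1 s2.
have key : de * (r1 * r2) = (r1 - r2) * (c ^+ 2 * (r1 * r2) - al ^+ 2).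
  by rewrite -d; transitivity (P1 * r1 * r2 - P2 * r2 * r1); [ring|rewrite e1 e2; ring].
have q1 : al ^+ 2 <= c ^+ 2 * r1 ^+ 2 by rewrite -exprMn ler_pXn2r // nnegrE mulr_ge0 // ltW.
have q2 : al ^+ 2 <= c ^+ 2 * r2 ^+ 2 by rewrite -exprMn ler_pXn2r // nnegrE mulr_ge0 // ltW.
have rr : 0 < r1 * r2 by rewrite mulr_gt0.
have c2 : 0 < c ^+ 2 by rewrite exprn_gt0.
have le : r2 <= r1.
  rewrite leNgt; apply/negP => lt.
  have : c ^+ 2 * r1 ^+ 2 < c ^+ 2 * (r1 * r2) by rewrite ltr_pM2l // expr2 ltr_pM2l.
  move=> h; have := mulr_gt0 (ltac:(lra) : 0 < r2 - r1) (ltac:(lra) : 0 < c ^+ 2 * (r1 * r2) - al ^+ 2).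
  have := mulr_ge0 de0 (ltW rr); lra.
split => //.
rewrite -(ler_pM2r r20).
have h : c ^+ 2 * r2 * (r1 - r2) <= c ^+ 2 * (r1 * r2) - al ^+ 2 by lra.
have := ler_wpM2l (ltac:(lra) : 0 <= r1 - r2) h; lra.
Qed.

(** As above on the supersonic branch, where the momentum flux decreases with r. *)
Lemma sup_close (c al P1 P2 r1 r2 de : R) : 0 < c -> 0 <= al -> 0 < r1 -> 0 < r2 ->
  P1 * r1 = al ^+ 2 + c ^+ 2 * r1 ^+ 2 -> P2 * r2 = al ^+ 2 + c ^+ 2 * r2 ^+ 2 ->
  P1 - P2 = de -> 0 <= de -> c * r1 <= al -> c * r2 <= al ->
  r1 <= r2 /\ c ^+ 2 * (r1 - r2) ^+ 2 <= de * r1.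
Proof.
move=> c0 a0 r10 r20 e1 e2 d de0 s1 s2.
have key : de * (r1 * r2) = (r1 - r2) * (c ^+ 2 * (r1 * r2) - al ^+ 2).
  by rewrite -d; transitivity (P1 * r1 * r2 - P2 * r2 * r1); [ring|rewrite e1 e2; ring].
have cr1 : 0 <= c * r1 by rewrite mulr_ge0 // ltW.
have cr2 : 0 <= c * r2 by rewrite mulr_ge0 // ltW.
have q1 : c ^+ 2 * r1 ^+ 2 <= al ^+ 2 by rewrite -exprMn ler_pXn2r // nnegrE.
have q2 : c ^+ 2 * r2 ^+ 2 <= al ^+ 2 by rewrite -exprMn ler_pXn2r // nnegrE.
have rr : 0 < r1 * r2 by rewrite mulr_gt0.
have c2 : 0 < c ^+ 2 by rewrite exprn_gt0.
have le : r1 <= r2.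
  rewrite leNgt; apply/negP => lt.
  have : c ^+ 2 * (r1 * r2) < c ^+ 2 * r1 ^+ 2 by rewrite ltr_pM2l // expr2 ltr_pM2l.
  move=> h; have := mulr_gt0 (ltac:(lra) : 0 < r1 - r2) (ltac:(lra) : 0 < al ^+ 2 - c ^+ 2 * (r1 * r2)).
  have := mulr_ge0 de0 (ltW rr); lra.
split => //.
rewrite -(ler_pM2r r20).
have h : c ^+ 2 * r2 * (r2 - r1) <= al ^+ 2 - c ^+ 2 * (r1 * r2) by lra.
have := ler_wpM2l (ltac:(lra) : 0 <= r2 - r1) h; lra.
Qed.

(** A shock at x1 puts the contact at distance less than c from x1, so a transition too far to the
left would put the contact before v. *)
Lemma left_start (c rL uL v : R) rho m P G xs x1 : 0 < c -> 0 < rL -> simil c rho m P G ->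
  left_wave c rL uL rho m G xs x1 -> v <= xs -> Num.min v uL - c <= x1.
Proof.
move=> c0 r0 S L vx; rewrite leNgt; apply/negP => lt.
have [xv xu] : x1 < v - c /\ x1 < uL - c.
  by move: lt; rewrite ltrBrDr lt_min => /andP[? ?]; split; lra.
have z1 : 1 < (uL - x1) / c by rewrite ltr_pdivlMr // mul1r; lra.
have := lw_sub L (lexx _) (ltW (lw_lt L)); rewrite hz_ge1 ?(ltW z1) //.
rewrite (lw_sup L (lexx _) (ltW xu)).
set z := (uL - x1) / c in z1 *.
have -> : uL - x1 = c * z by rewrite /z; field; rewrite gt_eqF.
move=> E.
have n0 : rL * z != 0 by rewrite gt_eqF // mulr_gt0 //; lra.
have e0 : rL * z * (z * (xs - x1)) = rL * z * c.
  by transitivity (rL * z ^+ 2 * (xs - x1)); [ring|rewrite -E; ring].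
have zc := mulfI n0 e0.
have := ltr_pM2r (ltac:(lra) : 0 < xs - x1) 1 z; rewrite z1 mul1r zc => h.
have h2 : xs - x1 < c by rewrite h.
lra.
Qed.

(** The mass flux at v is largest for the wave that is still in its fan there. *)
Lemma flux_le_fan (c rL uL v : R) rho m P G xs x1 : 0 < c -> 0 < rL -> simil c rho m P G ->
  left_wave c rL uL rho m G xs x1 -> x1 < v -> v <= xs -> uL - c <= v ->
  m v <= c * (rL * gz ((uL - v) / c)).
Proof.
move=> c0 r0 S L xv vx uv.
have E := lw_sub L (lexx _) (ltW (lw_lt L)).
rewrite (lw_sub L (ltW xv) vx).
set z := (uL - x1) / c in E *; set rho1 := rL * hz z in E *.
have rho10 : 0 < rho1 by rewrite mulr_gt0 // hz_gt0.
pose y := (v - x1) / c.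
have y0 : 0 < y by rewrite divr_gt0 //; lra.
have vE : v = x1 + c * y by rewrite /y; field; rewrite gt_eqF.
have -> : (uL - v) / c = z - y by rewrite /z /y; field; rewrite gt_eqF.
have zy : z - y <= 1.
  have -> : z - y = (uL - v) / c by rewrite /z /y; field; rewrite gt_eqF.
  by rewrite ler_pdivrMr // mul1r; lra.
have -> : xs - v = (xs - x1) - c * y by rewrite vE; ring.
rewrite mulrBr -E gzE //.
have [xu|ux] := leP x1 (uL - c).
  have z1 : 1 <= z by rewrite ler_pdivlMr // mul1r; lra.
  rewrite (lw_sup L (lexx _) xu) /rho1 hz_ge1 //.
  have -> : uL - x1 = c * z by rewrite /z; field; rewrite gt_eqF.
  have e1 := expR_ge1Dx (z - y - 1).
  have -> : rL * (c * z) - rL * z ^+ 2 * (c * y) = c * (rL * (z - z ^+ 2 * y)) by ring.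
  rewrite ler_pM2l // ler_pM2l //.
  have := mulr_ge0 (ltW y0) (ltac:(lra) : 0 <= z - 1).
  have := mulr_ge0 (mulr_ge0 (ltW y0) (ltac:(lra) : 0 <= z - 1)) (ltac:(lra) : 0 <= z); lra.
rewrite (lw_fan L (ltW ux) (lexx _)) -/z.
have z1 : z <= 1 by rewrite ler_pdivrMr // mul1r; lra.
rewrite /rho1 hzE // gzE //.
have -> : expR (z - y - 1) = expR (z - 1) * expR (- y) by rewrite -expRD; congr expR; ring.
have -> : c * (rL * expR (z - 1)) - rL * expR (z - 1) * (c * y) = c * (rL * (expR (z - 1) * (1 - y))) by ring.
rewrite ler_pM2l // ler_pM2l // ler_pM2l ?expR_gt0 //.
by have := expR_ge1Dx (- y); lra.
Qed.

End Approx.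

Section ParticleApprox.
Context {R : realType}.

Lemma abs_sq_le (x e : R) : 0 <= e -> x ^+ 2 <= e ^+ 2 -> `|x| <= e.
Proof. by move=> e0; rewrite -[X in X <= _]real_normK ?num_real // ler_pXn2r // nnegrE. Qed.

(** Behind a shock of ratio at least zv^2 > 1 the flow is strictly subsonic, and becoming sonic costs a
definite amount of momentum. *)
Lemma sonic_gap (c rL rm rp zv z de : R) : 0 < c -> 0 < rL -> 1 < zv -> zv < z ->
  rm = rL * z ^+ 2 -> rp <= rL * z -> c ^+ 2 * (rm - rp) ^+ 2 <= de * rm ->
  rL * (1 - zv^-1) ^+ 2 * c ^+ 2 <= de.
Proof.
move=> c0 r0 zz zlt rmz rpz h.
have c2 : 0 < c ^+ 2 by rewrite exprn_gt0.
have zi : zv^-1 < 1 by rewrite invf_lt1; lra.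
have q0 : 0 < 1 - zv^-1 by lra.
have rLm : rL <= rm by rewrite rmz -[leLHS]mulr1 ler_pM2l //; apply: exprn_ege1; lra.
have rm0 : 0 < rm by lra.
have gap : rm * (1 - zv^-1) <= rm - rp.
  have : rL * z <= rm * zv^-1.
    rewrite rmz ler_pdivlMr; last lra.
    rewrite -mulrA ler_pM2l // expr2 ler_pM2l; lra.
  lra.
have gap2 : (rm * (1 - zv^-1)) ^+ 2 <= (rm - rp) ^+ 2.
  have g0 : 0 <= rm * (1 - zv^-1) by rewrite mulr_ge0 // ltW.
  by rewrite ler_pXn2r // nnegrE //; exact: le_trans gap.
have : c ^+ 2 * (rm * (1 - zv^-1)) ^+ 2 <= de * rm by apply: le_trans h; rewrite ler_pM2l.
have -> : c ^+ 2 * (rm * (1 - zv^-1)) ^+ 2 = (rm * (1 - zv^-1) ^+ 2 * c ^+ 2) * rm by ring.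
rewrite ler_pM2r //; apply: le_trans.
by rewrite ler_pM2r // ler_pM2r // exprn_gt0.
Qed.

(** Both fans decay by the same exponential factor, so the distance of their densities does not
grow. *)
Lemma fan_close (c rL uL v rp al e y : R) : 0 < c -> 0 < rL -> 0 < rp -> uL - c <= v -> al = c * rp ->
  rp <= rL * gz ((uL - v) / c) -> rL * gz ((uL - v) / c) <= rp + e -> v <= y ->
  `|rp * gz ((v + al / rp - y) / c) - rL * gz ((uL - y) / c)| <= e /\
  `|rp * hz ((v + al / rp - y) / c) - rL * hz ((uL - y) / c)| <= e.
Proof.
move=> c0 r0 rp0 uv alE h1 h2 vy; set zv := (uL - v) / c in h1 h2 *.
set rv := rL * gz zv in h1 h2.
have zv1 : zv <= 1 by rewrite /zv ler_pdivrMr // mul1r; lra.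
have t0 : 0 <= (y - v) / c by rewrite divr_ge0 // ?subr_ge0 // ltW.
have E1 : (v + al / rp - y) / c = 1 - (y - v) / c by rewrite alE; field; rewrite !gt_eqF.
have E2 : (uL - y) / c = zv - (y - v) / c by rewrite /zv; field; rewrite gt_eqF.
have est : `|rp * expR (- ((y - v) / c)) - rv * expR (- ((y - v) / c))| <= e.
  have x0 := expR_ge0 (- ((y - v) / c)).
  have x1 : expR (- ((y - v) / c)) <= 1 by rewrite -[leRHS]expR0 ler_expR oppr_le0.
  rewrite -mulrBl normrM (ger0_norm x0) ler0_norm; last by rewrite subr_le0.
  rewrite -[leRHS]mulr1; apply: ler_pM => //; lra.
have G : `|rp * gz ((v + al / rp - y) / c) - rL * gz ((uL - y) / c)| <= e.
  by rewrite E1 E2 gz_shift // (@gz_ge1 _ 1) // mul1r gz_shift // mulrA.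
split => //; rewrite !hz_gz //; [rewrite E2; lra|rewrite E1; lra].
Qed.

(** The two supersonic states have the same mass flux through v, so that their variables z differ by
the constant De, and gz and hz are Lipschitz. *)
Lemma sup_profile_close (c rL uL v rp al e y : R) : 0 < c -> 0 < rL -> v <= uL - c -> al = rL * (uL - v) ->
  rL <= rp -> rp <= rL + e -> v <= y ->
  `|rp * gz ((v + al / rp - y) / c) - rL * gz ((uL - y) / c)| <= 3 * ((uL - v) / c) ^+ 2 * e /\
  `|rp * hz ((v + al / rp - y) / c) - rL * hz ((uL - y) / c)| <= 3 * ((uL - v) / c) ^+ 2 * e.
Proof.
move=> c0 r0 vu alE rLrp rpe vy; set Z := (uL - v) / c.
have rp0 : 0 < rp by exact: lt_le_trans rLrp.
have e0 : 0 <= e by lra.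
have Z1 : 1 <= Z by rewrite /Z ler_pdivlMr // mul1r; lra.
pose De := Z * (1 - rL / rp).
have q1 : rL / rp <= 1 by rewrite ler_pdivrMr // mul1r.
have De0 : 0 <= De by apply: mulr_ge0; lra.
have rLDe : rL * De <= Z * e.
  rewrite /De mulrCA; apply: ler_wpM2l; first lra.
  have -> : rL * (1 - rL / rp) = (rL / rp) * (rp - rL) by field; rewrite gt_eqF.
  rewrite -[leRHS]mul1r; apply: ler_pM => //; [by rewrite divr_ge0 // ltW|lra|lra].
have zE : (v + al / rp - y) / c = (uL - y) / c - De.
  by rewrite /De /Z alE; field; rewrite !gt_eqF.
have zle : (uL - y) / c <= Z by exact: zc_mono.
rewrite zE; set z := (uL - y) / c in zle *.
have zz : z - De <= z by lra.
have b3 : Z * e <= Z ^+ 2 * e by apply: ler_wpM2r => //; rewrite expr2 -[leLHS]mulr1 ler_pM2l //; lra.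
have b4 : 1 * e <= Z ^+ 2 * e by apply: ler_wpM2r => //; exact: exprn_ege1.
clear zE alE vu vy.
split.
- have g1 := gz_lip zz; have g2 := gz_mono zz; have g3 := gz_le1 (z - De); have g4 := gz_gt0 (z - De).
  have -> : rp * gz (z - De) - rL * gz z = (rp - rL) * gz (z - De) - rL * (gz z - gz (z - De)) by ring.
  apply: le_trans (ler_normB _ _) _.
  rewrite !ger0_norm; [|by apply: mulr_ge0; lra|by apply: mulr_ge0; lra].
  have b1 : (rp - rL) * gz (z - De) <= e * 1 by apply: ler_pM; lra.
  have b2 : rL * (gz z - gz (z - De)) <= rL * De by rewrite ler_pM2l //; lra.
  lra.
- have g1 := hz_lip Z1 zle zz; have g2 := hz_mono zz; have g4 := hz_gt0 (z - De).
  have g3 : hz (z - De) <= Z ^+ 2 by rewrite -(hz_ge1 Z1); apply: hz_mono; lra.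
  have -> : rp * hz (z - De) - rL * hz z = (rp - rL) * hz (z - De) - rL * (hz z - hz (z - De)) by ring.
  apply: le_trans (ler_normB _ _) _.
  rewrite !ger0_norm; [|by apply: mulr_ge0; lra|by apply: mulr_ge0; lra].
  have b1 : (rp - rL) * hz (z - De) <= e * Z ^+ 2 by apply: ler_pM; lra.
  have b2 : rL * (hz z - hz (z - De)) <= rL * (2 * Z * De) by rewrite ler_pM2l //; lra.
  have b5 : 2 * Z * (rL * De) <= 2 * Z * (Z * e) by rewrite ler_pM2l //; lra.
  lra.
Qed.

(** The approximating wave has its transition x1 before v if the flow is already subsonic when it
reaches v, at v if the particle acts as a shock, and where the right flow has its own transition
in the other cases. *)
Lemma particle_approx (c rL uL v eta : R) : 0 < c -> 0 < rL -> 0 < eta ->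
  exists2 de0 : R, 0 < de0 & forall rR uR al de rm rp A B,
    particle c rL uL rR uR v al de rm rp A B -> 0 <= al -> (0 < al -> 0 < de) -> 0 <= de -> de <= de0 ->
  exists2 x1, Num.min v uL - c <= x1 & exists2 G, conull G &
   (forall x, G x -> x < v -> `|f_rho A x - dens c rL uL x1 x| <= eta) /\
   (forall x, G x -> v < x -> 0 < f_m B x -> `|f_rho B x - dens c rL uL x1 x| <= eta).
Proof.
move=> c0 r0 eta0.
pose B0 := Num.min v uL - c.
pose K := rL * (1 + hz ((uL - B0) / c)).
have K0 : 0 < K by rewrite mulr_gt0 //; have := hz_gt0 ((uL - B0) / c); lra.
have rK : rL <= K by rewrite /K -[leLHS]mulr1 ler_pM2l //; have := hz_gt0 ((uL - B0) / c); lra.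
pose zv := (uL - v) / c.
pose Z := Num.max 1 zv.
have Z1 : 1 <= Z by rewrite /Z le_max lexx.
have zZ : zv <= Z by rewrite /Z le_max lexx orbT.
have Z2 : 1 <= Z ^+ 2 by exact: exprn_ege1.
pose e1 := eta / (3 * Z ^+ 2).
have e10 : 0 < e1 by rewrite divr_gt0 //; lra.
have e1E : 3 * Z ^+ 2 * e1 = eta by rewrite /e1; field; lra.
have e1eta : e1 <= eta by rewrite -e1E -[leLHS]mul1r ler_pM2r //; lra.
pose g0 := if v < uL - c then rL * (1 - zv^-1) ^+ 2 * c ^+ 2 / 2 else 1.
have c2 : 0 < c ^+ 2 by rewrite exprn_gt0.
have zv1 : v < uL - c -> 1 < zv by move=> h; rewrite /zv ltr_pdivlMr // mul1r; lra.
have gap0 : v < uL - c -> 0 < rL * (1 - zv^-1) ^+ 2 * c ^+ 2.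
  move=> h; have zz := zv1 h.
  have : zv^-1 < 1 by rewrite invf_lt1; lra.
  by move=> h1; rewrite mulr_gt0 // mulr_gt0 // exprn_gt0 //; lra.
have g00 : 0 < g0 by rewrite /g0; case: ifP => // h; rewrite divr_gt0 // gap0.
exists (Num.min (c ^+ 2 * e1 ^+ 2 / K) g0).
  by rewrite lt_min g00 andbT divr_gt0 // mulr_gt0 // exprn_gt0.
move=> rR uR al de rm rp A B pt al0 alde de0; rewrite le_min => /andP[deK deg].
have small r : 0 < r -> r <= K -> de * r <= c ^+ 2 * e1 ^+ 2.
  move=> rp0 rK'; apply: (@le_trans _ _ (de * K)); first exact: ler_wpM2l.
  by rewrite -ler_pdivlMr.
have close2 r1 r2 : 0 < r1 -> r1 <= K -> c ^+ 2 * (r1 - r2) ^+ 2 <= de * r1 -> `|r1 - r2| <= e1.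
  move=> rp0 rK' h; apply: abs_sq_le; first exact: ltW.
  by rewrite -(ler_pM2l c2); apply: le_trans h (small _ _ _).
have [hA hB rm0 rp0 mA mB PA PB tA tB jump pos _] := pt.
have SA := rm_simil hA; have SB := rm_simil hB.
have [xsA [xA LA]] := rm_left hA; have [xsB [xB LB]] := rm_left hB.
have vA : v <= xsA.
  by rewrite leNgt; apply/negP => /(sm_decr SA); rewrite (lw_zero LA) mA ltNge al0.
have startA : B0 <= xA by exact: left_start c0 r0 SA LA vA.
have KE x : B0 <= x -> rL * hz ((uL - x) / c) <= K.
  by move=> Bx; rewrite /K ler_pM2l //; have := hz_mono (zc_mono uL c0 Bx); clear; lra.
have B0v : B0 <= v.
  by rewrite lerBlDr; apply: (@le_trans _ _ v); [rewrite ge_min lexx|rewrite lerDl ltW].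
pose G := f_G A `&` f_G B `&` [set x | x <> xA] `&` [set x | x <> xB].
have cG : conull G by do !apply: conullI; [exact: sm_G SA|exact: sm_G SB|exact: conullD1|exact: conullD1].
have exactA x : G x -> x < v -> f_rho A x = dens c rL uL xA x.
  by move=> [[[gA gB] /eqP nA] nB] xv; rewrite (lw_dens LA gA) //; exact: lt_le_trans vA.
have densl x x1 : x < x1 -> dens c rL uL x1 x = rL * gz ((uL - x) / c) by rewrite /dens => ->.
have densr x x1 : x1 <= x -> dens c rL uL x1 x = rL * hz ((uL - x1) / c) by rewrite /dens leNgt => /negbTE ->.
have exactA' x1 x : v <= x1 -> v <= xA -> G x -> x < v -> `|f_rho A x - dens c rL uL x1 x| <= eta.
  move=> vx1 vxA Gx xv; rewrite exactA // !densl ?subrr ?normr0 ?(ltW eta0) //.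
    exact: lt_le_trans vx1.
  exact: lt_le_trans vxA.
have exactA0 x : G x -> x < v -> `|f_rho A x - dens c rL uL xA x| <= eta.
  by move=> Gx xv; rewrite exactA // subrr normr0 ltW.
have mposB x : 0 < f_m B x -> x < xsB.
  by move=> mx; apply: (sm_lt SB); rewrite (lw_zero LB).
have mBv x : v < x -> 0 < f_m B x -> 0 < al.
  by move=> vx mx; apply: lt_trans mx _; rewrite -mB; exact: sm_decr SB _ _ vx.
have vB : 0 < al -> v < xsB by move=> h; apply: (sm_lt SB); rewrite (lw_zero LB) mB.
have rtB : 0 < al -> (al <= c * rp /\ forall x, f_G B x -> v < x < xsB -> f_rho B x = rp) \/ (v < xB /\ c * rp <= al).
  by move=> h; exact: (right_trace c0 rp0 SB LB (vB h) tB).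
have densB x : G x -> 0 < f_m B x -> f_rho B x = dens c rp (v + al / rp) xB x.
  by move=> [[[_ gB] _] nB] mx; apply: (lw_dens LB) => //; [exact: mposB|apply/eqP].
have constB : (forall x, f_G B x -> v < x < xsB -> f_rho B x = rp) -> forall x, G x -> v < x -> 0 < f_m B x -> f_rho B x = rp.
  by move=> h x [[[_ gB] _] _] vx mx; apply: h => //; rewrite vx mposB.
clear mposB deK small.
case: (left_trace c0 r0 SA LA vA tA) => [[xAv [rmE mlt]]|[vxA vu [rmE mE]]|[vxA uv mE]].
- rewrite mA in mlt.
  have rmK : rm <= K by rewrite rmE; exact: KE.
  have [al00|alp] := leP al 0.
    exists xA => //; exists G => //; split => // x Gx vx /(mBv _ vx).
    by rewrite ltNge al00.
  have [rple rprm] := sub_close c0 al0 rm0 rp0 PA PB jump de0 (ltW mlt) (pos alp (ltW mlt)).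
  have cl := close2 _ _ rm0 rmK rprm.
  case: (rtB alp) => [[_ Bc]|[vxB alB]].
  + exists xA => //; exists G => //; split => // x Gx vx mx.
    rewrite (constB Bc) // densr; last by apply: ltW; exact: lt_trans vx.
    by rewrite -rmE distrC; exact: le_trans e1eta.
  + have alE : al = c * rp by apply/le_anti; rewrite alB (pos alp (ltW mlt)).
    have uv : uL - c <= v.
      rewrite leNgt; apply/negP => lt; have zz := zv1 lt.
      pose z := (uL - xA) / c.
      have zlt : zv < z by rewrite /zv /z ltr_pM2r ?invr_gt0 // ltrD2l ltrN2.
      have xAu : xA <= uL - c by exact: le_trans (ltW xAv) (ltW lt).
      have rpz : rp <= rL * z.
        rewrite -(ler_pM2l c0) -alE -mA; apply: le_trans (ltW (sm_decr SA xAv)) _.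
        rewrite (lw_sup LA (lexx _) xAu) mulrCA /z.
        by have -> : c * ((uL - xA) / c) = uL - xA by field; rewrite gt_eqF.
      have rmz : rm = rL * z ^+ 2 by rewrite rmE hz_ge1 // ltW // (lt_trans zz).
      have := sonic_gap c0 r0 zz zlt rmz rpz rprm.
      move: deg (gap0 lt); rewrite /g0 lt; clear; lra.
    pose rv := rL * gz zv.
    have rprv : rp <= rv.
      by have := flux_le_fan c0 r0 SA LA xAv vA uv; rewrite mA alE ler_pM2l.
    have rvrm : rv <= rm.
      by rewrite rmE /rv ler_pM2l //; apply: le_trans (gz_le_hz _) _; apply: hz_mono; exact: zc_mono (ltW xAv).
    have rmrp : rm <= rp + e1 by move: cl; rewrite ler_norml => /andP[_]; clear; lra.
    have rve : rv <= rp + e1 by exact: le_trans rmrp.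
    have FC y (vy : v <= y) := fan_close c0 r0 rp0 uv alE rprv rve vy.
    exists xB; first by apply: le_trans (ltW vxB).
    exists G => //; split.
      move=> x Gx xv; have xxB : x < xB by exact: lt_trans vxB.
      rewrite (densl _ _ xxB) exactA //; have [xxA|xAx] := ltP x xA.
        by rewrite densl // subrr normr0 ltW.
      rewrite densr // -rmE.
      have l1 : rv <= rL * gz ((uL - x) / c) by rewrite /rv ler_pM2l //; apply: gz_mono; apply: zc_mono => //; exact: ltW.
      have l2 : rL * gz ((uL - x) / c) <= rm.
        by rewrite rmE ler_pM2l //; apply: le_trans (gz_le_hz _) _; apply: hz_mono; exact: zc_mono.
      rewrite ger0_norm ?subr_ge0 //; move: l1 rprv rmrp e1eta; clear; lra.
    move=> x Gx vx mx; rewrite densB //; case: (ltP x xB) => xxB.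
      rewrite densl // {1}/dens xxB; apply: le_trans e1eta.
      by have [] := FC x (ltW vx).
    rewrite densr // {1}/dens ltNge xxB /=; apply: le_trans e1eta.
    by have [] := FC xB (ltW vxB).
- have uv0 : 0 < uL - v by move: vu c0; clear; lra.
  have alE : al = rL * (uL - v) by rewrite -mA mE.
  have alp : 0 < al by rewrite alE mulr_gt0.
  have zv1' : 1 <= zv by rewrite /zv ler_pdivlMr // mul1r; move: vu; clear; lra.
  have zvZ : zv = Z by rewrite /Z; apply/esym/max_idPr.
  have uzv : uL - v = c * zv by rewrite /zv; field; rewrite gt_eqF.
  case: (rtB alp) => [[alB Bc]|[vxB alB]].
  + exists v; first by [].
    pose r1 := rL * hz zv.
    have r10 : 0 < r1 by rewrite mulr_gt0 // hz_gt0.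
    have r1K : r1 <= K by exact: KE.
    have r1E : r1 = rL * zv ^+ 2 by rewrite /r1 hz_ge1.
    have PA1 : f_P A v * r1 = al ^+ 2 + c ^+ 2 * r1 ^+ 2.
      have : f_P A v = rL * (c ^+ 2 * zv ^+ 2 + c ^+ 2).
        by apply: (mulIf (lt0r_neq0 rm0)); rewrite PA rmE alE uzv; ring.
      by move=> ->; rewrite r1E alE uzv; ring.
    have s1 : al <= c * r1.
      rewrite alE uzv r1E mulrCA ler_pM2l // ler_pM2l // expr2 -[leLHS]mulr1 ler_pM2l //.
      exact: lt_le_trans zv1'.
    have [rple h] := sub_close c0 al0 r10 rp0 PA1 PB jump de0 s1 alB.
    have cl := close2 _ _ r10 r1K h.
    exists G => //; split; first by move=> x; exact: exactA'.
    move=> x Gx vx mx; rewrite (constB Bc) // densr; last exact: ltW.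
    by rewrite distrC; exact: le_trans cl e1eta.
  + exists xB; first by apply: le_trans (ltW vxB).
    have PA1 : f_P A v * rL = al ^+ 2 + c ^+ 2 * rL ^+ 2 by rewrite -rmE.
    have s1 : c * rL <= al by rewrite alE uzv mulrCA ler_pM2l // -[leLHS]mulr1 ler_pM2l.
    have [rLrp h] := sup_close c0 al0 r0 rp0 PA1 PB jump de0 s1 alB.
    have cl := close2 _ _ r0 rK h.
    have rpe : rp <= rL + e1 by move: cl; rewrite ler_norml => /andP[+ _]; clear; lra.
    have FC y (vy : v <= y) := sup_profile_close c0 r0 vu alE rLrp rpe vy.
    rewrite -/zv zvZ e1E in FC.
    exists G => //; split; first by move=> x; apply: exactA' => //; exact: ltW.
    move=> x Gx vx mx; rewrite densB //; case: (ltP x xB) => xxB.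
      by rewrite densl // {1}/dens xxB; have [] := FC x (ltW vx).
    by rewrite densr // {1}/dens ltNge xxB /=; have [] := FC xB (ltW vxB).
(* at a sonic state the momentum flux is minimal, so that it cannot jump down *)
- exfalso; rewrite mA in mE.
  have alp : 0 < al by rewrite mE mulr_gt0.
  have := alde alp; rewrite -jump.
  have : f_P A v = 2 * c * al by apply: (mulIf (lt0r_neq0 rm0)); rewrite PA mE; ring.
  move=> ->; apply/negP; rewrite -leNgt subr_le0 -(ler_pM2r rp0) PB.
  by have := sqr_ge0 (al - c * rp); clear; lra.
Qed.

End ParticleApprox.

(** * Vanishing jump of momentum flux *)

Section Glue.
Context {R : realType}.

Lemma locbm_ifb (b : R -> bool) (f g : R -> R) : measurable_fun setT b -> locbm f -> locbm g ->
  locbm (fun x => if b x then f x else g x).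
Proof.
move=> mb [mf bf] [mg bg]; split; first exact: measurable_fun_ifT.
move=> A; have [M1 H1] := bf A; have [M2 H2] := bg A.
exists (Num.max M1 M2) => x xA; rewrite le_max.
by case: ifP => _; rewrite ?(H1 _ xA) ?(H2 _ xA) ?orbT.
Qed.

Lemma locbm_if (f g : R -> R) v : locbm f -> locbm g -> locbm (fun x => if x < v then f x else g x).
Proof. by move=> lf lg; apply: locbm_ifb => //; exact: measurable_fun_ltr. Qed.

Lemma glue_int (f g F1 F2 : R -> R) (v : R) : locbm f -> locbm g ->
  (forall x y, x <= y -> F1 x - F1 y = Iab x y f) -> (forall x y, x <= y -> F2 x - F2 y = Iab x y g) ->
  F1 v = F2 v ->
  forall x y, x <= y -> (if x < v then F1 x else F2 x) - (if y < v then F1 y else F2 y) =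
    Iab x y (fun z => if z < v then f z else g z).
Proof.
move=> lf lg H1 H2 E x y xy.
have lh := locbm_if v lf lg.
have left a b : a <= b -> b <= v -> Iab a b (fun z => if z < v then f z else g z) = Iab a b f.
  move=> ab bv; apply: (Iab_ae (@conullT R)) => // z _ /andP[_ zb].
  by rewrite ifT //; lra.
have right a b : a <= b -> v <= a -> Iab a b (fun z => if z < v then f z else g z) = Iab a b g.
  move=> ab bv; apply: (Iab_ae (@conullT R)) => // z _ /andP[zb _].
  by rewrite ifF //; apply/negbTE; rewrite -leNgt; lra.
have [xv|vx] := ltP x v; have [yv|vy] := ltP y v.
- by rewrite left ?H1 // ltW.
- have xv' := ltW xv.
  rewrite (@Iab_split _ _ x v y lh xv' vy) (left x v xv' (lexx _)) (right v y vy (lexx _)).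
  by rewrite -(H1 _ _ xv') -(H2 _ _ vy) E; ring.
- lra.
- by rewrite right ?H2.
Qed.

End Glue.

Section EulerLimit.
Context {R : realType}.

Lemma wave_unique_zero c (rho m P : R -> R) G x y : simil c rho m P G -> m x = 0 -> m y = 0 -> x = y.
Proof.
move=> S mx my; apply/eqP; rewrite eq_le; apply/andP; split; rewrite leNgt; apply/negP => /(sm_decr S); lra.
Qed.

(** The outer state has density rL, and P is continuous. *)
Lemma far_pressure (c rL uL : R) rho m P G xs x1 x : 0 < c -> simil c rho m P G ->
  left_wave c rL uL rho m G xs x1 -> x <= x1 -> x <= uL - c ->
  P x * rL = m x ^+ 2 + c ^+ 2 * rL ^+ 2.
Proof.
move=> c0 S L xx xu.
have cm := sm_mcont S; have cP := sm_Pcont S.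
pose f y := P y * rL - m y ^+ 2 - c ^+ 2 * rL ^+ 2.
have cf : continuous f.
  move=> y; apply: cvgB; last exact: cvg_cst.
  apply: cvgB; first by apply: cvgM; [exact: cP|exact: cvg_cst].
  by apply: cvgM; exact: cm.
have fG y : G y -> x - 1 < y < x -> f y = 0.
  move=> Gy /andP[_ yx].
  have E : rho y = rL.
    rewrite (lw_dens L Gy); [|have := lw_lt L; lra|by rewrite lt_eqF //; lra].
    by rewrite /dens ifT ?gz_ge1 ?mulr1 //; [rewrite ler_pdivlMr // mul1r|]; lra.
  by rewrite /f; have := sm_q S Gy; rewrite E => ->; ring.
have h1 : 0 <= f x.
  apply: (@ge0_dense _ f G (x - 1) x cf (sm_G S)); [lra| |lra].
  by move=> y Gy yy; rewrite fG.
have h2 : 0 <= - f x.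
  apply: (@ge0_dense _ (fun y => - f y) G (x - 1) x _ (sm_G S)); [|lra| |lra].
    by move=> y; apply: cvgN; exact: cf.
  by move=> y Gy yy; rewrite fG // oppr0.
rewrite /f in h1 h2; lra.
Qed.

Lemma riemann_mflow (c rL uL rR uR : R) (s : @flow R) : solves c rL uL rR uR s ->
  mflow (f_rho s) (f_m s) (f_P s).
Proof.
move=> H; have S := rm_simil H; split.
- exact: sm_loc S.
- exact: locbm_cont (sm_mcont S).
- by move=> x; exact/ltW/(rho_gt0 S).
- by move=> x y; exact: sm_m S x y.
- by move=> x y xy; exact: (simil_Pint S xy).
Qed.

Lemma pressure_ge c (rho m P : R -> R) G x : simil c rho m P G -> G x -> c ^+ 2 * rho x <= P x.
Proof.
move=> S Gx; have r0 := rho_gt0 S x.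
rewrite -(ler_pM2r r0) (sm_q S Gx).
by have := sqr_ge0 (m x); rewrite !expr2; lra.
Qed.

(** The two sides of the particle are glued into one flow, with P shifted by de on the right of v. By
[particle_approx] its density is close to that of a wave of the left outer state, hence ordered
with respect to the Euler solution up to a small error, and [flow_stability] applies. *)
Lemma euler_limit (c rL uL rR uR v eps : R) (V : @flow R) : 0 < c -> 0 < rL -> 0 < rR -> 0 < eps ->
  solves c rL uL rR uR V ->
  exists2 de0 : R, 0 < de0 & forall al de rm rp A B,
    particle c rL uL rR uR v al de rm rp A B -> 0 <= al -> (0 < al -> 0 < de) -> 0 <= de -> de <= de0 ->
    near_flow v eps A B V V.
Proof.
move=> c0 r0 rR0 eps0 hV.
have SV := rm_simil hV.
have [xsV [xV LV]] := rm_left hV; have [xsV' [xV' LV']] := rm_right hV.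
have [r' [M' [r'0 M'0 rM' _]]] := sm_slope SV.
pose b' := xsV.
have mb' : f_m V b' = 0 := lw_zero LV.
have b'E : - xsV' = b'.
  by apply: (wave_unique_zero SV) => //; have := lw_zero LV'; lra.
pose Bl := Num.min v uL - c.
pose B0 := Num.min (Num.min Bl xV) b'.
have [B01 B02 B03] : [/\ B0 <= Bl, B0 <= xV & B0 <= b'].
  by split; rewrite /B0 !ge_min ?lexx ?orbT.
have Blu : Bl <= uL - c by rewrite /Bl lerB // ge_min lexx orbT.
have Blv : Bl <= v - c by rewrite /Bl lerB // ge_min lexx.
pose K := rL * (1 + hz ((uL - Bl) / c)).
have K0 : 0 < K by rewrite mulr_gt0 //; have := hz_gt0 ((uL - Bl) / c); lra.
pose M := K + 1.
pose M1 := f_P V b' / c ^+ 2.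
have c2 : 0 < c ^+ 2 by rewrite exprn_gt0.
have M10 : 0 <= M1 by apply: divr_ge0; [have := P_ge0 c0 SV b'|exact: ltW].
pose r0' := rL * gz ((uL - (b' + 1)) / c) / 2.
have r0'0 : 0 < r0' by rewrite divr_gt0 // mulr_gt0 // gz_gt0.
pose A0 := b' - B0.
have A00 : 0 <= A0 by rewrite /A0; lra.
(* kap bounds the distance of the contacts, eta the error of the approximating wave *)
pose S := 3 * (M + M' + M1).
have S0 : 0 < S by rewrite /S /M; lra.
pose kap := eps / (2 * S).
have kap0 : 0 < kap by rewrite divr_gt0 //; lra.
have kapE : S * kap = eps / 2 by rewrite /kap; field; lra.
have rk0 : 0 < r' * kap ^+ 2 by rewrite mulr_gt0 // exprn_gt0.
pose Q := Num.min (Num.min (eps / 6) (r' * kap ^+ 2 / 4)) (Num.min (r' * kap) (Num.min (r0' * kap) (r0' / 2))).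
have min0 (x y : R) : 0 < x -> 0 < y -> 0 < Num.min x y by move=> x0 y0; rewrite lt_min x0 y0.
have Q0 : 0 < Q.
  have [e6 [k4 [r2 [k1 k2]]]] : 0 < eps / 6 /\ 0 < r' * kap ^+ 2 / 4 /\ 0 < r0' / 2 /\ 0 < r' * kap /\ 0 < r0' * kap.
    have pk := mulr_gt0 r'0 kap0; have pk' := mulr_gt0 r0'0 kap0.
    by move: eps0 rk0 r0'0 pk pk'; clear; lra.
  exact: min0 _ _ (min0 _ _ e6 k4) (min0 _ _ k1 (min0 _ _ k2 r2)).
have [Q1 Q2 [Q3 Q4 Q5]] : [/\ Q <= eps / 6, Q <= r' * kap ^+ 2 / 4 & [/\ Q <= r' * kap, Q <= r0' * kap & Q <= r0' / 2]].
  by do ?split; rewrite /Q !ge_min lexx ?orbT.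
pose Y := A0 + A0 ^+ 2 + 1.
have Y1 : 1 <= Y by rewrite /Y; have := sqr_ge0 A0; lra.
pose eta := Num.min (Num.min 1 r0') (Q / Y).
have Y0 : 0 < Y by apply: lt_le_trans Y1; exact: ltr01.
have eta0 : 0 < eta by exact: min0 _ _ (min0 _ _ ltr01 r0'0) (divr_gt0 Q0 Y0).
have [t1 t2 t3] : [/\ eta <= 1, eta <= r0' & eta <= Q / Y].
  by do ?split; rewrite /eta !ge_min lexx ?orbT.
have etaY : eta * Y <= Q by rewrite -ler_pdivlMr.
have eA : eta * A0 <= Q.
  apply: le_trans etaY; rewrite ler_pM2l // /Y; have := sqr_ge0 A0; lra.
have eA2 : eta * A0 ^+ 2 <= Q by apply: le_trans etaY; rewrite ler_pM2l // /Y; lra.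
have [de1 de10 Happ] := particle_approx uL v c0 r0 eta0.
exists (Num.min de1 (r' * kap ^+ 2 / 2)); first by rewrite lt_min de10 divr_gt0.
move=> al de rm rp A B pt al0 alde de0; rewrite le_min => /andP[dd1 dd2].
have [x1 x1B [G cG [GA GB]]] := Happ _ _ _ _ _ _ _ _ pt al0 alde de0 dd1.
have [hA hB rm0 rp0 mA mB PA PB tA tB jump pos _] := pt.
have SA := rm_simil hA; have SB := rm_simil hB.
have [xsA [xA LA]] := rm_left hA; have [xsB [xB LB]] := rm_right hB.
have vA : v <= xsA.
  by rewrite leNgt; apply/negP => /(sm_decr SA); rewrite (lw_zero LA) mA ltNge al0.
have startA : Bl <= xA by exact: left_start c0 r0 SA LA vA.
pose b := - xsB.
have mb : f_m B b = 0 by apply: oppr_inj; rewrite oppr0; exact: lw_zero LB.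
have vb : v <= b.
  by rewrite leNgt; apply/negP => /(sm_decr SB); rewrite mb mB ltNge al0.
have mBpos x : x < b -> 0 < f_m B x by move=> xb; rewrite -mb; exact: sm_decr SB _ _ xb.
have FA := riemann_mflow hA; have FB := riemann_mflow hB; have FV := riemann_mflow hV.
pose rho x := if x < v then f_rho A x else f_rho B x.
pose m x := if x < v then f_m A x else f_m B x.
pose P x := if x < v then f_P A x else f_P B x + de.
have F : mflow rho m P.
  split.
  - exact: locbm_if (mf_loc FA) (mf_loc FB).
  - exact: locbm_if (mf_mloc FA) (mf_mloc FB).
  - by move=> x; rewrite /rho; case: ifP => _; [exact: (mf_ge0 FA)|exact: (mf_ge0 FB)].
  - apply: glue_int; [exact: mf_loc FA|exact: mf_loc FB|exact: mf_m FA|exact: mf_m FB|].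
    by rewrite mA mB.
  - move=> x y xy.
    have -> : (fun z => 2 * m z) = (fun z => if z < v then 2 * f_m A z else 2 * f_m B z).
      by apply/funext => z; rewrite /m; case: ifP.
    rewrite /P; apply: (@glue_int _ _ _ (f_P A) (fun z => f_P B z + de)) => //.
    + exact: locbmM (locbm_cst _) (mf_mloc FA).
    + exact: locbmM (locbm_cst _) (mf_mloc FB).
    + exact: mf_P FA.
    + by move=> z w zw; rewrite -(mf_P FB zw); ring.
    + by rewrite -jump; ring.
have rightE x : v <= x -> [/\ rho x = f_rho B x, m x = f_m B x & P x = f_P B x + de].
  by move=> vx; rewrite /rho /m /P ltNge vx.
have leftE x : x < v -> [/\ rho x = f_rho A x, m x = f_m A x & P x = f_P A x].
  by move=> vx; rewrite /rho /m /P vx.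
pose H := G `&` f_G A `&` f_G B `&` f_G V `&` [set x | x <> v] `&` [set x | x <> xV] `&` [set x | x <> xA].
have cH : conull H.
  by do !apply: conullI => //; [exact: sm_G SA|exact: sm_G SB|exact: sm_G SV|exact: conullD1|exact: conullD1|exact: conullD1].
have approx x : H x -> x < b -> `|rho x - dens c rL uL x1 x| <= eta.
  move=> [[[[[[Gx _] _] _] /eqP nv] _] _] xb.
  have [xv|vx] := ltP x v; first by have [-> _ _] := leftE x xv; exact: GA.
  have [-> _ _] := rightE x vx; apply: GB => //; last exact: mBpos.
  by rewrite lt_neqAle eq_sym nv.
have VE x : H x -> x < b' -> f_rho V x = dens c rL uL xV x.
  by move=> [[[[_ gV] _] /eqP nV] _] xb; apply: (lw_dens LV).
have B0v : B0 < v by move: B01 Blv c0; clear; lra.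
have B0b : B0 <= b by move: B0v vb; clear; lra.
have B0u : B0 <= uL - c by exact: le_trans B01 Blu.
have B0A : B0 <= xA by exact: le_trans B01 startA.
have farA x : x <= B0 -> f_m A x = f_m V x.
  move=> xB0; have xu := le_trans xB0 B0u.
  by rewrite (lw_sup LA (le_trans xB0 B0A) xu) (lw_sup LV (le_trans xB0 B02) xu).
have mB0 : m B0 = f_m V B0 by have [_ -> _] := leftE B0 B0v; exact: farA.
have PB0 : P B0 = f_P V B0.
  have [_ _ ->] := leftE B0 B0v; apply: (mulIf (lt0r_neq0 r0)).
  rewrite (far_pressure c0 SA LA B0A B0u).
  by rewrite (far_pressure c0 SV LV B02 B0u) farA.
have rhofar x : H x -> x < B0 -> f_rho A x = f_rho V x.
  move=> [[[[[[_ gA] _] gV] _] /eqP nV] /eqP nA] xB0.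
  have [k1 k2] := (lt_le_trans xB0 B0A, lt_le_trans xB0 B02).
  rewrite (lw_dens LA gA (lt_trans k1 (lw_lt LA)) nA).
  by rewrite (lw_dens LV gV (lt_trans k2 (lw_lt LV)) nV) /dens k1 k2.
have main d : b <= d -> b' <= d -> Iab B0 d (fun x => `|rho x - f_rho V x|) <= eps.
  move=> bd b'd.
  apply: (@le_trans _ _ (3 * eta * A0 + S * kap)); last first.
    by move: eA Q1; rewrite kapE -mulrA; clear; lra.
  apply: (@flow_stability _ H rho m P (f_rho V) (f_m V) (f_P V) b b' B0 eta de kap r' M' M M1 r0') => //.
  - by have [_ -> _] := rightE b vb.
  - have [h|h] := leP x1 xV; [left|right] => x Hx /andP[_]; rewrite lt_min => /andP[xb xb'].
      have := approx x Hx xb; rewrite (VE x Hx xb') ler_norml => /andP[h1 _].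
      by have := @dens_mono _ c rL uL x1 xV x c0 r0 h; move: h1; clear; lra.
    have := approx x Hx xb; rewrite (VE x Hx xb') ler_norml => /andP[_ h1].
    by have := @dens_mono _ c rL uL xV x1 x c0 r0 (ltW h); move: h1; clear; lra.
  - move=> a ba b'a.
    have va := le_trans vb ba.
    have [_ -> ->] := rightE a va.
    have b'a' : - xsV' <= a by rewrite b'E.
    have [k1 k2 k3 k4] := @right_cmp _ _ _ _ _ _ _ _ _ _ _ _ _ _ _ _ a c0 rR0 SB SV LB LV' ba b'a'.
    split.
    + by move=> h; have := k1 h; clear; lra.
    + by move=> h; have := k2 h; clear; lra.
    + move=> d' ad'; apply: le_trans (k4 d' ad').
      rewrite (@Iab_ae _ setT _ (fun x => `|f_rho B x - f_rho V x|)) //; first exact: conullT.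
      * exact: locbm_norm (locbmB (mf_loc F) (mf_loc FV)).
      * exact: locbm_norm (locbmB (mf_loc FB) (mf_loc FV)).
      * by move=> x _ /andP[ax _]; have [-> _ _] := rightE x (le_trans va (ltW ax)).
  - move=> x Hx /andP[_ xb]; have := approx x Hx xb; rewrite ler_norml => /andP[_ h1].
    by have := @dens_le _ c rL uL x1 x Bl c0 r0 x1B; rewrite -/K /M; move: h1 t1; clear; lra.
  - move=> x Hx /andP[bx xb'].
    have [-> _ _] := rightE x (le_trans vb (ltW bx)).
    rewrite /M1 ler_pdivlMr // mulrC.
    have gB : f_G B x by case: Hx => [[[[[_ ?] _] _] _] _].
    apply: le_trans (pressure_ge SB gB) _.
    have bb' : b <= b' by exact/ltW/(lt_trans bx).
    have b'' : - xsV' <= b' by rewrite b'E.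
    have [_ k2 _ _] := @right_cmp _ _ _ _ _ _ _ _ _ _ _ _ _ _ _ _ b' c0 rR0 SB SV LB LV' bb' b''.
    have mb'0 : f_m B b' <= f_m V b' by rewrite mb' -mb; exact: sm_ndecr SB _ _ bb'.
    apply: le_trans (k2 mb'0).
    rewrite -subr_le0 (mf_P FB (ltW xb')).
    have -> : 0 = 0 * (b' - x) by rewrite mul0r.
    apply: (Iab_bndr (@conullT R)); [exact: locbmM (locbm_cst _) (mf_mloc FB)|exact: ltW|].
    by move=> z _ /andP[z1 _]; have := sm_ndecr SB (ltW (lt_trans bx z1)); rewrite mb; clear; lra.
  - move=> x Hx /andP[_ xb] xb'; have := approx x Hx xb; rewrite ler_norml => /andP[h1 _].
    have h2 := @dens_ge _ c rL uL x1 x c0 r0.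
    have h3 : rL * gz ((uL - (b' + 1)) / c) <= rL * gz ((uL - x) / c).
      by rewrite ler_pM2l //; apply: gz_mono; apply: zc_mono => //; exact: ltW.
    have h4 : rL * gz ((uL - (b' + 1)) / c) = 2 * r0' by rewrite /r0'; field.
    by move: h1 h2 h3 h4 t2; clear; lra.
  - exact: ltW.
  - exact: ltW.
  - by move: K0; rewrite /M; clear; lra.
  - by rewrite -/A0; move: eA2 Q2 dd2; clear; lra.
  - by rewrite -/A0; exact: le_trans Q3.
  - by rewrite -/A0; exact: le_trans Q4.
  - by rewrite -/A0; apply: le_lt_trans (le_trans eA Q5) _; move: r0'0; clear; lra.
have lab : locbm (fun x => `|rho x - f_rho V x|) by exact: locbm_norm (locbmB (mf_loc F) (mf_loc FV)).
have lA : locbm (fun x => `|f_rho A x - f_rho V x|) by exact: locbm_norm (locbmB (mf_loc FA) (mf_loc FV)).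
have lB : locbm (fun x => `|f_rho B x - f_rho V x|) by exact: locbm_norm (locbmB (mf_loc FB) (mf_loc FV)).
have nn (f : R -> R) x y : 0 <= Iab x y (fun z => `|f z|) by apply: Rintegral_ge0 => z _.
pose dd y := Num.max (Num.max b b') (Num.max v y).
have ddP y : [/\ b <= dd y, b' <= dd y, v <= dd y & y <= dd y].
  by split; rewrite /dd !le_max lexx ?orbT.
have total x y : x <= y -> Iab x y (fun z => `|rho z - f_rho V z|) <= eps.
  move=> xy; have [d1 d2 d3 d4] := ddP y.
  pose L := Num.min x B0.
  have [L1 L2] : L <= x /\ L <= B0 by split; rewrite /L ge_min lexx ?orbT.
  have E : Iab L (dd y) (fun z => `|rho z - f_rho V z|) = Iab B0 (dd y) (fun z => `|rho z - f_rho V z|).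
    rewrite (Iab_split lab L2 (le_trans B0b d1)).
    rewrite (_ : Iab L B0 _ = 0) ?add0r //.
    transitivity (Iab L B0 (fun=> 0 : R)); last by rewrite Iab_cst // mul0r.
    apply: (Iab_ae cH) => //; first exact: locbm_cst.
    move=> z Hz /andP[_ zB]; have [-> _ _] := leftE z (lt_trans zB B0v).
    by rewrite (rhofar z Hz zB) subrr normr0.
  have := main (dd y) d1 d2; rewrite -E (Iab_split lab L1 (le_trans xy d4)).
  rewrite (Iab_split lab xy d4).
  by have := nn (fun z => rho z - f_rho V z) L x; have := nn (fun z => rho z - f_rho V z) y (dd y); clear; lra.
have mall x : `|m x - f_m V x| <= eps.
  have [xB0|Bx] := leP x B0.
    have [_ -> _] := leftE x (le_lt_trans xB0 B0v); rewrite farA // subrr normr0; exact: ltW.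
  have -> : m x - f_m V x = - Iab B0 x (fun z => rho z - f_rho V z).
    rewrite IabB; [|exact: mf_loc F|exact: mf_loc FV].
    by rewrite -(mf_m F (ltW Bx)) -(mf_m FV (ltW Bx)) mB0; ring.
  rewrite normrN; apply: le_trans (Iab_norm _ _ (locbmB (mf_loc F) (mf_loc FV))) _.
  exact: total (ltW Bx).
split.
- move=> x y xy yv; rewrite (@Iab_ae _ setT _ (fun x => `|rho x - f_rho V x|)) //; first exact: total.
    exact: conullT.
  by move=> z _ /andP[_ zy]; have [-> _ _] := leftE z (lt_le_trans zy yv).
- move=> x y vx xy; rewrite (@Iab_ae _ setT _ (fun x => `|rho x - f_rho V x|)) //; first exact: total.
    exact: conullT.
  by move=> z _ /andP[xz _]; have [-> _ _] := rightE z (le_trans vx (ltW xz)).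
- move=> x; rewrite le_eqVlt => /predU1P[->|xv]; last by have := mall x; have [_ -> _] := leftE x xv.
  by have := mall v; have [_ -> _] := rightE v (lexx _); rewrite mA mB.
- by move=> x vx; have := mall x; have [_ -> _] := rightE x vx.
Qed.

End EulerLimit.

(** * Vanishing mass flux through the particle *)

Section WallLimit.
Context {R : realType}.

(** If rp is sonic, it starts a fan along which m = c rho, up to the transition. *)
Lemma sub_behind (c rp v al : R) rho m P G xs x1 : 0 < c -> 0 < rp ->
  simil c rho m P G -> left_wave c rp (v + al / rp) rho m G xs x1 -> v < xs -> m v = al ->
  (forall e, 0 < e -> exists2 d, 0 < d & forall x, v < x < v + d -> `|rho x - rp| <= e) ->
  al <= c * rp -> forall x, G x -> v < x < xs -> x != x1 -> m x <= c * rho x.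
Proof.
move=> c0 r0 S L vx mv tr alc x Gx /andP[vx' xxs] nx.
have [[_ H]|[vx1 alc']] := right_trace c0 r0 S L vx tr.
  rewrite H ?vx' ?xxs //; apply: le_trans alc; rewrite -mv.
  exact/ltW/(sm_decr S).
have E : al = c * rp by apply/le_anti; rewrite alc alc'.
have uc : v + al / rp - c = v by rewrite E; field; rewrite gt_eqF.
rewrite (lw_dens L Gx xxs nx) /dens; case: ltP => h.
  by rewrite (lw_fan L _ (ltW h)) // uc ltW.
apply: le_trans (sm_ndecr S h) _.
exact: wave_edge L.
Qed.

(** Upstream, the L^1 distance is the difference al of the mass fluxes at v. Downstream the flow is
subsonic, so P <= 2 c^2 rho, while P is at least the wall pressure P0: the mass flux al is
exhausted within the distance C al with C = 2 c^2 / P0. Past the contact the right waves are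
compared. *)
Lemma wall_limit (c rL uL rR uR v de' rm' rp' eps : R) (VA VB : @flow R) : 0 < c -> 0 < rL -> 0 < rR -> 0 < eps ->
  particle c rL uL rR uR v 0 de' rm' rp' VA VB ->
  exists2 al0 : R, 0 < al0 & forall al de rm rp A B,
    particle c rL uL rR uR v al de rm rp A B -> 0 <= al -> al <= al0 ->
    near_flow v eps A B VA VB.
Proof.
move=> c0 r0 rR0 eps0 ptV.
have [hVA hVB _ rp'0 mVA mVB _ PVB _ _ _ _ _] := ptV.
have SVA := rm_simil hVA; have SVB := rm_simil hVB.
have [xsVA [xVA LVA]] := rm_left hVA; have [xsVB [xVB LVB]] := rm_right hVB.
have xsVAE : xsVA = v by apply: (wave_unique_zero SVA) => //; exact: lw_zero LVA.
have xsVBE : - xsVB = v.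
  by apply: (wave_unique_zero SVB) => //; apply: oppr_inj; rewrite oppr0; exact: lw_zero LVB.
have [r' [M' [r'0 M'0 rM' _]]] := sm_slope SVB.
pose P0 := f_P VB v.
have P00 : 0 < P0.
  have : 0 < P0 * rp' by rewrite PVB expr0n add0r mulr_gt0 // exprn_gt0.
  by rewrite pmulr_lgt0.
pose C := 2 * c ^+ 2 / P0.
have c2 : 0 < c ^+ 2 by rewrite exprn_gt0.
have C0 : 0 < C by rewrite divr_gt0 // mulr_gt0.
pose K := 1 + 2 * M' * C.
have MC : 0 <= M' * C by rewrite mulr_ge0 // ltW.
have K1 : 1 <= K by move: MC; rewrite /K -mulrA; clear; lra.
have K0 : 0 < K := lt_le_trans ltr01 K1.
exists (Num.min (c * rL / 2) (eps / K)).
  by rewrite lt_min; apply/andP; split; apply: divr_gt0 => //; exact: mulr_gt0.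
move=> al de rm rp A B pt al0; rewrite le_min => /andP[al1 al2].
have alK : al * K <= eps by rewrite -ler_pdivlMr.
have ale : al <= eps.
  have := ler_wpM2l al0 K1; by rewrite mulr1 => /le_trans; apply.
have [hA hB rm0 rp0 mA mB PA PB tA tB jump pos _] := pt.
have SA := rm_simil hA; have SB := rm_simil hB.
have FA := riemann_mflow hA; have FB := riemann_mflow hB.
have FVA := riemann_mflow hVA; have FVB := riemann_mflow hVB.
have [xsA [xA LA]] := rm_left hA; have [xsB [xB LB]] := rm_right hB.
have vA : v <= xsA.
  by rewrite leNgt; apply/negP => /(sm_decr SA); rewrite (lw_zero LA) mA ltNge al0.
pose b := - xsB.
have mb : f_m B b = 0 by apply: oppr_inj; rewrite oppr0; exact: lw_zero LB.
have vb : v <= b.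
  by rewrite leNgt; apply/negP => /(sm_decr SB); rewrite mb mB ltNge al0.
have vVA : v <= xsVA by rewrite xsVAE.
have [_ _ h3 h4] := left_cmp c0 r0 SA SVA LA LVA vA vVA.
rewrite mA mVA subr0 (ger0_norm al0) in h3 h4.
have nn (f : R -> R) x y : 0 <= Iab x y (fun z => `|f z|) by apply: Rintegral_ge0 => z _.
have lA : locbm (fun x => `|f_rho A x - f_rho VA x|) by exact: locbm_norm (locbmB (mf_loc FA) (mf_loc FVA)).
have lB : locbm (fun x => `|f_rho B x - f_rho VB x|) by exact: locbm_norm (locbmB (mf_loc FB) (mf_loc FVB)).
have bB : - xsB <= b by rewrite /b.
have bVB : - xsVB <= b by rewrite xsVBE.
have mVBb : f_m VB b <= 0 by rewrite -mVB; exact: sm_ndecr SVB _ _ vb.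
have [_ k2 k3 k4] := right_cmp c0 rR0 SVB SB LVB LB bVB bB.
rewrite mb subr0 (ler0_norm mVBb) in k3 k4.
have PBb : P0 <= f_P B b.
  apply: le_trans (k2 _); last by rewrite mb.
  rewrite -subr_le0 (mf_P FVB vb).
  have -> : 0 = 0 * (b - v) by rewrite mul0r.
  apply: (Iab_bndr (@conullT R)); [exact: locbmM (locbm_cst _) (mf_mloc FVB)|exact: vb|].
  move=> z _ /andP[z1 _]; have := sm_ndecr SVB (ltW z1); rewrite mVB; clear; lra.
have bv : (b - v) <= C * al.
  move: vb; rewrite le_eqVlt => /predU1P[<-|vb]; first by rewrite subrr mulr_ge0 // ltW.
  have al0' : 0 < al by rewrite -mB -mb; exact: sm_decr SB _ _ vb.
  have alc : al <= c * rp.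
    apply: pos => //.
    have [[_ [_]]|[_ vu [_]]|[_ _]] := left_trace c0 r0 SA LA vA tA; rewrite mA.
    - exact: ltW.
    - move=> E; exfalso; have : c * rL <= al.
        by rewrite E mulrC ler_pM2l //; move: vu; clear; lra.
      have : 0 < c * rL by rewrite mulr_gt0.
      by move: al1; clear; lra.
    - by move=> ->.
  have [xs [x1 L1]] := rm_left hB.
  have xsE : xs = b by apply: (wave_unique_zero SB) => //; exact: lw_zero L1.
  have sub := @sub_behind _ _ _ _ _ _ _ _ _ _ c0 rp0 SB L1 (ltac:(rewrite xsE; exact: vb)) mB tB alc.
  have dB : P0 / (2 * c ^+ 2) * (b - v) <= al.
    have -> : al = f_m B v - f_m B b by rewrite mB mb subr0.
    rewrite (mf_m FB (ltW vb)).
    apply: (@Iab_bndl _ (f_G B `&` [set x | x <> x1])); [|exact: mf_loc FB|exact: ltW|].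
      by apply: conullI; [exact: sm_G SB|exact: conullD1].
    move=> x [Gx /eqP nx] /andP[vx xb].
    have mx := sub x Gx (ltac:(by rewrite vx xsE xb)) nx.
    have mx0 : 0 <= f_m B x by rewrite -mb; exact: sm_ndecr SB _ _ (ltW xb).
    have rx := rho_gt0 SB x.
    have Px : f_P B b <= f_P B x.
      rewrite -subr_ge0 (mf_P FB (ltW xb)).
      have -> : 0 = 0 * (b - x) by rewrite mul0r.
      apply: (Iab_bndl (@conullT R)); [exact: locbmM (locbm_cst _) (mf_mloc FB)|exact: ltW|].
      by move=> z _ /andP[_ z1]; have := sm_ndecr SB (ltW z1); rewrite mb; clear; lra.
    rewrite ler_pdivrMr ?mulr_gt0 //.
    apply: le_trans PBb _; apply: le_trans Px _.
    rewrite -(ler_pM2r rx) (sm_q SB Gx).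
    have : f_m B x ^+ 2 <= (c * f_rho B x) ^+ 2.
      by apply: lerXn2r => //; rewrite nnegrE // mulr_ge0 // ltW.
    rewrite exprMn !expr2; clear; lra.
  have -> : b - v = C * (P0 / (2 * c ^+ 2) * (b - v)).
    by rewrite /C; field; rewrite !gt_eqF.
  by rewrite ler_pM2l.
have mVBb' : - f_m VB b <= M' * (C * al).
  have -> : - f_m VB b = Iab v b (f_rho VB) by rewrite -(mf_m FVB vb) mVB sub0r.
  apply: (@le_trans _ _ (M' * (b - v))); last by rewrite ler_pM2l.
  apply: (Iab_bndr (@conullT R)); [exact: mf_loc FVB|exact: vb|].
  by move=> z _ _; have /andP[] := rM' z.
have tot : al + 2 * (- f_m VB b) <= eps.
  by apply: le_trans alK; move: mVBb'; rewrite /K !mulrDr; clear; lra.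
have head : Iab v b (fun x => `|f_rho B x - f_rho VB x|) <= al - f_m VB b.
  have := Iab_absB FB FVB vb; rewrite mB mb mVB; clear; lra.
have total x y : v <= x -> x <= y -> Iab x y (fun x => `|f_rho B x - f_rho VB x|) <= eps.
  move=> vx xy; pose d := Num.max b y.
  have [bd yd] : b <= d /\ y <= d by rewrite /d !le_max !lexx ?orbT.
  have := k4 d bd.
  rewrite (_ : Iab b d _ = Iab b d (fun x => `|f_rho B x - f_rho VB x|)); last first.
    by congr Iab; apply/funext => z; exact: distrC.
  have := nn (fun z => f_rho B z - f_rho VB z) v x.
  have := nn (fun z => f_rho B z - f_rho VB z) y d.
  have := Iab_split lB vx (le_trans xy yd); have := Iab_split lB xy yd.
  have := Iab_split lB vb bd.
  by move: head tot; clear; lra.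
split.
- move=> x y xy yv; have := h4 x (le_trans xy yv).
  rewrite (Iab_split lA xy yv); have := nn (fun z => f_rho A z - f_rho VA z) y v.
  by move: ale; clear; lra.
- exact: total.
- by move=> x xv; exact: le_trans (h3 x xv) ale.
- move=> x vx; have [bx|xb] := leP b x.
    have := k3 x bx; rewrite distrC; move: tot mVBb al0; clear; lra.
  have := sm_ndecr SVB vx; have := sm_ndecr SVB (ltW xb); have := sm_ndecr SB vx; have := sm_ndecr SB (ltW xb).
  rewrite mb mB mVB => i1 i2 i3 i4; rewrite ler_norml.
  by apply/andP; move: i1 i2 i3 i4 tot mVBb al0; clear; split; lra.
Qed.

(** Among the flows with the same left state, and al >= 0, a wall has the highest pressure. *)
Lemma wall_jump (c rL uL rR uR v de' rm' rp' al de rm rp : R) (VA VB A B : @flow R) : 0 < c -> 0 < rL ->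
  particle c rL uL rR uR v 0 de' rm' rp' VA VB ->
  particle c rL uL rR uR v al de rm rp A B -> 0 <= al -> de <= f_P VA v.
Proof.
move=> c0 r0 ptV pt al0.
have hVA := pt_A ptV; have hA := pt_A pt; have hB := pt_B pt.
have SVA := rm_simil hVA; have SA := rm_simil hA; have SB := rm_simil hB.
have [xsVA [xVA LVA]] := rm_left hVA; have [xsA [xA LA]] := rm_left hA.
have vVA : v <= xsVA.
  by rewrite leNgt; apply/negP => /(sm_decr SVA); rewrite (lw_zero LVA) (pt_mA ptV) ltxx.
have vA : v <= xsA.
  by rewrite leNgt; apply/negP => /(sm_decr SA); rewrite (lw_zero LA) (pt_mA pt) ltNge al0.
have [_ h _ _] := left_cmp c0 r0 SA SVA LA LVA vA vVA.
rewrite -(pt_jump pt); apply: (@le_trans _ _ (f_P A v)).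
  by have := P_ge0 c0 SB v; clear; lra.
by apply: h; rewrite (pt_mA pt) (pt_mA ptV).
Qed.

(** m is nonincreasing, and it is explicit on the left of all waves. *)
Lemma flux_bound (c rL uL rR uR v al de rm rp : R) (A B : @flow R) : 0 < c -> 0 < rL ->
  particle c rL uL rR uR v al de rm rp A B -> 0 <= al -> al <= rL * (uL - (Num.min v uL - c)).
Proof.
move=> c0 r0 pt al0; have hA := pt_A pt; have SA := rm_simil hA.
have [xsA [xA LA]] := rm_left hA.
have vA : v <= xsA.
  by rewrite leNgt; apply/negP => /(sm_decr SA); rewrite (lw_zero LA) (pt_mA pt) ltNge al0.
have st := left_start c0 r0 SA LA vA.
set L := Num.min v uL - c in st *.
have [Lv Lu] : L <= v /\ L <= uL - c.
  have h1 : Num.min v uL <= v by rewrite ge_min lexx.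
  have h2 : Num.min v uL <= uL by rewrite ge_min lexx orbT.
  by rewrite /L; move: h1 h2 c0; clear; split; lra.
by rewrite -(lw_sup LA st Lu) -(pt_mA pt); exact: sm_ndecr SA _ _ Lv.
Qed.

End WallLimit.

(** * The germ as a jump relation *)

Section Germ.
Context {R : realType}.
Local Notation mu := (@lebesgue_measure R).
Local Notation state := (R * R)%type.

Definition mom_flux (c al r : R) : R := al ^+ 2 / r + c ^+ 2 * r.

Lemma mom_flux_derive (c al k x : R) : 0 < x ->
  is_derive x (1 : R) (fun r : R => k * mom_flux c al r) (k * (c ^+ 2 - al ^+ 2 / x ^+ 2)).
Proof.
move=> x0; have xn : x != 0 by rewrite gt_eqF.
have d1 := is_deriveV (f := id) xn (is_derive_id x 1).
have d2 := is_deriveZ (c ^+ 2) (is_derive_id x (1 : R)).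
have d3 := is_deriveZ (al ^+ 2) d1.
have d4 := is_deriveZ k (is_deriveD d3 d2).
refine (is_derive_eq d4 _).
by rewrite /GRing.scale /=; field.
Qed.

Lemma mom_flux_int (c al k a b : R) : 0 < a -> a <= b ->
  \int[mu]_(r in `[a, b]) (k * (c ^+ 2 - al ^+ 2 / r ^+ 2)) = k * mom_flux c al b - k * mom_flux c al a.
Proof.
move=> a0; rewrite le_eqVlt => /predU1P[<-|ab].
  by rewrite set_itv1 Rintegral_set1 subrr.
have pos x : x \in `[a, b] -> 0 < x by rewrite in_itv /= => /andP[h _]; exact: lt_le_trans h.
have dF (x : R) : 0 < x -> derivable (fun r : R => k * mom_flux c al r) x 1.
  by move=> x0; have [] := mom_flux_derive c al k x0.
have cF (x : R) : 0 < x -> {for x, continuous (fun r : R => k * mom_flux c al r)}.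
  by move=> x0; apply/differentiable_continuous/derivable1_diffP; exact: dF.
rewrite /Rintegral (@continuous_FTC2 _ _ (fun r : R => k * mom_flux c al r)) //.
- apply: continuous_in_subspaceT => x; rewrite inE /= => /pos x0.
  apply: cvgM; first exact: cvg_cst.
  apply: cvgB; first exact: cvg_cst.
  apply: cvgM; first exact: cvg_cst.
  apply: cvgV; first by rewrite expf_neq0 // gt_eqF.
  exact: exprn_continuous.
- split.
  + by move=> x xab; apply: dF; apply: pos; exact: subset_itv_oo_cc xab.
  + by apply: cvg_at_right_filter; apply: cF.
  + by apply: cvg_at_left_filter; apply: cF; exact: lt_trans ab.
- move=> x xab; rewrite derive1E.
  have x0 : 0 < x by apply: pos; exact: subset_itv_oo_cc xab.
  by have [_ ->] := mom_flux_derive c al k x0.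
Qed.

(** The integrand is the derivative in r of the momentum flux, divided by the drag. *)
Lemma germ_FE (c al r : R) (D : R -> R) : 0 < c -> al != 0 -> 0 < r ->
  germ_F c D al r = (mom_flux c al r - mom_flux c al (`|al| / c)) / `|D al|.
Proof.
move=> c0 al0 r0; have a0 : 0 < `|al| / c by rewrite divr_gt0 // normr_gt0.
rewrite /germ_F /oriented_integral; case: leP => h.
  by rewrite mom_flux_int //; ring.
by rewrite mom_flux_int ?(ltW h) //; ring.
Qed.

Lemma mom_flux_min (c al r : R) : 0 < c -> 0 < r -> 2 * c * al <= mom_flux c al r.
Proof.
move=> c0 r0; rewrite -subr_ge0.
have -> : mom_flux c al r - 2 * c * al = (al - c * r) ^+ 2 / r.
  by rewrite /mom_flux; field; rewrite gt_eqF.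
by rewrite divr_ge0 ?sqr_ge0 // ltW.
Qed.

(** Each relation on F_alpha is a difference of momentum fluxes. In the two shock cases the densities
rho and al^2 / (c^2 rho) on the sides of the shock have the same momentum flux, and theta and
1 - theta add up to the whole jump. The sonic state minimizes the momentum flux, so that a flow
which enters sonic cannot lose momentum. *)
Lemma germ_jump (c lam v : R) (D0 : R -> R) (Um Up : state) : 0 < c -> 0 < lam -> drag_force D0 ->
  germ c (fun a => lam * D0 a) v Um Up ->
  let al := Um.2 - v * Um.1 in
  [/\ al = Up.2 - v * Up.1,
      mom_flux c al Um.1 - mom_flux c al Up.1 = lam * D0 al,
      (0 < al -> al <= c * Um.1 -> al <= c * Up.1) &
      (al < 0 -> - al <= c * Up.1 -> - al <= c * Um.1)].
Proof.
case: Um Up => [rm qm] [rp qp] c0 lam0 [_ _ D00 Dp Dn] [] /=.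
set al := qm - v * rm => rm0 rp0 E H.
pose D a := lam * D0 a.
have FE r : al != 0 -> 0 < r -> `|D al| * germ_F c D al r = mom_flux c al r - mom_flux c al (`|al| / c).
  move=> al0 r0; rewrite germ_FE //; field.
  rewrite normr_eq0; apply: mulf_neq0; first by rewrite gt_eqF.
  by move: al0; rewrite neq_lt => /orP[/Dn|/Dp] h; [rewrite lt_eqF|rewrite gt_eqF].
have DP : 0 < al -> `|D al| = lam * D0 al by move=> h; rewrite gtr0_norm // mulr_gt0 // Dp.
have DN : al < 0 -> `|D al| = - (lam * D0 al).
  by move=> h; rewrite ltr0_norm // pmulr_rlt0 // Dn.
have sq r : 0 < r -> mom_flux c al (al ^+ 2 / (c ^+ 2 * r)) = mom_flux c al r \/ al = 0.
  move=> r0; have [->|al0] := eqVneq al 0; [by right|left].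
  by rewrite /mom_flux; field; rewrite al0 !gt_eqF.
have jump : mom_flux c al rm - mom_flux c al rp = lam * D0 al.
  case: H => [[a0 <- _]|[a0 _ h]|[a0 _ h]|[[h1 h2 [r [th [/andP[hr hr'] _ e1 e2]]]]|[h1 h2 [r [th [/andP[hr hr'] _ e1 e2]]]]]].
  - by rewrite a0 D00 mulr0 subrr.
  - have an : al != 0 by rewrite gt_eqF.
    have := congr1 (fun z => `|D al| * z) h; rewrite mulrBr !FE // mulr1 DP // => <-; ring.
  - have an : al != 0 by rewrite lt_eqF.
    have := congr1 (fun z => `|D al| * z) h; rewrite mulrBr !FE // mulr1 DN // => h'.
    by apply: oppr_inj; rewrite -h'; ring.
  - have a0 : 0 < al by apply: lt_trans h1; exact: mulr_gt0.
    have an : al != 0 by rewrite gt_eqF.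
    have r0 : 0 < r by exact: lt_le_trans hr.
    have r'0 : 0 < al ^+ 2 / (c ^+ 2 * r) by rewrite divr_gt0 ?mulr_gt0 ?exprn_gt0.
    have := congr1 (fun z => `|D al| * z) e1; have := congr1 (fun z => `|D al| * z) e2.
    rewrite !mulrBr !FE // mulr1 DP //.
    have [->|z0] := sq r r0; last by rewrite z0 ltxx in a0.
    by move=> i1 i2; have := congr2 +%R i1 i2; rewrite subrK => <-; ring.
  - have a0 : al < 0 by apply: lt_le_trans h1 _; rewrite oppr_le0 ltW // mulr_gt0.
    have an : al != 0 by rewrite lt_eqF.
    have r0 : 0 < r by exact: lt_le_trans hr.
    have r'0 : 0 < al ^+ 2 / (c ^+ 2 * r).
      by apply: divr_gt0; [rewrite exprn_even_gt0 //= an|apply: mulr_gt0 => //; exact: exprn_gt0].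
    have := congr1 (fun z => `|D al| * z) e1; have := congr1 (fun z => `|D al| * z) e2.
    rewrite !mulrBr !FE // mulr1 DN //.
    have [->|z0] := sq r r0; last by rewrite z0 ltxx in a0.
    move=> i1 i2; have := congr2 +%R i1 i2; rewrite subrK => h.
    by apply: oppr_inj; rewrite -h; ring.
have side r r' : 0 < r -> 0 < r' -> 0 <= (`|al| / c - r') * (`|al| / c - r) -> `|al| <= c * r ->
    (`|al| = c * r -> mom_flux c al r <= mom_flux c al r' -> False) -> `|al| <= c * r'.
  move=> r0 r'0 h; rewrite le_eqVlt => /predU1P[e|l] k.
    exfalso; apply: (k e).
    have sqE s : mom_flux c al s = mom_flux c `|al| s by rewrite /mom_flux real_normK // num_real.
    rewrite !sqE; apply: le_trans (mom_flux_min `|al| c0 r'0).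
    by rewrite e /mom_flux le_eqVlt; apply/orP; left; apply/eqP; field; rewrite gt_eqF.
  have : `|al| / c - r < 0 by rewrite subr_lt0 ltr_pdivrMr // mulrC.
  move=> n; move: h; rewrite nmulr_lge0 // subr_le0 ler_pdivrMr // mulrC.
  by [].
split => //.
- move=> a0 ac.
  have na : `|al| = al by rewrite gtr0_norm.
  case: H => [[z _ _]|[_ h _]|[z _ _]|[[h1 _ _]|[h1 _ _]]].
  + by rewrite z ltxx in a0.
  + rewrite -na; apply: (side rm) => //; rewrite ?na // => _ le.
    by have := mulr_gt0 lam0 (Dp _ a0); move: jump le; clear; lra.
  + by have := lt_trans a0 z; rewrite ltxx.
  + by have := lt_le_trans h1 ac; rewrite ltxx.
  + by have := lt_trans h1 (ltac:(rewrite oppr_lt0; exact: mulr_gt0) : - (c * rp) < 0); move=> /(lt_trans a0); rewrite ltxx.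
- move=> a0 ac.
  have na : `|al| = - al by rewrite ltr0_norm.
  case: H => [[z _ _]|[z _ _]|[_ h _]|[[h1 _ _]|[h1 _ _]]].
  + by rewrite z ltxx in a0.
  + by have := lt_trans a0 z; rewrite ltxx.
  + rewrite -na; apply: (side rp) => //; [by rewrite mulrC|by rewrite na|move=> _ le].
    by have := Dn _ a0; rewrite -(pmulr_rlt0 _ lam0); move: jump le; clear; lra.
  + by have := lt_trans a0 (mulr_gt0 c0 rm0); move=> /(lt_trans h1); rewrite ltxx.
  + by move: h1; rewrite ltrNr ltNge ac.
Qed.

End Germ.

(** * Traces at the interface *)

Section Trace.
Context {R : realType}.
Local Notation state := (R * R)%type.

Lemma left_eps (f : R -> R) (v a : R) : f x @[x --> v^'-] --> a ->
  forall e, 0 < e -> exists2 d, 0 < d & forall x, v - d < x < v -> `|f x - a| <= e.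
Proof.
move=> h e e0; move/cvgrPdist_le: h => /(_ e e0) h.
have [d /= d0 hd] := h; exists d => // x /andP[x1 x2].
rewrite distrC; apply: hd => //=.
by rewrite ltr_norml; apply/andP; move: x1 x2 d0; clear; split; lra.
Qed.

Lemma left_unique (G : set R) (f g : R -> R) (v a b : R) : conull G ->
  f x @[x --> v^'-] --> a -> g x @[x --> v^'-] --> b -> (forall x, G x -> f x = g x) -> a = b.
Proof.
move=> cG fa gb E; apply/eqP; rewrite -subr_eq0 -normr_eq0.
suff h : `|a - b| <= 0 by apply/eqP/le_anti; rewrite h normr_ge0.
apply/ler_addgt0Pl => e e0; rewrite addr0.
have e2 : 0 < e / 2 by rewrite divr_gt0.
have [d1 d10 h1] := left_eps fa e2; have [d2 d20 h2] := left_eps gb e2.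
have lt : Num.max (v - d1) (v - d2) < v by rewrite gt_max; apply/andP; move: d10 d20; clear; split; lra.
have [x [Gx /andP[]]] := conull_dense cG lt; rewrite gt_max => /andP[x1 x2] xv.
have := h1 x ltac:(by rewrite x1 xv); have := h2 x ltac:(by rewrite x2 xv).
rewrite (E x Gx) !ler_norml => /andP[i1 i2] /andP[i3 i4].
by apply/andP; move: i1 i2 i3 i4; clear; split; lra.
Qed.

(** The relations that hold almost everywhere pass to the limit, since m and P are continuous. *)
Lemma trace_left c (rho q m P : R -> R) G (v r0 q0 : R) : simil c rho m P G ->
  (forall x, G x -> q x = m x + x * rho x) ->
  rho x @[x --> v^'-] --> r0 -> q x @[x --> v^'-] --> q0 ->
  m v = q0 - v * r0 /\ P v * r0 = m v ^+ 2 + c ^+ 2 * r0 ^+ 2.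
Proof.
move=> S qE hr hq.
have hm : m x @[x --> v^'-] --> m v by apply: cvg_at_left_filter; exact: (sm_mcont S).
have hP : P x @[x --> v^'-] --> P v by apply: cvg_at_left_filter; exact: (sm_Pcont S).
have hi : x @[x --> v^'-] --> v by apply: cvg_at_left_filter; exact: cvg_id.
split.
  apply: (left_unique (sm_G S) hm (cvgB hq (cvgM hi hr))).
  by move=> x Gx /=; rewrite qE // addrK.
apply: (left_unique (sm_G S) (cvgM hP hr) (cvgD (cvgM hm hm) (cvgM (cvg_cst (c ^+ 2)) (cvgM hr hr)))).
by move=> x Gx /=; rewrite (sm_q S Gx) !expr2.
Qed.

(** The predicate Q stands for what the interface condition imposes on the mass flux and on the jump,
which treats particle and wall alike. *)
Lemma interface_particle (c v rL qL rR qR : R) (Gm : state -> state -> Prop) (Q : R -> R -> Prop) U :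
  0 < c -> 0 < rL -> 0 < rR ->
  interface_riemann_solution c Gm v (rL, qL) (rR, qR) U ->
  (forall Um Up, 0 < Um.1 -> 0 < Up.1 -> Gm Um Up ->
    let al := Um.2 - v * Um.1 in
    [/\ al = Up.2 - v * Up.1, Q al (mom_flux c al Um.1 - mom_flux c al Up.1),
      (0 < al -> al <= c * Um.1 -> al <= c * Up.1) &
      (al < 0 -> - al <= c * Up.1 -> - al <= c * Um.1)]) ->
  exists al de rm rp A B, [/\ particle c rL (qL / rL) rR (qR / rR) v al de rm rp A B, Q al de,
    forall x, x < v -> U x = (f_rho A x, f_q A x) &
    forall x, v < x -> U x = (f_rho B x, f_q B x)].
Proof.
move=> c0 r0 rR0 [[rm qm] [[rp qp] [/= rm0 rp0 g [W1 [s1 l1 e1]] [W2 [s2 l2 e2]]]]] HG.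
have /= [ale Qal pp pn] := HG (rm, qm) (rp, qp) rm0 rp0 g.
set al := qm - v * rm in ale Qal pp pn.
have [mA [PA [GA hA]]] := euler_resolve c0 r0 rm0 s1.
have [mB [PB [GB hB]]] := euler_resolve c0 rp0 rR0 s2.
pose A := Flow (fst \o W1) (snd \o W1) mA PA GA.
pose B := Flow (fst \o W2) (snd \o W2) mB PB GB.
have um : qm / rm = v + al / rm by rewrite /al; field; rewrite gt_eqF.
have up : qp / rp = v + al / rp by rewrite ale; field; rewrite gt_eqF.
have r1 : (fst \o W1) x @[x --> v^'-] --> rm by exact: (cvg_comp _ _ l1 (@cvg_fst _ _ (nbhs rm) (nbhs qm) _)).
have q1 : (snd \o W1) x @[x --> v^'-] --> qm by exact: (cvg_comp _ _ l1 (@cvg_snd _ _ (nbhs rm) (nbhs qm) _)).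
have r2 : (fst \o W2) x @[x --> v^'+] --> rp by exact: (cvg_comp _ _ l2 (@cvg_fst _ _ (nbhs rp) (nbhs qp) _)).
have q2 : (snd \o W2) x @[x --> v^'+] --> qp by exact: (cvg_comp _ _ l2 (@cvg_snd _ _ (nbhs rp) (nbhs qp) _)).
have [mAv PAv] := trace_left (rm_simil hA) (rm_q hA) r1 q1.
have hB' := solves_opp (s := B) hB.
move/cvg_at_rightNP : r2 => r2; move/cvg_at_rightNP : q2 => q2.
have [mBv PBv] := trace_left (rm_simil hB') (rm_q hB') r2 (cvgN q2).
rewrite /= !opprK in mBv PBv.
have mBE : mB v = al by apply: oppr_inj; rewrite mBv ale; ring.
exists al, (mom_flux c al rm - mom_flux c al rp), rm, rp, A, B; split => //.
- split => //=.
  + by rewrite -um.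
  + by rewrite -up.
  + by rewrite PAv mAv.
  + by rewrite PBv sqrrN mBE.
  + exact: left_eps r1.
  + move=> e e0; have [d d0 hd] := left_eps r2 e0; exists d => // x /andP[x1 x2].
    have := hd (- x); rewrite /= opprK; apply.
    by apply/andP; move: x1 x2; clear; split; lra.
  + have : PA v = mom_flux c al rm.
      by apply: (mulIf (lt0r_neq0 rm0)); rewrite PAv mAv /mom_flux -/al; field; rewrite gt_eqF.
    have : PB v = mom_flux c al rp.
      by apply: (mulIf (lt0r_neq0 rp0)); rewrite PBv sqrrN mBE /mom_flux; field; rewrite gt_eqF.
    by move=> -> ->.
- by move=> x xv; rewrite e1 //=; case: (W1 x).
- by move=> x xv; rewrite e2 //=; case: (W2 x).
Qed.

End Trace.

(** * From profiles in xi to space-time *)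

Section L1loc.
Context {R : realType}.
Local Notation mu := (@lebesgue_measure R).
Local Notation state := (R * R)%type.

(** The integral of a nonnegative function is a supremum over simple functions, so no measurability
is involved and the set K below need not be shown measurable. *)
Lemma ge0_integral_mono d (T : measurableType d) (nu : {measure set T -> \bar R}) (f g : T -> \bar R) :
  (forall x, 0 <= f x)%E -> (forall x, f x <= g x)%E -> (\int[nu]_x f x <= \int[nu]_x g x)%E.
Proof.
move=> f0 fg; have g0 x : (0 <= g x)%E by apply: le_trans (f0 x) (fg x).
rewrite !ge0_integralTE //; apply: ereal_sup_le => _ [h hf <-].
by exists h => // x; exact: le_trans (hf x) (fg x).
Qed.

(** At fixed t > 0 the substitution x = t xi turns the inner integral into t times an integral over
|xi| <= X / t; the slice t = 0 is negligible. *)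
Lemma self_similar_integral (g : R -> R) (T X C : R) (K : set (R * R)) :
  locbm g -> (forall x, 0 <= g x) -> 0 <= T -> 0 <= X -> 0 <= C ->
  (forall t : R, 0 < t <= T -> t * Iab (- (X / t)) (X / t) g <= C) ->
  (forall z, K z -> 0 <= z.1 <= T /\ `|z.2| <= X) ->
  (\int[(mu \x mu)%E]_(z in K) (g (z.2 / z.1))%:E <= (T * C)%:E)%E.
Proof.
move=> lg g0 T0 X0 C0 HC HK; have [mg _] := lg.
pose F (z : R * R) := (\1_`[0, T]%classic z.1 * (\1_`[- X, X]%classic z.2 * g (z.2 / z.1)))%:E.
have F0 z : (0 <= F z)%E by rewrite lee_fin !mulr_ge0 // ?indicE.
have mI (a b : R) : measurable_fun setT (\1_`[a, b]%classic : R -> R) by exact: measurable_indic.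
have mF : measurable_fun setT F.
  apply/measurable_EFinP; apply: measurable_funM; first exact: measurableT_comp (mI 0 T) measurable_fst.
  apply: measurable_funM; first exact: measurableT_comp (mI (- X) X) measurable_snd.
  apply: measurableT_comp mg _; apply: measurable_funM => //.
  by apply: measurableT_comp => //; exact: measurable_inv.
apply: (@le_trans _ _ (\int[(mu \x mu)%E]_z F z)%E).
  rewrite integral_mkcond; apply: ge0_integral_mono => z; rewrite patchE; case: ifP => [|_] //.
    by rewrite lee_fin.
  rewrite inE => /HK [z1 z2].
  have i1 : (z.1 : R) \in `[0, T]%classic by rewrite inE /= in_itv.
  have i2 : (z.2 : R) \in `[- X, X]%classic by rewrite inE /= in_itv /= -ler_norml.
  by rewrite /F !indicE i1 i2 !mul1r.
rewrite fubini_tonelli1 //.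
apply: (@le_trans _ _ (\int[mu]_t (C * \1_`[0, T]%classic t)%:E)%E); last first.
  have -> : (\int[mu]_t (C * \1_`[0, T]%classic t)%:E = \int[mu]_(t in `[0%R, T]) C%:E)%E.
    rewrite [RHS]integral_mkcond; apply: eq_integral => t _; rewrite patchE indicE.
    by case: ifP => h; rewrite ?mulr1 ?mulr0.
  rewrite integral_cst //= lebesgue_measure_itv /= lte_fin.
  move: T0; rewrite le_eqVlt => /predU1P[<-|->]; first by rewrite ltxx mule0 mul0r.
  by rewrite -EFinM lee_fin subr0 mulrC.
have mphi := measurable_fun_fubini_tonelli_F F mF F0 (m2 := mu).
apply: ae_ge0_le_integral => //.
- by move=> t _; apply: integral_ge0 => x _; exact: F0.
- by move=> t _; rewrite lee_fin mulr_ge0 // indicE.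
- by apply/measurable_EFinP; apply: measurable_funM.
apply: negligibleS (@conullD1 R 0) => t /= h t0; apply: h => _.
rewrite /fubini_F /F /=.
have [tT|tT] := boolP (t \in `[0, T]%classic); last first.
  rewrite indicE (negbTE tT) mulr0 integral0_eq // => x _.
  by rewrite mul0r.
rewrite [in leRHS]indicE tT mulr1.
move: (tT); rewrite inE /= in_itv /= => /andP[t1 t2].
have tp : 0 < t by rewrite lt_neqAle t1 andbT eq_sym; exact/eqP.
have mf : measurable_fun setT (fun x => F (t, x)) by exact: (measurableT_comp mF (pair1_measurable t)).
have := @ge0_integral_scale _ t (lt0r_neq0 tp) (fun x => F (t, x)) mf (fun x => F0 (t, x)).
rewrite /F /= => ->.
have -> : (\int[mu]_x (\1_`[0, T]%classic t * (\1_`[- X, X]%classic (t * x) * g (t * x / t)))%:E =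
    \int[mu]_(x in `[(- (X / t))%R, (X / t)%R]) (g x)%:E)%E.
  rewrite [RHS]integral_mkcond; apply: eq_integral => x _; rewrite patchE !indicE tT mul1r.
  have -> : t * x / t = x by field; rewrite gt_eqF.
  have -> : (t * x \in `[- X, X]%classic) = (x \in `[- (X / t), X / t]%classic).
    apply/idP/idP; rewrite !inE /= !in_itv /= -!ler_norml normrM (gtr0_norm tp) ler_pdivlMr //;
    by rewrite mulrC.
  by case: ifP => _; rewrite ?mul1r ?mul0r.
have -> : (\int[mu]_(x in `[(- (X / t))%R, (X / t)%R]) (g x)%:E = (Iab (- (X / t)) (X / t) g)%:E)%E.
  by rewrite /Iab /Rintegral fineK //; apply: integrable_fin_num => //; exact: locbm_int.
rewrite -EFinM lee_fin gtr0_norm //; apply: HC.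
by rewrite tp t2.
Qed.

Definition profile_dist (U V : R -> state) (x : R) := `|(U x).1 - (V x).1| + `|(U x).2 - (V x).2|.

(** The bound depends on the window because the distance in q is at most that in m plus |xi| times
that in rho. *)
Definition profile_near (e : R) (U V : R -> state) :=
  locbm (profile_dist U V) /\
  forall Y, 0 <= Y -> Iab (- Y) Y (profile_dist U V) <= 2 * Y * e + (1 + Y) * (2 * e).

Lemma compact_box (K : set (R * R)) : compact K -> exists2 M : R, 0 < M & forall z, K z -> `|z.1| <= M /\ `|z.2| <= M.
Proof.
move=> /compact_bounded [M [_ HM]]; exists (`|M| + 1); first by have := normr_ge0 M; lra.
move=> z /(HM (`|M| + 1) _) h.
have {h} : `|z| <= `|M| + 1 by apply: h; have := ler_norm M; lra.
by rewrite prod_normE ge_max => /andP.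
Qed.

Lemma cvg_L1loc_near (F : set_system R) {FF : Filter F} (U : R -> R -> state) (V : R -> state) :
  (forall e, 0 < e -> \forall lam \near F, profile_near e (U lam) V) ->
  cvg_L1loc F (fun lam => self_similar (U lam)) (self_similar V).
Proof.
move=> H K cK K0.
have [M M0 HM] := compact_box cK.
have box z : K z -> 0 <= z.1 <= M /\ `|z.2| <= M.
  move=> Kz; have [h1 h2] := HM z Kz; split => //.
  by apply/andP; split; [exact: K0|apply: le_trans h1; exact: ler_norm].
pose I lam := (\int[(mu \x mu)%E]_(z in K) (`|(self_similar (U lam) z.1 z.2).1 - (self_similar V z.1 z.2).1|
        + `|(self_similar (U lam) z.1 z.2).2 - (self_similar V z.1 z.2).2|)%:E)%E.
have I0 lam : (0 <= I lam)%E by apply: integral_ge0 => z _; rewrite lee_fin addr_ge0.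
have key e lam : 0 < e -> profile_near e (U lam) V -> (I lam <= (6 * M ^+ 2 * e)%:E)%E.
  move=> e0 [l1 l2].
  have -> : 6 * M ^+ 2 * e = M * (6 * M * e) by ring.
  apply: (@self_similar_integral (profile_dist (U lam) V) M M) => //; rewrite ?(ltW M0) //.
  - by move=> x; rewrite addr_ge0.
  - by rewrite !mulr_ge0 // ltW.
  move=> t /andP[t0 tM].
  have Y0 : 0 <= M / t by rewrite divr_ge0 // ltW.
  have := l2 _ Y0; rewrite -(ler_pM2l t0) => /le_trans; apply.
  have -> : t * (2 * (M / t) * e + (1 + M / t) * (2 * e)) = (4 * M + 2 * t) * e.
    by field; rewrite gt_eqF.
  by rewrite ler_pM2r //; move: tM; clear; lra.
have fin e lam : 0 < e -> profile_near e (U lam) V -> I lam \is a fin_num.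
  by move=> e0 h; rewrite ge0_fin_numE //; exact: le_lt_trans (key _ _ e0 h) (ltry _).
apply/fine_cvgP; split.
  near=> lam; apply: (fin 1) => //; near: lam; exact: H.
apply/cvgrPdist_le => e e0.
have k0 : 0 < 6 * M ^+ 2 by rewrite mulr_gt0 // exprn_gt0.
have d0 : 0 < e / (6 * M ^+ 2) by rewrite divr_gt0.
near=> lam.
have h : profile_near (e / (6 * M ^+ 2)) (U lam) V by near: lam; exact: H.
have le := key _ _ d0 h; rewrite (mulrC (6 * _)) (divfK (lt0r_neq0 k0)) in le.
rewrite sub0r normrN /= ger0_norm; last by apply: fine_ge0; exact: I0.
by rewrite -lee_fin fineK //; exact: fin h.
Unshelve. all: by end_near.
Qed.

Lemma flow_profile (c rL uL rR uR rL1 uL1 rR1 uR1 rL2 uL2 rR2 uR2 rL3 uL3 rR3 uR3 v e : R)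
    (A B A' B' : @flow R) (U V : R -> state) :
  solves c rL uL rR uR A -> solves c rL1 uL1 rR1 uR1 B ->
  solves c rL2 uL2 rR2 uR2 A' -> solves c rL3 uL3 rR3 uR3 B' ->
  (forall x, x < v -> U x = (f_rho A x, f_q A x)) -> (forall x, v < x -> U x = (f_rho B x, f_q B x)) ->
  (forall x, x < v -> V x = (f_rho A' x, f_q A' x)) -> (forall x, v < x -> V x = (f_rho B' x, f_q B' x)) ->
  0 <= e -> near_flow v e A B A' B' -> profile_near e U V.
Proof.
move=> hA hB hA' hB' UA UB VA VB e0 [n1 n2 n3 n4].
pose dr (s t : @flow R) x := `|f_rho s x - f_rho t x|.
have ldr (s t : @flow R) a1 a2 a3 a4 b1 b2 b3 b4 : solves c a1 a2 a3 a4 s -> solves c b1 b2 b3 b4 t -> locbm (dr s t).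
  by move=> H1 H2; exact: locbm_norm (locbmB (sm_loc (rm_simil H1)) (sm_loc (rm_simil H2))).
pose gq (s t : @flow R) x := dr s t x + `|f_q s x - f_q t x|.
have lgq (s t : @flow R) a1 a2 a3 a4 b1 b2 b3 b4 : solves c a1 a2 a3 a4 s -> solves c b1 b2 b3 b4 t -> locbm (gq s t).
  move=> H1 H2; apply: locbmD; first exact: ldr H1 H2.
  exact: locbm_norm (locbmB (rm_qloc H1) (rm_qloc H2)).
have lU : locbm (profile_dist U V).
  have -> : profile_dist U V = fun x => if x < v then gq A A' x else if v < x then gq B B' x else profile_dist U V v.
    apply/funext => x; case: ltP => [xv|vx]; first by rewrite /profile_dist UA // VA.
    case: ltP => [vx'|xv]; first by rewrite /profile_dist UB // VB.
    by congr profile_dist; apply/le_anti; rewrite vx xv.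
  apply: locbm_ifb; [exact: measurable_fun_ltr|exact: lgq hA hA'|].
  apply: locbm_ifb; [exact: measurable_fun_ltr|exact: lgq hB hB'|exact: locbm_cst].
split=> // Y Y0.
pose h x := if x < v then dr A A' x else dr B B' x.
have lh : locbm h.
  apply: locbm_ifb; [exact: measurable_fun_ltr|exact: ldr hA hA'|exact: ldr hB hB'].
have YY : - Y <= Y by move: Y0; clear; lra.
have left a b : a <= b -> b <= v -> Iab a b h <= e.
  move=> ab bv; apply: le_trans (n1 a b ab bv); rewrite (@Iab_ae _ setT _ (dr A A')) //; [exact: conullT|exact: ldr hA hA'|].
  by move=> z _ /andP[_ zb]; rewrite /h ifT //; exact: lt_le_trans bv.
have right a b : v <= a -> a <= b -> Iab a b h <= e.
  move=> va ab; apply: le_trans (n2 a b va ab); rewrite (@Iab_ae _ setT _ (dr B B')) //; [exact: conullT|exact: ldr hB hB'|].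
  by move=> z _ /andP[az _]; rewrite /h ifF //; apply/negbTE; rewrite -leNgt; apply: le_trans va (ltW az).
have toth : Iab (- Y) Y h <= 2 * e.
  have [Yv|vY] := leP Y v; first by have := left _ _ YY Yv; move: e0; clear; lra.
  have [vY'|Yv'] := leP v (- Y); first by have := right _ _ vY' YY; move: e0; clear; lra.
  rewrite (Iab_split lh (ltW Yv') (ltW vY)).
  by have := left _ _ (ltW Yv') (lexx _); have := right _ _ (lexx _) (ltW vY); clear; lra.
pose G := f_G A `&` f_G B `&` f_G A' `&` f_G B' `&` [set x | x <> v].
have cG : conull G.
  by do !apply: conullI; [exact: sm_G (rm_simil hA)|exact: sm_G (rm_simil hB)|exact: sm_G (rm_simil hA')|exact: sm_G (rm_simil hB')|exact: conullD1].
have pt (r r' m m' x : R) : `|x| <= Y -> `|m - m'| <= e ->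
    `|r - r'| + `|(m + x * r) - (m' + x * r')| <= e + (1 + Y) * `|r - r'|.
  move=> xY me; have -> : (m + x * r) - (m' + x * r') = (m - m') + x * (r - r') by ring.
  have := ler_normD (m - m') (x * (r - r')); rewrite normrM.
  have := ler_wpM2r (normr_ge0 (r - r')) xY.
  by move: me; clear; lra.
apply: (@le_trans _ _ (Iab (- Y) Y (fun x => e + (1 + Y) * h x))).
  apply: (Iab_le cG) => //; first exact: locbmD (locbm_cst _) (locbmM (locbm_cst _) lh).
  move=> x [[[[gA gB] gA'] gB'] nv] /andP[x1 x2].
  have xY : `|x| <= Y by rewrite ler_norml (ltW x1) (ltW x2).
  rewrite /h; case: ltP => [xv|vx].
    rewrite /profile_dist UA // VA //= (rm_q hA gA) (rm_q hA' gA').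
    by apply: pt => //; apply: n3; exact: ltW.
  have vx' : v < x by rewrite lt_neqAle vx andbT eq_sym; exact/eqP.
  rewrite /profile_dist UB // VB //= (rm_q hB gB) (rm_q hB' gB').
  by apply: pt => //; exact: n4.
rewrite IabD; [|exact: locbm_cst|exact: locbmM (locbm_cst _) lh].
rewrite Iab_cst // IabZ //.
have := ler_wpM2l (ltac:(by move: Y0; clear; lra) : 0 <= 1 + Y) toth.
by clear; lra.
Qed.

End L1loc.

(** * Strong and weak drag *)

Section Limits.
Context {R : realType}.
Local Notation state := (R * R)%type.

Lemma drag_particle (c lam v rL qL rR qR : R) (D0 : R -> R) U : 0 < c -> drag_force D0 -> 0 < rL -> 0 < rR -> 0 < lam ->
  particle_riemann_solution c (fun a => lam * D0 a) v (rL, qL) (rR, qR) U ->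
  exists al de rm rp A B, [/\ particle c rL (qL / rL) rR (qR / rR) v al de rm rp A B, de = lam * D0 al,
    forall x, x < v -> U x = (f_rho A x, f_q A x) &
    forall x, v < x -> U x = (f_rho B x, f_q B x)].
Proof.
move=> c0 hD r0 rR0 lam0 H.
apply: (@interface_particle _ _ _ _ _ _ _ _ (fun al de => de = lam * D0 al) _ c0 r0 rR0 H).
by move=> Um Up _ _ g; exact: germ_jump c0 lam0 hD g.
Qed.

Lemma wall_particle (c v rL qL rR qR : R) U : 0 < c -> 0 < rL -> 0 < rR ->
  wall_riemann_solution c v (rL, qL) (rR, qR) U ->
  exists de rm rp A B, [/\ particle c rL (qL / rL) rR (qR / rR) v 0 de rm rp A B,
    forall x, x < v -> U x = (f_rho A x, f_q A x) &
    forall x, v < x -> U x = (f_rho B x, f_q B x)].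
Proof.
move=> c0 r0 rR0 H.
have [|al [de [rm [rp [A [B [pt al0 UA UB]]]]]]] := @interface_particle _ _ _ _ _ _ _ _ (fun al _ => al = 0) _ c0 r0 rR0 H.
  move=> Um Up _ _ [-> ->]; rewrite subrr /=; split => //; first by rewrite subrr.
  - by rewrite ltxx.
  - by rewrite ltxx.
by rewrite al0 in pt; exists de, rm, rp, A, B.
Qed.

(** The jump lam D0(al) stays below the wall pressure and D0 is monotone, so al falls below any
threshold. *)
Lemma strong_drag (c v rL qL rR qR : R) (D0 : R -> R) (U : R -> R -> state) (V : R -> state) :
  0 < c -> drag_force D0 -> 0 < rL -> 0 < rR ->
  (forall lam, 0 < lam -> particle_riemann_solution c (fun a => lam * D0 a) v (rL, qL) (rR, qR) (U lam)) ->
  wall_riemann_solution c v (rL, qL) (rR, qR) V ->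
  forall e, 0 < e -> \forall lam \near +oo, profile_near e (U lam) V.
Proof.
move=> c0 hD r0 rR0 HU HV e e0.
have [de' [rm' [rp' [VA [VB [ptV VEA VEB]]]]]] := wall_particle c0 r0 rR0 HV.
have ptV' := particle_opp ptV; rewrite oppr0 in ptV'.
have [a1 a10 H1] := wall_limit c0 r0 rR0 e0 ptV.
have [a2 a20 H2] := wall_limit c0 rR0 r0 e0 ptV'.
have [_ mono D00 Dp Dn] := hD.
pose p := `|f_P VA v| + `|f_P VB v|.
have d1 := Dp _ a10; have d2 : 0 < - D0 (- a2) by rewrite oppr_gt0; apply: Dn; rewrite oppr_lt0.
near=> lam.
have lam0 : 0 < lam by near: lam; apply: nbhs_pinfty_gt; rewrite num_real.
have l1 : p < lam * D0 a1.
  by rewrite -ltr_pdivrMr //; near: lam; apply: nbhs_pinfty_gt; rewrite num_real.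
have l2 : p < lam * - D0 (- a2).
  by rewrite -ltr_pdivrMr //; near: lam; apply: nbhs_pinfty_gt; rewrite num_real.
have [al [de [rm [rp [A [B [pt deE UA UB]]]]]]] := drag_particle c0 hD r0 rR0 lam0 (HU lam lam0).
apply: (flow_profile (pt_A pt) (pt_B pt) (pt_A ptV) (pt_B ptV) UA UB VEA VEB (ltW e0)).
have [al0|al0] := leP 0 al.
  apply: (H1 _ _ _ _ _ _ pt al0); rewrite leNgt; apply/negP => lt.
  have := wall_jump c0 r0 ptV pt al0; rewrite deE leNgt => /negP; apply.
  apply: (@lt_le_trans _ _ (lam * D0 a1)); last by rewrite ler_pM2l //; apply: mono; exact: ltW.
  by apply: le_lt_trans l1; rewrite /p; have := ler_norm (f_P VA v); have := normr_ge0 (f_P VB v); clear; lra.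
have pt' := particle_opp pt.
have nal0 : 0 <= - al by rewrite oppr_ge0 ltW.
apply: (near_flow_opp (pt_A pt) (pt_B pt) (pt_A ptV) (pt_B ptV)).
apply: (H2 _ _ _ _ _ _ pt' nal0); rewrite leNgt; apply/negP => lt.
have := wall_jump c0 rR0 ptV' pt' nal0; rewrite deE /= opprK leNgt => /negP; apply.
rewrite -mulrN; apply: (@lt_le_trans _ _ (lam * - D0 (- a2))); last first.
  by rewrite ler_pM2l // lerN2; apply: mono; rewrite lerNr ltW.
by apply: le_lt_trans l2; rewrite /p; have := ler_norm (f_P VB v); have := normr_ge0 (f_P VA v); clear; lra.
Unshelve. all: by end_near.
Qed.

(** The mass flux al is bounded independently of lam, hence lam D0(al) tends to 0. *)
Lemma weak_drag (c v rL qL rR qR : R) (D0 : R -> R) (U : R -> R -> state) (V : R -> state) :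
  0 < c -> drag_force D0 -> 0 < rL -> 0 < rR ->
  (forall lam, 0 < lam -> particle_riemann_solution c (fun a => lam * D0 a) v (rL, qL) (rR, qR) (U lam)) ->
  euler_riemann_solution c (rL, qL) (rR, qR) V ->
  forall e, 0 < e -> \forall lam \near 0^'+, profile_near e (U lam) V.
Proof.
move=> c0 hD r0 rR0 HU HV e e0.
have [m [P [G hV]]] := euler_resolve c0 r0 rR0 HV.
pose W := Flow (fst \o V) (snd \o V) m P G.
have sW : solves c rL (qL / rL) rR (qR / rR) W by [].
have [d1 d10 H1] := euler_limit v c0 r0 rR0 e0 sW.
have [d2 d20 H2] := euler_limit (- v) c0 rR0 r0 e0 (solves_opp sW).
have [_ mono D00 Dp Dn] := hD.
pose b1 := rL * (qL / rL - (Num.min v (qL / rL) - c)).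
pose b2 := rR * (- (qR / rR) - (Num.min (- v) (- (qR / rR)) - c)).
pose C := `|D0 b1| + `|D0 (- b2)| + 1.
have C0 : 0 < C by rewrite ltr_wpDl // addr_ge0.
have WE x : V x = (f_rho W x, f_q W x) by rewrite /=; case: (V x).
near=> lam.
have lam0 : 0 < lam by near: lam; exact: nbhs_right_gt.
have l1 : lam * C <= d1.
  by rewrite -ler_pdivlMr //; near: lam; apply: nbhs_right_le; rewrite divr_gt0.
have l2 : lam * C <= d2.
  by rewrite -ler_pdivlMr //; near: lam; apply: nbhs_right_le; rewrite divr_gt0.
have [al [de [rm [rp [A [B [pt deE UA UB]]]]]]] := drag_particle c0 hD r0 rR0 lam0 (HU lam lam0).
apply: (flow_profile (pt_A pt) (pt_B pt) sW sW UA UB (fun x _ => WE x) (fun x _ => WE x) (ltW e0)).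
have sgn a : 0 <= a -> 0 <= D0 a by move=> h; rewrite -D00; exact: mono.
have [al0|al0] := leP 0 al.
  have ab := flux_bound c0 r0 pt al0; rewrite -/b1 in ab.
  apply: (H1 _ _ _ _ _ _ pt al0); rewrite deE.
  - by move=> /Dp h; exact: mulr_gt0.
  - by rewrite mulr_ge0 ?sgn // ltW.
  - apply: le_trans l1; rewrite ler_pM2l //; apply: le_trans (mono _ _ ab) _.
    by rewrite /C; have := ler_norm (D0 b1); have := normr_ge0 (D0 (- b2)); clear; lra.
have pt' := particle_opp pt.
have nal0 : 0 <= - al by rewrite oppr_ge0 ltW.
have ab := flux_bound c0 rR0 pt' nal0; rewrite -/b2 in ab.
apply: (near_flow_opp (pt_A pt) (pt_B pt) sW sW).
apply: (H2 _ _ _ _ _ _ pt' nal0); rewrite deE -mulrN.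
- by move=> _; apply: mulr_gt0 => //; rewrite oppr_gt0 Dn.
- by rewrite mulr_ge0 ?(ltW lam0) // oppr_ge0 ltW // Dn.
- apply: le_trans l2; rewrite ler_pM2l //.
  apply: (@le_trans _ _ (- D0 (- b2))); first by rewrite lerN2; apply: mono; rewrite lerNl.
  by rewrite /C; have := ler_norm (- D0 (- b2)); rewrite normrN; have := normr_ge0 (D0 b1); clear; lra.
Unshelve. all: by end_near.
Qed.

End Limits.

Theorem proposition3p14 (R : realType) (c : R) (D0 : R -> R)
    (v rhoL qL rhoR qR : R) (U : R -> R -> R * R) :
  0 < c -> drag_force D0 -> 0 < rhoL -> 0 < rhoR ->
  (forall lam : R, 0 < lam ->
     particle_riemann_solution c (fun alpha => lam * D0 alpha) v
       (rhoL, qL) (rhoR, qR) (U lam)) ->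
  (forall V : R -> R * R,
     wall_riemann_solution c v (rhoL, qL) (rhoR, qR) V ->
     cvg_L1loc +oo (fun lam => self_similar (U lam)) (self_similar V)) /\
  (forall V : R -> R * R,
     euler_riemann_solution c (rhoL, qL) (rhoR, qR) V ->
     cvg_L1loc 0^'+ (fun lam => self_similar (U lam)) (self_similar V)).
Proof.
move=> c0 hD rL0 rR0 HU; split => V HV; apply: cvg_L1loc_near => e e0.
  exact: strong_drag HU HV e e0.
exact: weak_drag HU HV e e0.
Qed.
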